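(* Let $X$ be a (complex) Banach space, let $n \geq 1$ be an integer and suppose $1 \leq p < \infty$. Then there exists a contractive projection $P_{p,X} \colon \mathfrak{M}^{p}(\mathbb{R}^n,X) \to \mathfrak{M}^{p}(\mathbb{R}^n,X)$ (that is, a linear map with $P_{p,X}\circ P_{p,X} = P_{p,X}$ and $\|P_{p,X}(\phi)\|_{\mathfrak{M}^p(\mathbb{R}^n,X)} \leq \|\phi\|_{\mathfrak{M}^p(\mathbb{R}^n,X)}$ for all $\phi$) whose range is exactly the subspace $\mathfrak{M}^{p}_{\mathrm{rad}}(\mathbb{R}^n,X)$ of radial multipliers. Moreover, in the case $X=\mathbb{C}$, the map $M_{P_{p,\mathbb{C}}(\phi)} \colon \mathrm{L}^p(\mathbb{R}^n) \to \mathrm{L}^p(\mathbb{R}^n)$ associated to the radial multiplier $P_{p,\mathbb{C}}(\phi)$ is positive whenever $\phi \in \mathfrak{M}^p(\mathbb{R}^n,\mathbb{C})$ is such that the map $M_\phi \colon \mathrm{L}^p(\mathbb{R}^n) \to \mathrm{L}^p(\mathbb{R}^n)$ is positive.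
   Context: $\mathrm{L}^p(\mathbb{R}^n,X)$ denotes the Bochner space of (classes of) strongly measurable $p$-integrable functions $\mathbb{R}^n \to X$ with respect to Lebesgue measure, and $\mathrm{L}^p(\mathbb{R}^n) = \mathrm{L}^p(\mathbb{R}^n,\mathbb{C})$. $\mathcal{F}^{-1}$ denotes the inverse Fourier transform and $\hat f$ the Fourier transform of $f$. Fourier multipliers: a (scalar-valued) function $\phi \in \mathrm{L}^\infty(\mathbb{R}^n)$ (functions equal almost everywhere being identified) belongs to $\mathfrak{M}^p(\mathbb{R}^n,X)$ if the map $f \mapsto \mathcal{F}^{-1}(\phi \hat f)$, defined for those $f \in \mathrm{L}^p(\mathbb{R}^n,X)$ which are of the form $f=\mathcal{F}^{-1}(g)$ with $g \in \mathrm{L}^1(\mathbb{R}^n,X)$ (and then $\hat f = g$), takes values in $\mathrm{L}^p(\mathbb{R}^n,X)$ and is bounded for the norm of $\mathrm{L}^p(\mathbb{R}^n,X)$. Since such $f$ are dense in $\mathrm{L}^p(\mathbb{R}^n,X)$, this map extends uniquely to a bounded operator on $\mathrm{L}^p(\mathbb{R}^n,X)$; the norm $\|\phi\|_{\mathfrak{M}^p(\mathbb{R}^n,X)}$ is the norm of this operator in the Banach space of bounded operators on $\mathrm{L}^p(\mathbb{R}^n,X)$. When $X=\mathbb{C}$ this operator is denoted $M_\phi \colon \mathrm{L}^p(\mathbb{R}^n) \to \mathrm{L}^p(\mathbb{R}^n)$. Radial: with $|\cdot|$ the Euclidean norm on $\mathbb{R}^n$, a function $\phi \colon \mathbb{R}^n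 \to \mathbb{C}$ is radial if $\phi(x) = \dot\phi(|x|)$ for some function $\dot\phi \colon \mathbb{R}_+ \to \mathbb{C}$ (for a class in $\mathrm{L}^\infty(\mathbb{R}^n)$ this means that some representative has this property). $\mathfrak{M}^p_{\mathrm{rad}}(\mathbb{R}^n,X) = \{\phi \in \mathfrak{M}^p(\mathbb{R}^n,X) : \phi \text{ is radial}\}$, with the norm induced from $\mathfrak{M}^p(\mathbb{R}^n,X)$. Positivity: a bounded linear operator $T \colon \mathrm{L}^p(\mathbb{R}^n) \to \mathrm{L}^p(\mathbb{R}^n)$ is positive if $T(f) \geq 0$ for every $f \geq 0$. *)

(* Defs.v *)
From HB Require Import structures.
From mathcomp Require Import all_boot all_order all_algebra.
From mathcomp Require Import all_classical all_reals all_analysis.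
From mathcomp Require Import complex.

Set Implicit Arguments.
Unset Strict Implicit.
Unset Printing Implicit Defensive.

Import Order.TTheory GRing.Theory Num.Theory.
Import numFieldNormedType.Exports.

Local Open Scope classical_set_scope.
Local Open Scope ring_scope.
Local Open Scope complex_scope.

Lemma complex_complete (R : realType) (F : set_system R[i]^o) :
  ProperFilter F -> cauchy F -> cvg F.
Proof.
move=> FF /cauchyP Fc.
pose re (z : R[i]^o) : R := complex.Re z.
pose im (z : R[i]^o) : R := complex.Im z.
have Hball (h : R[i]^o -> R) :
    (forall z w, (`|h z - h w|)%:C <= `|z - w|) -> cvg (h @ F).
  move=> hle; apply/cauchy_cvgP/cauchyP => e e0.
  have e0' : 0 < e%:C by rewrite ltcR.
  have [z Fz] := Fc _ e0'.
  exists (h z); apply: (filterS _ Fz : F (h @^-1` ball (h z) e)) => w.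
  rewrite /preimage /= -!ball_normE /= => zw.
  by rewrite -ltcR; apply: le_lt_trans zw; exact: hle.
have /cvg_ex[a ha] : cvg (re @ F).
  by apply: Hball => z w; rewrite /re -raddfB; exact: normc_ge_Re.
have /cvg_ex[b hb] : cvg (im @ F).
  apply: Hball => z w; rewrite /im -raddfB; case: (z - w) => x y.
  by rewrite normc_def lecR /= -sqrtr_sqr ler_wsqrtr // lerDr sqr_ge0.
apply/cvg_ex; exists (a +i* b : R[i]^o).
apply/cvgrPdist_lt => e e0.
have eE : e = (complex.Re e)%:C by rewrite RRe_real// gtr0_real.
have e20 : 0 < complex.Re e / 2 by rewrite divr_gt0// -ltcR -eE.
move/cvgrPdist_lt : ha => /(_ _ e20) ha.
move/cvgrPdist_lt : hb => /(_ _ e20) hb.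
near=> z.
have za : `|a - re z| < complex.Re e / 2 by near: z.
have zb : `|b - im z| < complex.Re e / 2 by near: z.
have normleD (x y : R) : `|x +i* y : R[i]| <= (`|x| + `|y|)%:C.
  rewrite normc_def lecR /= -[leRHS]ger0_norm ?addr_ge0// -sqrtr_sqr.
  by rewrite ler_wsqrtr// sqrrD !real_normK ?num_real// addrAC lerDl
    mulrn_wge0// mulr_ge0.
have -> : (a +i* b : R[i]^o) - z =
    ((a - complex.Re (z : R[i])) +i* (b - complex.Im (z : R[i])) : R[i]).
  by clear; case: z.
by apply: le_lt_trans (normleD _ _) _; rewrite eE ltcR [ltRHS]splitr ltrD.
Unshelve. all: by end_near.
Qed.

HB.instance Definition _ (R : realType) := GRing.ComAlgebra.copy R[i] R[i]^o.
HB.instance Definition _ (R : realType) := Vector.copy R[i] R[i]^o.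
HB.instance Definition _ (R : realType) := NormedModule.copy R[i] R[i]^o.
HB.instance Definition _ (R : realType) :=
  Uniform_isComplete.Build R[i] (@complex_complete R).

Section lebesgue_measure_Rn.
Variable R : realType.
Local Notation mR := (measurableTypeR R).

Lemma measurable_tcons (n : nat) : measurable_fun [set: mR * n.-tuple mR]
  (fun x : mR * n.-tuple mR => [the n.+1.-tuple mR of x.1 :: x.2]).
Proof. exact: measurable_cons. Qed.

Definition cons_measure (n : nat)
    (mu : {measure set (mR * n.-tuple mR) -> \bar R}) :
    {measure set (n.+1.-tuple mR) -> \bar R} :=
  measure_function_pushforward__canonical__measure_function_Measure
    mu (@measurable_tcons n).

(* Lebesgue measure on the Borel sigma-algebra of R^n, as an iterated product
   transported along R * R^n = R^(n+1). The reversed product [\x^] agrees with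
   [\x] on sigma-finite measures, and its structure of measure only requires
   the left factor to be sigma-finite. *)
Fixpoint lebesgue_Rn (n : nat) : {measure set (n.-tuple mR) -> \bar R} :=
  match n with
  | 0 => \d_([tuple] : 0.-tuple mR)
  | m.+1 => cons_measure (lebesgue_measure \x^ lebesgue_Rn m)%E
  end.
End lebesgue_measure_Rn.

Notation Rn R n := (n.-tuple (measurableTypeR R)).

Section euclidean.
Context {R : realType} {n : nat}.
Definition dotp (x y : Rn R n) : R := \sum_(i < n) tnth x i * tnth y i.
Definition enorm (x : Rn R n) : R := Num.sqrt (\sum_(i < n) tnth x i ^+ 2).
End euclidean.

(* The norm of a complex normed space takes its values in the nonnegative reals
   of [R[i]]. *)
Definition rnorm {R : realType} {X : normedModType R[i]} (x : X) : R :=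
  complex.Re `|x|.

Section bochner.
Context {d} {T : measurableType d} {R : realType}.
Variables (mu : {measure set T -> \bar R}) (X : normedModType R[i]).
Implicit Types (f g s : T -> X) (p : R).

Definition simple_fun s :=
  finite_set (range s) /\ forall y, measurable (s @^-1` [set y]).

(* On R^n the simple functions are Borel and the convergence holds everywhere;
   every almost everywhere limit of Lebesgue simple functions is almost
   everywhere equal to such a function, so the classes are the usual ones. *)
Definition strongly_measurable f :=
  exists s : (T -> X)^nat, (forall k, simple_fun (s k)) /\
    forall x, s k x @[k --> \oo] --> f x.

Definition Lpnorm p f : \bar R := 'N[mu]_(p%:E)[EFin \o rnorm \o f]%E.

(* Elements of the Bochner space are represented by functions; equality is
   equality almost everywhere. *)
Definition Lp p f := strongly_measurable f /\ (Lpnorm p f < +oo)%E.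

Definition simple_integrable s := simple_fun s /\
  forall y, y != 0 -> (mu (s @^-1` [set y]) < +oo)%E.

Definition simple_integral s : X :=
  \sum_(y \in range s) (fine (mu (s @^-1` [set y])))%:C *: y.

Definition is_bochner_integral f (v : X) :=
  exists s : (T -> X)^nat,
    [/\ strongly_measurable f,
        forall k, simple_integrable (s k),
        Lpnorm 1 (s k \- f) @[k --> \oo] --> 0%E &
        simple_integral (s k) @[k --> \oo] --> v].

Definition bochner_integral f : X := xget 0 (is_bochner_integral f).

Definition ess_bounded f := exists M : R, \forall x \ae mu, rnorm (f x) <= M.

Definition Linfty f := strongly_measurable f /\ ess_bounded f.

(* Bounded linear operators on the Banach space of classes of p-integrable
   functions. *)
Definition bounded_operator p (U : (T -> X) -> T -> X) :=
  [/\ forall f, Lp p f -> Lp p (U f),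
      forall f g, Lp p f -> Lp p g -> f = g %[ae mu] -> U f = U g %[ae mu],
      forall (a : R[i]) f g, Lp p f -> Lp p g ->
        U (a \*: f \+ g) = a \*: U f \+ U g %[ae mu] &
      exists C : R, forall f, Lp p f -> (Lpnorm p (U f) <= C%:E * Lpnorm p f)%E].

Definition operator_norm p (U : (T -> X) -> T -> X) : \bar R :=
  ereal_sup [set Lpnorm p (U f) | f in [set f | Lp p f /\ (Lpnorm p f <= 1)%E]].
End bochner.

Section multipliers.
Context {R : realType} (n : nat) (p : R).
Local Notation E := (Rn R n).
Local Notation mu := (@lebesgue_Rn R n).

(* Inverse Fourier transform, with kernel exp(2 i pi <x, xi>). *)
Definition inverse_fourier (X : normedModType R[i]) (g : E -> X) (x : E) : X :=
  bochner_integral mu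
    (fun xi => let t := 2 * pi * dotp x xi in (cos t +i* sin t) *: g xi).

(* The integrable functions g such that F^-1(g) belongs to L^p; the functions
   F^-1(g) form the initial domain of Fourier multipliers. *)
Definition fourier_domain (X : normedModType R[i]) (g : E -> X) :=
  Lp mu 1 g /\ Lp mu p (inverse_fourier g).

Definition fmul (X : normedModType R[i]) (phi : E -> R[i]) (g : E -> X) : E -> X :=
  fun xi => phi xi *: g xi.

Definition multiplier (X : normedModType R[i]) (phi : E -> R[i]) :=
  [/\ Linfty mu phi,
      forall g : E -> X, fourier_domain g ->
        Lp mu p (inverse_fourier (fmul phi g)) &
      exists C : R, forall g : E -> X, fourier_domain g ->
        (Lpnorm mu p (inverse_fourier (fmul phi g)) <=
           C%:E * Lpnorm mu p (inverse_fourier g))%E].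

Definition extends_multiplier (X : normedModType R[i]) (phi : E -> R[i])
    (U : (E -> X) -> E -> X) :=
  bounded_operator mu p U /\
  forall g : E -> X, fourier_domain g ->
    U (inverse_fourier g) = inverse_fourier (fmul phi g) %[ae mu].

(* For a multiplier phi, this is the bounded operator on L^p extending
   F^-1(g) |-> F^-1(phi g), unique up to equality almost everywhere. *)
Definition multiplier_operator (X : normedModType R[i]) (phi : E -> R[i]) :
    (E -> X) -> E -> X :=
  xget (fun=> cst 0) (extends_multiplier phi).

Definition multiplier_norm (X : normedModType R[i]) (phi : E -> R[i]) : \bar R :=
  operator_norm mu p (@multiplier_operator X phi).

Definition radial (phi : E -> R[i]) :=
  exists phi0 : R -> R[i], phi = phi0 \o enorm %[ae mu].

Definition radial_multiplier (X : normedModType R[i]) (phi : E -> R[i]) :=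
  multiplier X phi /\ radial phi.

Definition linear_on_multipliers (X : normedModType R[i])
    (P : (E -> R[i]) -> E -> R[i]) :=
  forall (a : R[i]) phi psi, multiplier X phi -> multiplier X psi ->
    P (fun x => a * phi x + psi x) = (fun x => a * P phi x + P psi x) %[ae mu].

(* A map defined on classes modulo equality almost everywhere, hence the second
   condition. *)
Definition contractive_projection_onto_radial (X : normedModType R[i])
    (P : (E -> R[i]) -> E -> R[i]) :=
  [/\ forall phi, multiplier X phi -> multiplier X (P phi),
      forall phi psi, multiplier X phi -> multiplier X psi ->
        phi = psi %[ae mu] -> P phi = P psi %[ae mu],
      linear_on_multipliers X P &
   [/\ forall phi, multiplier X phi -> P (P phi) = P phi %[ae mu],
       forall phi, multiplier X phi ->
         (multiplier_norm X (P phi) <= multiplier_norm X phi)%E &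
       forall psi, multiplier X psi ->
         ((exists2 phi, multiplier X phi & P phi = psi %[ae mu]) <->
          radial_multiplier X psi)]].

(* On [R[i]] the order relation [0 <= z] means that z is a nonnegative real. *)
Definition positive_operator (U : (E -> R[i]) -> E -> R[i]) :=
  forall f : E -> R[i], Lp mu p f ->
    (\forall x \ae mu, 0 <= f x) -> \forall x \ae mu, 0 <= U f x.
End multipliers.

Arguments multiplier_operator {R n} p X phi.
Arguments multiplier_norm {R n} p X phi.

(* Main.v *)
From HB Require Import structures.
Require Import Defs.
From mathcomp Require Import all_boot all_order all_algebra.
From mathcomp Require Import all_classical all_reals all_analysis.
From mathcomp Require Import measurable_realfun complex.
From mathcomp Require Import ring lra.
Import Order.TTheory GRing.Theory Num.Theory.
Import numFieldNormedType.Exports.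
Local Open Scope ring_scope.
Local Open Scope complex_scope.
Local Open Scope classical_set_scope.
Set Implicit Arguments.
Unset Strict Implicit.
Unset Printing Implicit Defensive.

(** Averaging a multiplier [phi] over the orthogonal group yields a radial
    multiplier of no larger norm, because [M_(phi \o U)] is the conjugate of
    [M_phi] by the isometry of L^p induced by [U]. The average over the group is
    replaced here by a minimization that yields the same function.

    Let [hull phi] be the set of functions obtained from the [phi \o U], [U] a
    linear isometry, by taking midpoints. A Gaussian weight makes bounded
    functions square integrable and is preserved by isometries. By the
    parallelogram law, a sequence of [hull phi] that minimizes the weighted L^2
    norm converges ([hull_close], [riesz_fischer]), and its limit is invariant
    under every isometry, since composition with an isometry turns a minimizing
    sequence into another one ([hull_invariant_limit]). A function invariant
    almost everywhere under each isometry is radial ([invariant_radial]): it is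
    the limit of its averages over small balls, and these are invariant at every
    point, hence depend only on the norm because isometries act transitively on
    spheres ([iso_transitive]). This limit is [radialize phi].

    Pairing with a radial function against the Gaussian weight gives the same
    value on all of [hull phi], and these pairings separate radial functions
    ([hull_moment], [moment_separated]). So [radialize phi] is the only radial
    function with the same pairings as [phi]; it depends linearly on [phi], and
    it is [phi] itself when [phi] is radial.

    The estimates are first proved on the initial domain. If [N] is sublinear and
    Lipschitz, a bound of the L^p norm of [N (F^-1 (phi g))] by the distance from
    [F^-1 g] to a class of functions stable under isometries is inherited by the
    hull (change of variables, Minkowski) and by bounded almost everywhere limits
    (dominated convergence for the transforms, then Fatou); see
    [hull_size_bound] and [lim_size_bound]. With [N] the norm and the zero function this
    is contractivity; with [N] measuring the defect of positivity and with the
    nonnegative functions it is the preservation of positivity.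

    Passing from the initial domain to operators on L^p requires its density
    ([fourier_domain_dense]). The transform [poisson] of [laplace] is explicit and
    positive everywhere. The functions whose product with every element of the
    closure of the initial domain remains in this closure contain the characters,
    because these correspond to translations of [g], and are stable under sums,
    products and bounded limits; hence they contain all bounded measurable
    functions. Multiplying [poisson] by such functions reaches every simple
    function. *)

(** * The norm of a complex normed space as a real number *)

Section rnorm_theory.
Context {R : realType} {X : normedModType R[i]}.
Implicit Types (x y : X) (u : nat -> X).

Lemma rnormE x : `|x| = (rnorm x)%:C.
Proof. by rewrite /rnorm RRe_real. Qed.

Lemma rnorm_ge0 x : 0 <= rnorm x.
Proof. by rewrite -lecR -rnormE; exact: normr_ge0. Qed.

Lemma rnorm0 : rnorm (0 : X) = 0.
Proof. by rewrite /rnorm normr0. Qed.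

Lemma rnorm_eq0 x : (rnorm x == 0) = (x == 0).
Proof.
rewrite -[RHS]normr_eq0 rnormE.
by apply/eqP/eqP => [->//|]; exact: (@complexI R _ 0).
Qed.

Lemma rnormD x y : rnorm (x + y) <= rnorm x + rnorm y.
Proof. by rewrite -lecR rmorphD /= -!rnormE ler_normD. Qed.

Lemma rnormN x : rnorm (- x) = rnorm x.
Proof. by rewrite /rnorm normrN. Qed.

Lemma rnormBC x y : rnorm (x - y) = rnorm (y - x).
Proof. by rewrite /rnorm distrC. Qed.

Lemma rnormZ (a : R[i]) x : rnorm (a *: x) = rnorm a * rnorm x.
Proof.
by apply: (@complexI R); rewrite rmorphM /= -!rnormE normrZ.
Qed.

Lemma rnormB x y z : rnorm (x - z) <= rnorm (x - y) + rnorm (y - z).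
Proof. by apply: le_trans (rnormD _ _); rewrite addrA subrK. Qed.

Lemma ler_rnorm_dist x y : `|rnorm x - rnorm y| <= rnorm (x - y).
Proof.
rewrite ler_norml; apply/andP; split.
  by rewrite lerNl opprB lerBlDr rnormBC -[leLHS]/(rnorm y) -{1}(subrK x y) rnormD.
by rewrite lerBlDr -{1}(subrK y x) rnormD.
Qed.

(** Balls of a normed module over [R[i]] have complex radii; this brings
    convergence back to a real sequence. *)
Lemma rcvgP u (l : X) :
  (u k @[k --> \oo] --> l) <-> (rnorm (u k - l) @[k --> \oo] --> (0 : R)).
Proof.
split=> [/cvgrPdist_lt ul|/cvgrPdist_lt ul]; apply/cvgrPdist_lt => e e0.
  have e0' : 0 < e%:C by rewrite ltcR.
  have := ul _ e0'; apply: filterS => k.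
  by rewrite rnormE ltcR rnormBC sub0r normrN ger0_norm// rnorm_ge0.
have eE : e = (complex.Re e)%:C by rewrite RRe_real// gtr0_real.
have e0' : 0 < complex.Re e by rewrite -ltcR -eE.
have := ul _ e0'; apply: filterS => k.
by rewrite sub0r normrN ger0_norm ?rnorm_ge0// rnormBC eE rnormE ltcR.
Qed.

Lemma rcvg_rnorm u (l : X) : u k @[k --> \oo] --> l ->
  rnorm (u k) @[k --> \oo] --> rnorm l.
Proof.
move=> /rcvgP ul; apply/cvgrPdist_le => e e0.
move/cvgrPdist_le : ul => /(_ _ e0); apply: filterS => k.
rewrite sub0r normrN ger0_norm ?rnorm_ge0// rnormBC; apply: le_trans.
exact: ler_rnorm_dist.
Qed.

End rnorm_theory.

Section rnorm_complex.
Context {R : realType}.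
Implicit Types (z w : R[i]) (a b : R).

Lemma rnormM z w : rnorm (z * w) = rnorm z * rnorm w.
Proof. exact: (@rnormZ R R[i]). Qed.

Lemma rnormC a : rnorm a%:C = `|a|.
Proof. by rewrite /rnorm normc_def /= expr0n /= addr0 sqrtr_sqr. Qed.

Lemma rnorm_sqr z : rnorm z ^+ 2 = complex.Re z ^+ 2 + complex.Im z ^+ 2.
Proof.
case: z => a b; rewrite /rnorm normc_def /= sqr_sqrtr//.
by rewrite addr_ge0 ?sqr_ge0.
Qed.

Lemma ler_Re_rnorm z : `|complex.Re z| <= rnorm z.
Proof.
rewrite -(@ler_pXn2r _ 2) ?nnegrE ?rnorm_ge0//.
by rewrite rnorm_sqr real_normK ?num_real// lerDl sqr_ge0.
Qed.

Lemma ler_Im_rnorm z : `|complex.Im z| <= rnorm z.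
Proof.
rewrite -(@ler_pXn2r _ 2) ?nnegrE ?rnorm_ge0//.
by rewrite rnorm_sqr real_normK ?num_real// lerDr sqr_ge0.
Qed.

Lemma rnorm_le_ReIm z : rnorm z <= `|complex.Re z| + `|complex.Im z|.
Proof.
rewrite -(@ler_pXn2r _ 2) ?nnegrE ?rnorm_ge0 ?addr_ge0//.
rewrite rnorm_sqr sqrrD !real_normK ?num_real// addrAC lerDl.
by rewrite mulrn_wge0// mulr_ge0.
Qed.

Lemma rcvg_Re (u : nat -> R[i]) z : u k @[k --> \oo] --> z ->
  complex.Re (u k) @[k --> \oo] --> complex.Re z.
Proof.
move=> /rcvgP uz; apply/cvgrPdist_le => e e0.
move/cvgrPdist_le : uz => /(_ _ e0); apply: filterS => k.
rewrite sub0r normrN ger0_norm ?rnorm_ge0// rnormBC; apply: le_trans.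
by rewrite -raddfB; exact: ler_Re_rnorm.
Qed.

Lemma rcvg_Im (u : nat -> R[i]) z : u k @[k --> \oo] --> z ->
  complex.Im (u k) @[k --> \oo] --> complex.Im z.
Proof.
move=> /rcvgP uz; apply/cvgrPdist_le => e e0.
move/cvgrPdist_le : uz => /(_ _ e0); apply: filterS => k.
rewrite sub0r normrN ger0_norm ?rnorm_ge0// rnormBC; apply: le_trans.
by rewrite -raddfB; exact: ler_Im_rnorm.
Qed.

Lemma rcvg_complex (u : nat -> R[i]) z :
  complex.Re (u k) @[k --> \oo] --> complex.Re z ->
  complex.Im (u k) @[k --> \oo] --> complex.Im z ->
  u k @[k --> \oo] --> z.
Proof.
move=> uRe uIm; apply/rcvgP.
apply: (@squeeze_cvgr _ _ _ _ (fun=> 0)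
  (fun k => `|complex.Re (u k) - complex.Re z| +
            `|complex.Im (u k) - complex.Im z|)).
- apply: nearW => k; rewrite rnorm_ge0/= -!raddfB; exact: rnorm_le_ReIm.
- exact: cvg_cst.
- rewrite -[0 in X in _ --> X]addr0; apply: cvgD.
    by apply/norm_cvg0P; rewrite -(subrr (complex.Re z)); apply: cvgB => //; exact: cvg_cst.
  by apply/norm_cvg0P; rewrite -(subrr (complex.Im z)); apply: cvgB => //; exact: cvg_cst.
Qed.

Lemma rcvg_realC (u : nat -> R) a : u k @[k --> \oo] --> a ->
  (u k)%:C @[k --> \oo] --> a%:C.
Proof. by move=> ua; apply: rcvg_complex => //=; exact: cvg_cst. Qed.

End rnorm_complex.

(** * Strongly measurable functions *)

Section simple_functions.
Context {d} {T : measurableType d}.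

Lemma simple_fun_cst {R : realType} (X : normedModType R[i]) (c : X) :
  simple_fun (cst c : T -> X).
Proof.
split; first by apply: (@sub_finite_set _ _ [set c]) => [_ [x _ <-]//|]; exact: finite_set1.
move=> y; rewrite preimage_cst; case: ifPn => _; [exact: measurableT|exact: measurable0].
Qed.

Lemma simple_fun_preimage {R : realType} (X : normedModType R[i]) (s : T -> X) :
  simple_fun s -> forall A : set X, measurable (s @^-1` A).
Proof.
move=> [fs ms] A.
rewrite (_ : s @^-1` A = \bigcup_(y in range s `&` A) s @^-1` [set y]).
  apply: fin_bigcup_measurable => //.
  exact: finite_setIl.
apply/seteqP; split => [x /= Ax|x [y [_ Ay] /= xy]]; last by rewrite xy.
by exists (s x) => //; split => //; exists x.
Qed.

Lemma simple_fun_map2 {R : realType} (X Y Z : normedModType R[i])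
    (h : X -> Y -> Z) (s : T -> X) (t : T -> Y) :
  simple_fun s -> simple_fun t -> simple_fun (fun x => h (s x) (t x)).
Proof.
move=> ss st; split.
  apply: (@sub_finite_set _ _ [set h x y | x in range s & y in range t]).
    by move=> _ [x _ <-] /=; exists (s x); [exists x|exists (t x) => //; exists x].
  apply: finite_image2; [exact: ss.1|exact: st.1].
move=> z.
rewrite (_ : _ @^-1` _ = \bigcup_(y in range t)
    ((s @^-1` [set x | h x y = z]) `&` (t @^-1` [set y]))).
  apply: fin_bigcup_measurable => [|y _]; first exact: st.1.
  by apply: measurableI; exact: simple_fun_preimage.
apply/seteqP; split => [x /= hz|x [y _ [/= <-]] ->//].
by exists (t x); [exists x|split].
Qed.

Lemma simple_fun_measurable {R : realType} (X : normedModType R[i]) d'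
    (Y : measurableType d') (h : X -> Y) (s : T -> X) :
  simple_fun s -> measurable_fun setT (h \o s).
Proof.
move=> ss _ B mB; rewrite setTI.
exact: (simple_fun_preimage ss (h @^-1` B)).
Qed.

Lemma simple_fun_indic {R : realType} (A : set T) :
  measurable A -> simple_fun (fun x => (\1_A x : R)%:C).
Proof.
move=> mA; split.
  apply: (@sub_finite_set _ _ [set (0 : R)%:C; (1 : R)%:C]).
    by move=> _ [x _ <-]; rewrite indicE; case: (x \in A); [right|left].
  exact: finite_set2.
move=> y.
rewrite (_ : _ @^-1` _ = (A `&` [set _ | (1 : R)%:C = y]) `|`
   (~` A `&` [set _ | (0 : R)%:C = y])); last first.
  apply/seteqP; split => [x /=|x /=].
    by rewrite indicE; case: (boolP (x \in A)); rewrite ?inE ?notin_setE; [left|right].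
  by move=> [[Ax <-]|[Ax <-]]; rewrite indicE; [rewrite mem_set|rewrite memNset].
have mc (P : Prop) : measurable [set _ : T | P].
  have [p|np] := pselect P.
    by rewrite (_ : [set _ | P] = setT)//; apply/seteqP; split.
  by rewrite (_ : [set _ | P] = set0)//; apply/seteqP; split.
apply: measurableU; apply: measurableI => //; exact: measurableC.
Qed.

End simple_functions.

Section strongly_measurable_theory.
Context {d} {T : measurableType d} {R : realType}.
Implicit Types (X Y Z : normedModType R[i]).

Lemma sm_measurable_cont X (h : X -> R) (f : T -> X) :
  strongly_measurable f ->
  (forall u (l : X), u k @[k --> \oo] --> l -> h (u k) @[k --> \oo] --> h l) ->
  measurable_fun setT (h \o f).
Proof.
move=> [s [ss sf]] hc.
apply: (@measurable_fun_cvg _ _ _ setT (fun k => h \o s k)) => //.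
  by move=> k; exact: simple_fun_measurable.
by move=> x _; apply: hc; exact: sf.
Qed.

Lemma sm_dist X (f : T -> X) (a : X) : strongly_measurable f ->
  measurable_fun setT (fun x => rnorm (f x - a)).
Proof.
move=> mf; apply: (@sm_measurable_cont _ (fun y => rnorm (y - a))) => // u l ul.
by apply: rcvg_rnorm; apply: cvgB => //; exact: cvg_cst.
Qed.

Lemma sm_rnorm X (f : T -> X) : strongly_measurable f ->
  measurable_fun setT (rnorm \o f).
Proof.
by move=> mf; apply: sm_measurable_cont => // u l; exact: rcvg_rnorm.
Qed.

(** The countably many values of the approximating simple functions. *)
Lemma sm_dense X (f : T -> X) : strongly_measurable f ->
  exists D : nat -> X, forall x e, 0 < e -> exists i, rnorm (f x - D i) < e.
Proof.
move=> [s [ss sf]].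
have /choice[sq sqP] k : exists q : seq X, range (s k) = [set` q].
  by have /finite_seqP := (ss k).1.
pose D n := if unpickle n is Some (k, j) then nth 0 (sq k) j else 0.
exists D => x e e0.
have /rcvgP/cvgrPdist_lt/(_ _ e0)[N _ /(_ N (leqnn N))] := sf x.
rewrite sub0r normrN ger0_norm ?rnorm_ge0// => sNe.
have : range (s N) (s N x) by exists x.
rewrite sqP /= => xq.
exists (pickle (N, index (s N x) (sq N))).
by rewrite /D pickleK nth_index// rnormBC.
Qed.

(** The simple functions are nearest-point projections on the first [k] points
    of the dense sequence, ties being broken in favour of the first one. *)
Fixpoint nearest X (D : nat -> X) (k : nat) (y : X) : X :=
  if k is k'.+1 then
    if rnorm (y - D k) < rnorm (y - nearest D k' y) then D k
    else nearest D k' y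
  else D 0.

Lemma nearest_le X (D : nat -> X) k i y : (i <= k)%N ->
  rnorm (y - nearest D k y) <= rnorm (y - D i).
Proof.
elim: k => [|k IH]; first by rewrite leqn0 => /eqP ->.
rewrite leq_eqVlt => /predU1P[->|]; rewrite [nearest _ _.+1 _]/=.
  by case: ltP.
by rewrite ltnS => /IH h; case: ltP => // /ltW/le_trans; apply.
Qed.

(** Pettis' criterion: the distances to the points of a dense sequence decide
    which of the first [k] points is nearest. Stability under pointwise limits
    rests on it. *)
Lemma sm_pettis X (f : T -> X) (D : nat -> X) :
  (forall i, measurable_fun setT (fun x => rnorm (f x - D i))) ->
  (forall x e, 0 < e -> exists i, rnorm (f x - D i) < e) ->
  strongly_measurable f.
Proof.
move=> mD dD; exists (fun k => nearest D k \o f); split.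
  move=> k.
  suff : simple_fun (nearest D k \o f) /\
      measurable_fun setT (fun x => rnorm (f x - nearest D k (f x))) by case.
  elim: k => [|k [[IHf IHm] IH]].
    by split => //=; exact: simple_fun_cst.
  have mlt : measurable [set x | rnorm (f x - D k.+1) < rnorm (f x - nearest D k (f x))].
    rewrite -[X in measurable X]setTI.
    exact: measurable_fun_ltr.
  split; last first.
    rewrite (_ : (fun x => _) = (fun x => Num.min (rnorm (f x - D k.+1)) (rnorm (f x - nearest D k (f x))))).
      exact: measurable_minr.
    by apply/funext => x; rewrite /= minEle; case: ltgtP => //= ->.
  split.
    apply: (@sub_finite_set _ _ (D k.+1 |` range (nearest D k \o f))).
      by move=> _ [x _ <-] /=; case: ifPn => _; [left|right; exists x].
    by rewrite finite_setU; split => //; exact: finite_set1.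
  move=> y.
  set A := [set x | _] in mlt.
  rewrite (_ : _ @^-1` _ = (A `&` [set _ | D k.+1 = y]) `|`
     (~` A `&` (nearest D k \o f) @^-1` [set y])); last first.
    apply/seteqP; split => [x /=|x /=].
      rewrite /A/=; case: ltP => h; [left|right] => //.
    by move=> [[Ax Dy]|[/negP/negbTE Ax ny]]; rewrite Ax.
  apply: measurableU; last first.
    by apply: measurableI => //; exact: measurableC.
  apply: measurableI => //.
  have [p|np] := pselect (D k.+1 = y).
    by rewrite (_ : [set _ | _] = setT)//; apply/seteqP; split.
  by rewrite (_ : [set _ | _] = set0)//; apply/seteqP; split.
move=> x; apply/rcvgP; apply/cvgrPdist_lt => e e0.
have [i ie] := dD x e e0.
exists i => // k /= ik.
rewrite sub0r normrN ger0_norm ?rnorm_ge0// rnormBC.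
by apply: le_lt_trans ie; exact: nearest_le.
Qed.

Lemma sm_lim X (f : nat -> T -> X) (g : T -> X) :
  (forall k, strongly_measurable (f k)) ->
  (forall x, f k x @[k --> \oo] --> g x) -> strongly_measurable g.
Proof.
move=> mf fg.
have /choice[D DP] k := sm_dense (mf k).
pose D' n := if unpickle n is Some (k, j) then D k j else 0.
apply: (@sm_pettis _ _ D').
  move=> i.
  apply: (@measurable_fun_cvg _ _ _ setT (fun k x => rnorm (f k x - D' i))) => //.
    by move=> k; exact: sm_dist.
  move=> x _; apply: rcvg_rnorm; apply: cvgB; [exact: fg|exact: cvg_cst].
move=> x e e0.
have e20 : 0 < e / 2 by rewrite divr_gt0.
have /rcvgP/cvgrPdist_lt/(_ _ e20)[N _ /(_ N (leqnn N))] := fg x.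
rewrite sub0r normrN ger0_norm ?rnorm_ge0// => fNe.
have [j je] := DP N x _ e20.
exists (pickle (N, j)); rewrite /D' pickleK.
apply: le_lt_trans (rnormB _ (f N x) _) _.
by rewrite [e]splitr ltrD// rnormBC.
Qed.

Lemma sm_map2 X Y Z (h : X -> Y -> Z) (f : T -> X) (g : T -> Y) :
  (forall u v (x : X) (y : Y), u k @[k --> \oo] --> x -> v k @[k --> \oo] --> y ->
     h (u k) (v k) @[k --> \oo] --> h x y) ->
  strongly_measurable f -> strongly_measurable g ->
  strongly_measurable (fun x => h (f x) (g x)).
Proof.
move=> hc [s [ss sf]] [t [st tg]].
exists (fun k x => h (s k x) (t k x)); split => [k|x].
  exact: simple_fun_map2.
by apply: hc; [exact: sf|exact: tg].
Qed.

Lemma sm_map X Y (h : X -> Y) (f : T -> X) :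
  (forall u (x : X), u k @[k --> \oo] --> x -> h (u k) @[k --> \oo] --> h x) ->
  strongly_measurable f -> strongly_measurable (h \o f).
Proof.
move=> hc mf.
by apply: (@sm_map2 _ _ _ (fun x _ => h x) _ _ _ mf mf) => u v x y /hc.
Qed.

Lemma sm_simple X (f : T -> X) : simple_fun f -> strongly_measurable f.
Proof. by move=> sf; exists (fun=> f); split => // x; exact: cvg_cst. Qed.

Lemma sm_cst X (c : X) : strongly_measurable (cst c : T -> X).
Proof. exact/sm_simple/simple_fun_cst. Qed.

Lemma smD X (f g : T -> X) : strongly_measurable f -> strongly_measurable g ->
  strongly_measurable (f \+ g).
Proof. by apply: (@sm_map2 _ _ _ +%R) => u v x y; exact: cvgD. Qed.

Lemma smN X (f : T -> X) : strongly_measurable f -> strongly_measurable (\- f).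
Proof. by apply: (@sm_map _ _ -%R) => u x; exact: cvgN. Qed.

Lemma smB X (f g : T -> X) : strongly_measurable f -> strongly_measurable g ->
  strongly_measurable (f \- g).
Proof.
by apply: (@sm_map2 _ _ _ (fun x y => x - y)) => u v x y; exact: cvgB.
Qed.

Lemma smZ X (a : T -> R[i]) (f : T -> X) : strongly_measurable a ->
  strongly_measurable f -> strongly_measurable (fun x => a x *: f x).
Proof. by apply: (@sm_map2 R[i] X X *:%R) => u v x y; exact: cvgZ. Qed.

Lemma smM (a b : T -> R[i]) : strongly_measurable a ->
  strongly_measurable b -> strongly_measurable (fun x => a x * b x).
Proof. exact: smZ. Qed.

Lemma smZl X (a : R[i]) (f : T -> X) :
  strongly_measurable f -> strongly_measurable (a \*: f).
Proof. by apply: smZ; exact: sm_cst. Qed.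

Lemma sm_realC (f : T -> R) : measurable_fun setT f ->
  strongly_measurable (fun x => (f x)%:C).
Proof.
move=> mf.
pose D n : R[i] := if unpickle n is Some q then (ratr q)%:C else 0.
apply: (@sm_pettis _ _ D).
  move=> i; have [a ->] : exists a, D i = a%:C.
    by rewrite /D; case: unpickle => [q|]; [exists (ratr q)|exists 0].
  rewrite (_ : (fun x => _) = (fun x => `|f x - a|)); last first.
    by apply/funext => x; rewrite -rmorphB rnormC.
  by apply: measurableT_comp => //; exact: measurable_funB.
move=> x e e0.
have /rat_in_itvoo[q] : f x < f x + e by rewrite ltrDl.
rewrite in_itv/= => /andP[h1 h2].
exists (pickle q); rewrite /D pickleK -rmorphB rnormC ltr_norml; lra.
Qed.

Lemma sm_complexP (f : T -> R[i]) :
  strongly_measurable f <-> measurable_fun setT (fun x => complex.Re (f x)) /\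
                            measurable_fun setT (fun x => complex.Im (f x)).
Proof.
split=> [mf|[mRe mIm]].
  split; [apply: (sm_measurable_cont mf) => u l|apply: (sm_measurable_cont mf) => u l].
    exact: rcvg_Re.
  exact: rcvg_Im.
rewrite (_ : f = (fun x => (complex.Re (f x))%:C) \+
    (fun x => 'i * (complex.Im (f x))%:C)); last first.
  by apply/funext => x /=; rewrite -complexE.
apply: smD; first exact: sm_realC.
apply: smM; [exact: sm_cst|exact: sm_realC].
Qed.

End strongly_measurable_theory.

Lemma sm_comp {R : realType} d d' (T : measurableType d) (T' : measurableType d')
    (X : normedModType R[i]) (f : T -> X) (U : T' -> T) :
  measurable_fun setT U -> strongly_measurable f -> strongly_measurable (f \o U).
Proof.
move=> mU [s [ss sf]]; exists (fun k => s k \o U); split => [k|x]; last exact: sf.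
split; first by apply: sub_finite_set (ss k).1 => _ [x _ <-]; exists (U x).
move=> y; rewrite comp_preimage -[X in measurable X]setTI; apply: mU => //.
exact: (ss k).2.
Qed.

(** * The norm of L^p *)

Section ae_tools.
Context {d} {T : measurableType d} {R : realType} (mu : {measure set T -> \bar R}).

Lemma ae_forall_nat (P : nat -> T -> Prop) :
  (forall k, \forall x \ae mu, P k x) -> \forall x \ae mu, forall k, P k x.
Proof.
move=> h; rewrite /almost_everywhere /prop_near1 /nbhs/=.
rewrite (_ : ~` _ = \bigcup_k ~` [set x | P k x]).
  exact: negligible_bigcup.
apply/seteqP; split => [x /= /existsNP[k nk]|x [k _ /= nk]]; first by exists k.
by move=> /(_ k).
Qed.

Lemma ae_eqE (Y : Type) (f g : T -> Y) :
  f = g %[ae mu] <-> \forall x \ae mu, f x = g x.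
Proof. by split; apply: filterS => x; [exact|]. Qed.

End ae_tools.

Lemma powR_cvgn {R : realType} (u : nat -> R) (l p : R) : 0 < p ->
  (forall k, 0 <= u k) -> u k @[k --> \oo] --> l ->
  u k `^ p @[k --> \oo] --> l `^ p.
Proof.
move=> p0 u0 ul.
have : 0 <= l.
  rewrite -(cvg_lim _ ul)//; apply: limr_ge; first by apply/cvg_ex; exists l.
  exact: nearW.
rewrite le_eqVlt => /predU1P[l0|l0].
  rewrite -l0 powR0 ?gt_eqF//; rewrite -l0 in ul.
  apply/cvgrPdist_lt => e e0.
  have e'0 : 0 < e `^ p^-1 by rewrite powR_gt0.
  move/cvgrPdist_lt : ul => /(_ _ e'0); apply: filterS => k.
  rewrite !sub0r !normrN !ger0_norm ?powR_ge0// => ue.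
  have := @gt0_ltr_powR _ p p0 (u k) (e `^ p^-1).
  rewrite !nnegrE u0 powR_ge0 -powRrM mulVf ?gt_eqF// powRr1 ?ltW//.
  exact.
rewrite /(l `^ p) gt_eqF//.
have : \forall k \near \oo, 0 < u k.
  move/cvgrPdist_lt : ul => /(_ _ l0); apply: filterS => k.
  by rewrite ltr_norml ltrBlDl -ltrBlDr subrr => /andP[_].
move=> upos.
apply: (@cvg_trans _ ((expR (p * ln (u k))) @[k --> \oo])).
  apply: near_eq_cvg; apply: filterS upos => k uk.
  by rewrite /powR gt_eqF.
apply: continuous_cvg; first exact: continuous_expR.
apply: cvgM; first exact: cvg_cst.
apply: continuous_cvg => //.
exact: continuous_ln.
Qed.

Section limn_einf.
Local Open Scope ereal_scope.
Context {R : realType}.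
Implicit Types u : nat -> \bar R.

Lemma limn_einf_ge0 u : (forall k, 0 <= u k) -> 0 <= limn_einf u.
Proof.
move=> u0; rewrite limn_einf_lim; apply: lime_ge; first exact: is_cvg_einfs.
by apply: nearW => k; apply: le_ereal_inf_tmp => _ [m _ <-].
Qed.

Lemma limn_einf_le u M : (\forall k \near \oo, u k <= M) -> limn_einf u <= M.
Proof.
move=> [N _ uM]; rewrite limn_einf_lim; apply: lime_le; first exact: is_cvg_einfs.
apply: nearW => k; apply: (@le_trans _ _ (u (maxn k N))).
  by apply: ereal_inf_lbound; exists (maxn k N) => //=; rewrite leq_maxl.
by apply: uM => /=; rewrite leq_maxr.
Qed.

Lemma measurable_limn_einf d (T : measurableType d) (f : nat -> T -> \bar R) :
  (forall k, measurable_fun setT (f k)) ->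
  measurable_fun setT (fun x => limn_einf (fun k => f k x)).
Proof.
move=> mf; apply: measurableT_comp => //.
apply: (@measurable_fun_limn_esup _ _ _ _ (fun k x => - f k x)) => k.
exact: measurableT_comp.
Qed.

End limn_einf.

Section Lpnorm_theory.
Context {d} {T : measurableType d} {R : realType} (mu : {measure set T -> \bar R}).
Implicit Types (X Y : normedModType R[i]) (p : R).

Definition powint p X (f : T -> X) : \bar R :=
  (\int[mu]_x ((rnorm (f x)) `^ p)%:E)%E.

Lemma powint_ge0 p X (f : T -> X) : (0 <= powint p f)%E.
Proof. by apply: integral_ge0 => x _; rewrite lee_fin powR_ge0. Qed.

Lemma LpnormE p X (f : T -> X) : (Lpnorm mu p f = powint p f `^ p^-1)%E.
Proof.
rewrite /Lpnorm unlock /powint; congr (_ `^ _)%E.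
by apply: eq_integral => x _ /=; rewrite ger0_norm// rnorm_ge0.
Qed.

Lemma Lpnorm_ge0 p X (f : T -> X) : (0 <= Lpnorm mu p f)%E.
Proof. exact: Lnorm_ge0. Qed.

Lemma powintE p X (f : T -> X) : p != 0 -> (powint p f = Lpnorm mu p f `^ p)%E.
Proof.
by move=> p0; rewrite LpnormE -poweRrM mulVf// poweRe1// powint_ge0.
Qed.

Lemma Lpnorm1 X (f : T -> X) : (Lpnorm mu 1 f = \int[mu]_x (rnorm (f x))%:E)%E.
Proof.
rewrite /Lpnorm Lnorm1; apply: eq_integral => x _ /=.
by rewrite ger0_norm// rnorm_ge0.
Qed.

Lemma Lpnorm_lty p X (f : T -> X) : p != 0 ->
  (Lpnorm mu p f < +oo)%E = (powint p f < +oo)%E.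
Proof.
move=> p0; apply/idP/idP => [h|h]; last by rewrite LpnormE poweR_lty.
by rewrite powintE// poweR_lty.
Qed.

Lemma measurable_powint p X (f : T -> X) : strongly_measurable f ->
  measurable_fun setT (fun x => ((rnorm (f x)) `^ p)%:E).
Proof.
move=> mf; apply/measurable_EFinP.
apply: (@measurableT_comp _ _ _ _ _ _ (fun y : R => y `^ p)) => //.
exact: sm_rnorm.
Qed.

Lemma le_powint p X Y (f : T -> X) (g : T -> Y) : 0 <= p ->
  strongly_measurable f -> strongly_measurable g ->
  (\forall x \ae mu, rnorm (f x) <= rnorm (g x)) ->
  (powint p f <= powint p g)%E.
Proof.
move=> p0 mf mg fg; apply: ae_ge0_le_integral => //.
- by move=> x _; rewrite lee_fin powR_ge0.
- exact: measurable_powint.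
- by move=> x _; rewrite lee_fin powR_ge0.
- exact: measurable_powint.
apply: filterS fg => x fg _; rewrite lee_fin.
by apply: ge0_ler_powR; rewrite ?nnegrE ?rnorm_ge0.
Qed.

Lemma le_Lpnorm p X Y (f : T -> X) (g : T -> Y) : 0 <= p ->
  strongly_measurable f -> strongly_measurable g ->
  (\forall x \ae mu, rnorm (f x) <= rnorm (g x)) ->
  (Lpnorm mu p f <= Lpnorm mu p g)%E.
Proof.
move=> p0 mf mg fg; rewrite !LpnormE gt0_ler_poweR ?invr_ge0//.
- by rewrite in_itv/= powint_ge0 leey.
- by rewrite in_itv/= powint_ge0 leey.
exact: le_powint.
Qed.

Lemma eq_Lpnorm p X Y (f : T -> X) (g : T -> Y) : 0 <= p ->
  strongly_measurable f -> strongly_measurable g ->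
  (\forall x \ae mu, rnorm (f x) = rnorm (g x)) ->
  Lpnorm mu p f = Lpnorm mu p g.
Proof.
move=> p0 mf mg fg; apply/eqP; rewrite eq_le; apply/andP; split;
  by apply: le_Lpnorm => //; apply: filterS fg => x ->.
Qed.

Lemma powintZ p X (a : R[i]) (f : T -> X) : 0 <= p -> strongly_measurable f ->
  (powint p (a \*: f)%R = (rnorm a `^ p)%:E * powint p f)%E.
Proof.
move=> p0 mf; rewrite /powint -ge0_integralZl_EFin//.
- by apply: eq_integral => x _; rewrite -EFinM -powRM ?rnorm_ge0//= rnormZ.
- by move=> x _; rewrite lee_fin powR_ge0.
- exact: measurable_powint.
exact: powR_ge0.
Qed.

Lemma LpnormZ p X (a : R[i]) (f : T -> X) : 0 < p -> strongly_measurable f ->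
  (Lpnorm mu p (a \*: f)%R = (rnorm a)%:E * Lpnorm mu p f)%E.
Proof.
move=> p0 mf; rewrite !LpnormE powintZ ?ltW//.
rewrite poweRM ?powint_ge0 ?lee_fin ?powR_ge0// poweR_EFin -powRrM.
by rewrite mulfV ?gt_eqF// powRr1// rnorm_ge0.
Qed.

Lemma LpnormN p X (f : T -> X) : Lpnorm mu p (\- f) = Lpnorm mu p f.
Proof.
by rewrite !LpnormE /powint; under eq_integral do rewrite /= rnormN.
Qed.

Lemma LpnormBC p X (f g : T -> X) : Lpnorm mu p (f \- g) = Lpnorm mu p (g \- f)%R.
Proof.
by rewrite !LpnormE /powint; under eq_integral do rewrite /= rnormBC.
Qed.

Lemma Lpnorm0 p X : p != 0 -> Lpnorm mu p (cst 0 : T -> X) = 0%E.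
Proof.
move=> p0; rewrite LpnormE /powint.
under eq_integral do rewrite /= rnorm0 powR0//.
by rewrite integral0 poweR0r// invr_neq0.
Qed.

(** Minkowski's inequality for the real functions [rnorm \o f] and [rnorm \o g]. *)
Lemma LpnormD p X (f g : T -> X) : 1 <= p ->
  strongly_measurable f -> strongly_measurable g ->
  (Lpnorm mu p (f \+ g)%R <= Lpnorm mu p f + Lpnorm mu p g)%E.
Proof.
move=> p1 mf mg.
have p0 : 0 <= p by apply: le_trans p1.
have := @minkowski_EFin _ _ _ mu (rnorm \o f) (rnorm \o g) p
  (sm_rnorm mf) (sm_rnorm mg) p1.
apply: le_trans.
have mC : strongly_measurable (fun x => (rnorm (f x) + rnorm (g x))%:C).
  by apply: sm_realC; apply: measurable_funD; exact: sm_rnorm.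
have -> : Lnorm mu p%:E (EFin \o ((rnorm \o f) \+ (rnorm \o g))) =
    Lpnorm mu p (fun x => (rnorm (f x) + rnorm (g x))%:C).
  rewrite /Lpnorm; congr (Lnorm mu p%:E _); apply/funext => x /=.
  by rewrite rnormC ger0_norm// addr_ge0// rnorm_ge0.
apply: le_Lpnorm => //; first exact: smD.
by apply: aeW => x /=; rewrite rnormC ger0_norm ?rnormD// addr_ge0// rnorm_ge0.
Qed.

Lemma LpnormB p X (f g : T -> X) : 1 <= p ->
  strongly_measurable f -> strongly_measurable g ->
  (Lpnorm mu p (f \- g)%R <= Lpnorm mu p f + Lpnorm mu p g)%E.
Proof.
move=> p1 mf mg; rewrite -[X in (_ <= _ + X)%E]LpnormN.
by apply: LpnormD => //; exact: smN.
Qed.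

Lemma Lpnorm_eq0 p X (f : T -> X) : 0 < p -> strongly_measurable f ->
  Lpnorm mu p f = 0%E -> \forall x \ae mu, f x = 0.
Proof.
move=> p0 mf; rewrite /Lpnorm => /Lnorm_eq0_eq0 h.
have : (EFin \o rnorm \o f) = \0%E %[ae mu].
  by apply: h => //; apply/measurable_EFinP; exact: sm_rnorm.
by apply: filterS => x /(_ I) /= [] /eqP; rewrite rnorm_eq0 => /eqP.
Qed.

Lemma Lp0 p X : p != 0 -> Lp mu p (cst 0 : T -> X).
Proof. by move=> p0; split; [exact: sm_cst|rewrite Lpnorm0]. Qed.

Lemma LpZ p X (a : R[i]) (f : T -> X) : 0 < p -> Lp mu p f -> Lp mu p (a \*: f).
Proof.
move=> p0 [mf If]; split; first exact: smZl.
by rewrite LpnormZ// lte_mul_pinfty// ?lee_fin rnorm_ge0.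
Qed.

Lemma LpD p X (f g : T -> X) : 1 <= p -> Lp mu p f -> Lp mu p g ->
  Lp mu p (f \+ g).
Proof.
move=> p1 [mf If] [mg Ig]; split; first exact: smD.
by apply: le_lt_trans (LpnormD _ _ _) _ => //; rewrite lte_add_pinfty.
Qed.

Lemma LpB p X (f g : T -> X) : 1 <= p -> Lp mu p f -> Lp mu p g ->
  Lp mu p (f \- g).
Proof.
move=> p1 [mf If] [mg Ig]; split; first exact: smB.
by apply: le_lt_trans (LpnormB _ _ _) _ => //; rewrite lte_add_pinfty.
Qed.

Lemma Lp_le p X Y (f : T -> X) (g : T -> Y) : 0 <= p ->
  strongly_measurable f -> Lp mu p g ->
  (\forall x \ae mu, rnorm (f x) <= rnorm (g x)) -> Lp mu p f.
Proof.
move=> p0 mf [mg Ig] fg; split => //.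
by apply: le_lt_trans Ig; exact: le_Lpnorm.
Qed.

Lemma LpnormB_ge p X (f g h : T -> X) : 1 <= p ->
  strongly_measurable f -> strongly_measurable g -> strongly_measurable h ->
  (Lpnorm mu p (f \- h)%R <= Lpnorm mu p (f \- g)%R + Lpnorm mu p (g \- h)%R)%E.
Proof.
move=> p1 mf mg mh.
rewrite (_ : f \- h = (f \- g) \+ (g \- h)).
  by apply: LpnormD => //; exact: smB.
by apply/funext => x /=; rewrite addrA subrK.
Qed.

(** Fatou's lemma carries uniform bounds over to almost everywhere limits. *)
Lemma Lpnorm_fatou p X (f : nat -> T -> X) (g : T -> X) (M : \bar R) : 0 < p ->
  (forall k, strongly_measurable (f k)) -> strongly_measurable g ->
  (\forall x \ae mu, f k x @[k --> \oo] --> g x) ->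
  (\forall k \near \oo, Lpnorm mu p (f k) <= M)%E -> (Lpnorm mu p g <= M)%E.
Proof.
move=> p0 mf mg fg fM.
have M0 : (0 <= M)%E.
  by case: fM => N _ /(_ N (leqnn N)); apply: le_trans; exact: Lpnorm_ge0.
suff h : (powint p g <= M `^ p)%E.
  rewrite LpnormE -[leRHS]poweRe1// -(mulfV (lt0r_neq0 p0)) poweRrM.
  rewrite gt0_ler_poweR ?invr_ge0 ?(ltW p0)// ?in_itv/= ?powint_ge0 ?leey//.
  by rewrite poweR_ge0.
have := @fatou _ _ _ mu setT measurableT
  (fun k x => ((rnorm (f k x)) `^ p)%:E) (fun k => measurable_powint p (mf k)).
move=> /(_ (fun k x _ => (powR_ge0 _ _ : (0 <= _%:E)%E))) F.
apply: (@le_trans _ _ (\int[mu]_x limn_einf (fun k => ((rnorm (f k x)) `^ p)%:E))%E).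
  apply: ae_ge0_le_integral => //.
  - by move=> x _; rewrite lee_fin powR_ge0.
  - exact: measurable_powint.
  - move=> x _; apply: limn_einf_ge0 => k; by rewrite lee_fin powR_ge0.
  - by apply: measurable_limn_einf => k; exact: measurable_powint.
  apply: filterS fg => x fg _.
  have : ((rnorm (f k x)) `^ p)%:E @[k --> \oo] --> ((rnorm (g x)) `^ p)%:E.
    apply: cvg_EFin; first exact: nearW.
    by apply: powR_cvgn => // [k|]; [exact: rnorm_ge0|exact: rcvg_rnorm fg].
  by move=> /cvg_limn_einf_sup[-> _].
apply: le_trans F _.
apply: limn_einf_le.
apply: filterS fM => k h; rewrite -[leLHS]/(powint p (f k)) powintE ?gt_eqF//.
rewrite gt0_ler_poweR ?(ltW p0)// in_itv/= ?Lpnorm_ge0 ?M0 ?leey//.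
Qed.

End Lpnorm_theory.

(** * Convergence in L^p *)

Section Lp_convergence.
Context {d} {T : measurableType d} {R : realType} (mu : {measure set T -> \bar R}).
Implicit Types (X Y : normedModType R[i]) (p : R).

Definition Lcvg p X (f : nat -> T -> X) (g : T -> X) :=
  forall e, 0 < e -> \forall k \near \oo, (Lpnorm mu p (f k \- g)%R < e%:E)%E.

Lemma Lcvg0P p X (f : nat -> T -> X) (g : T -> X) :
  Lcvg p f g <-> Lpnorm mu p (f k \- g) @[k --> \oo] --> 0%E.
Proof.
split=> [fg|].
  apply/fine_cvgP; split.
    apply: filterS (fg 1 ltr01) => k h.
    by rewrite ge0_fin_numE ?Lpnorm_ge0// (lt_trans h)// ltry.
  apply/cvgrPdist_lt => e e0; apply: filterS (fg e e0) => k h /=.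
  rewrite sub0r normrN ger0_norm ?fine_ge0 ?Lpnorm_ge0//.
  by rewrite -lte_fin fineK// ge0_fin_numE ?Lpnorm_ge0// (lt_trans h)// ltry.
move=> /fine_cvgP[f1 /cvgrPdist_lt f2] e e0.
near=> k.
have fk : Lpnorm mu p (f k \- g) \is a fin_num by near: k.
rewrite -(fineK fk) lte_fin.
have : `|0 - fine (Lpnorm mu p (f k \- g))| < e by near: k; exact: f2.
by rewrite sub0r normrN ger0_norm// fine_ge0 ?Lpnorm_ge0.
Unshelve. all: by end_near. Qed.

Lemma Lpnorm_lt p X (f : T -> X) e : 0 < p -> 0 < e ->
  (powint mu p f < (e `^ p)%:E)%E -> (Lpnorm mu p f < e%:E)%E.
Proof.
move=> p0 e0 h; rewrite ltNge; apply/negP => h'.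
move: h; apply/negP; rewrite -leNgt powintE ?gt_eqF// -poweR_EFin.
apply: gt0_ler_poweR => //; first exact: ltW.
  by rewrite in_itv/= leey andbT lee_fin ltW.
by rewrite in_itv/= Lpnorm_ge0 leey.
Qed.

Lemma Lp_dominated p X Y (f : nat -> T -> X) (g : T -> X) (h : T -> Y) : 0 < p ->
  (forall k, strongly_measurable (f k)) -> strongly_measurable g ->
  Lp mu p h -> (\forall x \ae mu, f k x @[k --> \oo] --> g x) ->
  (forall k, \forall x \ae mu, rnorm (f k x) <= rnorm (h x)) ->
  Lcvg p f g.
Proof.
move=> p0 mf mg [mh Ih] fg fh e e0.
have fh' := ae_forall_nat fh.
have gh : \forall x \ae mu, rnorm (g x) <= rnorm (h x).
  apply: filterS2 fg fh' => x fgx fhx.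
  have := rcvg_rnorm fgx => c.
  rewrite -(cvg_lim _ c)//; apply: limr_le; first by apply/cvg_ex; exists (rnorm (g x)).
  exact: nearW.
pose F k x := ((rnorm (f k x - g x)) `^ p)%:E.
pose H x := ((2 * rnorm (h x)) `^ p)%:E.
have mF k : measurable_fun setT (F k) by apply: measurable_powint; exact: smB.
have F0 : {ae mu, forall x, setT x -> F k x @[k --> \oo] --> 0%E}.
  apply: filterS fg => x fgx _ /=; apply: cvg_EFin; first exact: nearW.
  rewrite -[X in _ --> X](@powR0 _ p) ?gt_eqF//.
  apply: powR_cvgn => //; first by move=> k; exact: rnorm_ge0.
  exact/rcvgP.
have iH : mu.-integrable setT H.
  apply/integrableP; split.
    apply/measurable_EFinP.
    apply: (@measurableT_comp _ _ _ _ _ _ (fun y : R => y `^ p)) => //.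
    by apply: measurable_funM => //; exact: sm_rnorm.
  rewrite (_ : (fun x => _) = (fun x => ((rnorm ((2 : R)%:C *: h x)) `^ p)%:E)).
    rewrite -/(powint mu p ((2 : R)%:C \*: h)) powintZ ?ltW//.
    rewrite lte_mul_pinfty ?lee_fin ?powR_ge0//.
    by rewrite -Lpnorm_lty ?gt_eqF.
  apply/funext => x; rewrite /H gee0_abs ?lee_fin ?powR_ge0//.
  by rewrite rnormZ rnormC ger0_norm.
have FH : {ae mu, forall x k, setT x -> (`|F k x| <= H x)%E}.
  apply: filterS2 fh' gh => x fhx ghx k _.
  rewrite gee0_abs ?lee_fin ?powR_ge0//.
  apply: ge0_ler_powR; rewrite ?nnegrE ?mulr_ge0 ?rnorm_ge0//; first exact: ltW.
  apply: le_trans (rnormD _ _) _; rewrite rnormN mulr_natl mulr2n.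
  by apply: lerD.
have [_ _] := @dominated_convergence _ _ _ mu setT measurableT F (cst 0%E) H mF
  (measurable_cst _) F0 iH FH.
rewrite integral0.
move=> /fine_cvgP[D1 /cvgrPdist_lt D2].
have ep0 : 0 < e `^ p by rewrite powR_gt0.
near=> k.
apply: Lpnorm_lt => //.
have fk : (\int[mu]_x F k x \is a fin_num)%E by near: k.
rewrite -[ltLHS](fineK fk) lte_fin.
have : `|0 - fine (\int[mu]_x F k x)%E| < e `^ p by near: k; exact: D2.
rewrite sub0r normrN ger0_norm// fine_ge0//; apply: integral_ge0 => x _.
by rewrite lee_fin powR_ge0.
Unshelve. all: by end_near. Qed.

(** Sets of full measure are measurable only up to a null set, so the limit is
    taken on a measurable set of full measure and put equal to 0 elsewhere. *)
Lemma sm_ae_lim X (f : nat -> T -> X) :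
  (forall k, strongly_measurable (f k)) ->
  (\forall x \ae mu, cvg (f k x @[k --> \oo])) ->
  exists2 g, strongly_measurable g & \forall x \ae mu, f k x @[k --> \oo] --> g x.
Proof.
move=> mf [N [mN N0 Nf]].
pose chi x : R[i] := (\1_(~` N) x : R)%:C.
have mchi : strongly_measurable chi.
  by apply: sm_realC; apply: measurable_indic; exact: measurableC.
pose g x := lim (chi x *: f k x @[k --> \oo]).
have fg x : chi x *: f k x @[k --> \oo] --> g x.
  have [Nx|Nx] := pselect (N x).
    rewrite /g (_ : (fun k => chi x *: f k x) = fun=> 0).
      by rewrite lim_cst//; exact: cvg_cst.
    by apply/funext => k; rewrite /chi indicE memNset ?scale0r//= => /(_ Nx).
  have c : cvg (f k x @[k --> \oo]).
    by apply: contrapT => nc; apply: Nx; apply: Nf.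
  have [l fl] := (cvg_ex _).1 c.
  have : chi x *: f k x @[k --> \oo] --> chi x *: l.
    by apply: cvgZ fl; exact: cvg_cst.
  move=> h; rewrite /g; suff -> : lim (chi x *: f k x @[k --> \oo]) = chi x *: l by [].
  exact: cvg_lim h.
exists g.
  by apply: (@sm_lim _ _ _ _ (fun k x => chi x *: f k x)) => // k; exact: smZ.
exists N; split => // x /= nfg; apply: contrapT => Nx; apply: nfg.
have := fg x; rewrite (_ : (fun k => chi x *: f k x) = (fun k => f k x))//.
by apply/funext => k; rewrite /chi indicE mem_set// scale1r.
Qed.

Lemma geometric_cauchy (X : completeNormedModType R[i]) (u : nat -> X) (M : R) :
  (forall k, rnorm (u k.+1 - u k) <= M * 2^-1 ^+ k) -> cvg (u k @[k --> \oo]).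
Proof.
move=> uM.
have M0 : 0 <= M by have := le_trans (rnorm_ge0 _) (uM 0%N); rewrite expr0 mulr1.
have half : 0 <= 2^-1 :> R by rewrite invr_ge0.
have uMn k j : rnorm (u (k + j)%N - u k) <= M * 2 * 2^-1 ^+ k * (1 - 2^-1 ^+ j).
  elim: j => [|j IH]; first by rewrite addn0 subrr rnorm0 expr0 subrr mulr0.
  apply: le_trans (rnormB _ (u (k + j)%N) _) _.
  rewrite addnS; apply: le_trans (lerD (uM _) IH) _.
  rewrite exprD exprS; set a := 2^-1 ^+ k; set b := 2^-1 ^+ j.
  by rewrite le_eqVlt; apply/orP; left; apply/eqP; field.
apply/cauchy_cvgP/cauchyP => e e0.
have eE : e = (complex.Re e)%:C by rewrite RRe_real// gtr0_real.
have e0' : 0 < complex.Re e by rewrite -ltcR -eE.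
have : (M * 2) * 2^-1 ^+ k @[k --> \oo] --> (0 : R).
  rewrite -[X in _ --> X](mulr0 (M * 2)); apply: cvgM; first exact: cvg_cst.
  by apply: cvg_expr; rewrite ger0_norm// invf_lt1// ltr1n.
move=> /cvgrPdist_lt/(_ _ e0')[N _ /(_ N (leqnn N))].
rewrite sub0r normrN ger0_norm; last by rewrite !mulr_ge0// exprn_ge0.
move=> h; exists (u N); exists N => // k /= Nk.
rewrite -ball_normE /= eE rnormE ltcR rnormBC.
rewrite -(subnKC Nk); apply: le_lt_trans (uMn _ _) _.
by apply: le_lt_trans h; rewrite ler_piMr ?mulr_ge0 ?exprn_ge0// gerBl exprn_ge0.
Qed.

(** Even after multiplication by 2 ^ k, the differences have summable p-th
    powers of norms, so they are bounded at almost every point. *)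
Lemma riesz_fischer p (X : completeNormedModType R[i]) (f : nat -> T -> X) : 1 <= p ->
  (forall k, strongly_measurable (f k)) ->
  (forall k, Lpnorm mu p (f k.+1 \- f k)%R <= (4^-1 ^+ k)%:E)%E ->
  exists2 g, strongly_measurable g & \forall x \ae mu, f k x @[k --> \oo] --> g x.
Proof.
move=> p1 mf fM.
have p0 : 0 < p by apply: lt_le_trans p1.
apply: sm_ae_lim => //.
pose a k x := ((rnorm ((2 ^+ k : R)%:C *: (f k.+1 x - f k x))) `^ p)%:E.
have ma k : measurable_fun setT (a k).
  by apply: measurable_powint; apply: smZl; exact: smB.
have a0 k x : (0 <= a k x)%E by rewrite lee_fin powR_ge0.
have Ia k : (\int[mu]_x a k x <= (2^-1 ^+ k)%:E)%E.
  rewrite -[leLHS]/(powint mu p ((2 ^+ k : R)%:C \*: (f k.+1 \- f k))).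
  rewrite powintE ?gt_eqF// LpnormZ//; last exact: smB.
  rewrite rnormC ger0_norm ?exprn_ge0//.
  apply: (@le_trans _ _ ((2^-1 ^+ k)%:E `^ p)%E).
    rewrite gt0_ler_poweR ?(ltW p0)// ?in_itv/= ?leey ?lee_fin ?exprn_ge0 ?invr_ge0//.
      by rewrite mule_ge0 ?lee_fin ?exprn_ge0 ?Lpnorm_ge0.
    apply: (@le_trans _ _ ((2 ^+ k)%:E * (4^-1 ^+ k)%:E)%E).
      by apply: lee_pmul; rewrite ?lee_fin ?exprn_ge0 ?Lpnorm_ge0.
    rewrite -EFinM lee_fin -exprMn le_eqVlt; apply/orP; left; apply/eqP.
    by congr (_ ^+ _); field.
  rewrite poweR_EFin lee_fin -[leRHS]powRr1 ?exprn_ge0 ?invr_ge0//.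
  rewrite powRr1 ?exprn_ge0 ?invr_ge0//; apply: ge1r_powR => //.
  by rewrite exprn_gt0 ?invr_gt0//= exprn_ile1 ?invr_ge0// invf_le1 ?ler1n.
have I : (\int[mu]_x (\sum_(k <oo) a k x) < +oo)%E.
  rewrite integral_nneseries//.
  apply: (@le_lt_trans _ _ (\sum_(k <oo) (2^-1 ^+ k)%:E)%E).
    apply: lee_nneseries => // k _ _; first exact: integral_ge0.
  have /cvg_lim h := @cvg_geometric_eseries_half R 2 0.
  rewrite (_ : (\sum_(k <oo) _)%E = (2 / 2 ^+ 0)%:E) ?ltry// -h//.
  congr (limn _); apply/funext => k; apply: eq_bigr => j _; congr EFin.
  by rewrite addn1 natrX exprS invfM mulrA divff// mul1r exprVn.
have : mu.-integrable setT (fun x => \sum_(k <oo) a k x)%E.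
  apply/integrableP; split; first exact: ge0_emeasurable_sum.
  apply: le_lt_trans I; rewrite le_eqVlt; apply/orP; left; apply/eqP.
  by apply: eq_integral => x _; rewrite gee0_abs// nneseries_ge0.
move=> /integrable_ae => /(_ measurableT); apply: filterS => x /(_ Logic.I) fin.
pose M := Num.max 1 (fine (\sum_(k <oo) a k x))%E.
apply: (@geometric_cauchy _ _ M) => k.
rewrite -ler_pdivrMr ?exprn_gt0 ?invr_gt0// -exprVn invrK mulrC.
have -> : 2 ^+ k * rnorm (f k.+1 x - f k x) =
    rnorm ((2 ^+ k : R)%:C *: (f k.+1 x - f k x)).
  by rewrite rnormZ rnormC ger0_norm ?exprn_ge0.
set t := rnorm _.
have tM : t `^ p <= fine (\sum_(k <oo) a k x)%E.
  rewrite -lee_fin fineK// (@nneseriesD1 _ _ k)// leeDl// nneseries_ge0//.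
rewrite le_max; case: (leP t 1) => //= /ltW t1.
by apply: le_trans tM; exact: le1r_powR.
Qed.

End Lp_convergence.

(** * Integrals of simple functions *)

Section simple_integral_theory.
Context {d} {T : measurableType d} {R : realType} (mu : {measure set T -> \bar R}).
Implicit Types (X Y : normedModType R[i]).

(** The integral can be computed along any finite measurable partition on which
    the function is constant; the algebraic rules follow by choosing a common
    partition. *)
Lemma simple_integral_regroup X (W : choiceType) (w : T -> W) (V : seq W)
    (h : W -> X) : uniq V -> (forall x, w x \in V) ->
  (forall v, measurable (w @^-1` [set v])) ->
  (forall v, h v != 0 -> (mu (w @^-1` [set v]) < +oo)%E) ->
  simple_integral mu (h \o w) =
    \sum_(v <- V) (fine (mu (w @^-1` [set v])))%:C *: h v.
Proof.
move=> uV wV mw fw; set S := undup (map h V).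
have hS x : h (w x) \in S by rewrite mem_undup map_f.
rewrite /simple_integral (@fsbig_widen _ _ _ _ _ [set` S]); last 2 first.
- by move=> _ [x _ <-]; exact: hS.
- move=> y /= [_ ny]; rewrite (_ : _ @^-1` _ = set0) ?measure0 ?scale0r//.
  by apply/seteqP; split => // x /= hx; apply: ny; exists x.
rewrite -fsbig_seq ?undup_uniq//.
transitivity (\sum_(y <- S) \sum_(v <- V | h v == y)
    (fine (mu (w @^-1` [set v])))%:C *: h v); last first.
  rewrite (exchange_big_dep xpredT)//=; rewrite big_seq [RHS]big_seq; apply: eq_bigr => v vV.
  rewrite big_mkcond (bigD1_seq (h v)) ?undup_uniq ?mem_undup ?map_f//= eqxx.
  by rewrite big1 ?addr0// => y; rewrite eq_sym => /negbTE ->.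
apply: eq_big_seq => y yS; have [->|y0] := eqVneq y 0.
  by rewrite scaler0 big1// => v /eqP ->; rewrite scaler0.
under eq_bigr => v /eqP -> do [].
rewrite -scaler_suml -rmorph_sum/=; congr (_%:C *: _).
pose D := [set v | v \in V /\ h v = y].
have DV : D = [set` [seq v <- V | h v == y]].
  apply/seteqP; split => v; rewrite /D/= mem_filter.
    by move=> [-> ->]; rewrite eqxx.
  by move=> /andP[/eqP -> ->].
have -> : (h \o w) @^-1` [set y] = \bigcup_(v in D) w @^-1` [set v].
  apply/seteqP; split => [x /= xy|x [v [vV /= hv] /= ->//]].
  by exists (w x).
rewrite measure_fin_bigcup//; last 2 first.
- by rewrite DV; exact: finite_seq.
- by apply/trivIsetP => u v _ _ /eqP uv; apply/seteqP; split => // x [/= ux vx]; apply: uv; rewrite -ux -vx.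
rewrite DV -fsbig_seq ?filter_uniq// big_filter sum_fine//.
by move=> v /eqP hv; rewrite ge0_fin_numE// fw// hv.
Qed.

Lemma finite_range_seq X (s : T -> X) : simple_fun s ->
  exists2 V : seq X, uniq V & forall x, s x \in V.
Proof.
move=> [/finite_seqP[V sV] _]; exists (undup V); first exact: undup_uniq.
move=> x; rewrite mem_undup.
have : range s (s x) by exists x.
by rewrite sV.
Qed.

Lemma simple_integrable_map2 X Y (Z : normedModType R[i]) (h : X -> Y -> Z)
    (s : T -> X) (t : T -> Y) : h 0 0 = 0 ->
  simple_integrable mu s -> simple_integrable mu t ->
  simple_integrable mu (fun x => h (s x) (t x)).
Proof.
move=> h0 [ss fs] [st ft]; split; first exact: simple_fun_map2.
move=> z z0.
have ms : measurable (s @^-1` [set~ 0]) by exact: simple_fun_preimage.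
have mt : measurable (t @^-1` [set~ 0]) by exact: simple_fun_preimage.
have fin (W : normedModType R[i]) (r : T -> W) : simple_integrable mu r ->
    (mu (r @^-1` [set~ 0%R]) < +oo)%E.
  move=> [sr fr].
  rewrite (_ : r @^-1` _ = \bigcup_(y in range r `\ 0) r @^-1` [set y]).
    rewrite measure_fin_bigcup; last 3 first.
    - by apply: finite_setD; exact: sr.1.
    - by apply/trivIsetP => u v _ _ /eqP uv; apply/seteqP; split => // x [/= ux vx]; apply: uv; rewrite -ux -vx.
    - by move=> y _; exact: sr.2.
    rewrite fsbig_finite/=; last by apply: finite_setD; exact: sr.1.
    rewrite big_seq; apply: lte_sum_pinfty => y; rewrite in_fset_set; last by apply: finite_setD; exact: sr.1.
    by rewrite inE => -[_ /eqP]; exact: fr.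
  apply/seteqP; split => [x /= rx|x [y [_ /= y0] /= ->]//].
  by exists (r x) => //; split => //; exists x.
apply: (@le_lt_trans _ _ (mu (s @^-1` [set~ 0%R] `|` t @^-1` [set~ 0%R]))).
  apply: le_measure; rewrite ?inE.
  - by apply: (simple_fun_map2 h ss st).2.
  - exact: measurableU.
  move=> x /= hz; apply: contrapT => /not_orP[/contrapT s0 /contrapT t0].
  by move: z0; rewrite -hz s0 t0 h0 eqxx.
apply: le_lt_trans (measureU2 _ _ _) _ => //.
by apply: lte_add_pinfty; apply: fin; split.
Qed.

Lemma simple_integral_map2 X Y (Z : normedModType R[i]) (h : X -> Y -> Z)
    (s : T -> X) (t : T -> Y) : h 0 0 = 0 ->
  simple_integrable mu s -> simple_integrable mu t ->
  exists V : seq (X * Y),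
  [/\ uniq V, forall x, (s x, t x) \in V,
    (forall v, measurable ((fun x => (s x, t x)) @^-1` [set v])),
    (forall v, v != 0 -> (mu ((fun x => (s x, t x)) @^-1` [set v]) < +oo)%E) &
  simple_integral mu (fun x => h (s x) (t x)) =
    \sum_(v <- V) (fine (mu ((fun x => (s x, t x)) @^-1` [set v])))%:C *: h v.1 v.2].
Proof.
move=> h0 si ti; have [ss fs] := si; have [st ft] := ti.
have [Vs uVs sVs] := finite_range_seq ss.
have [Vt uVt tVt] := finite_range_seq st.
pose V := [seq (a, b) | a <- Vs, b <- Vt].
have uV : uniq V by apply: allpairs_uniq => // -[a b] [a' b'] _ _ /=.
have stV x : (s x, t x) \in V by rewrite allpairs_f ?sVs ?tVt.
have mw v : measurable ((fun x => (s x, t x)) @^-1` [set v]).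
  rewrite (_ : _ @^-1` _ = s @^-1` [set v.1] `&` t @^-1` [set v.2]).
    by apply: measurableI; [exact: ss.2|exact: st.2].
  apply/seteqP; split => [x /= <-//|x /= [-> ->]]; by case: v.
have fw v : v != 0 -> (mu ((fun x => (s x, t x)) @^-1` [set v]) < +oo)%E.
  move=> v0; have [v10|v10] := eqVneq v.1 0; last first.
    apply: le_lt_trans (fs _ v10); apply: le_measure; rewrite ?inE//; first exact: ss.2.
    by move=> x /= <-.
  have v20 : v.2 != 0.
    by apply: contra v0 => /eqP v20; rewrite (surjective_pairing v) v10 v20.
  apply: le_lt_trans (ft _ v20); apply: le_measure; rewrite ?inE//; first exact: st.2.
  by move=> x /= <-.
exists V; split => //.
rewrite -(@simple_integral_regroup _ _ (fun x => (s x, t x)) V (fun v => h v.1 v.2))//.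
move=> v hv; apply: fw; apply: contra hv => /eqP ->.
by rewrite /= h0.
Qed.

Lemma simple_integralD X (s t : T -> X) :
  simple_integrable mu s -> simple_integrable mu t ->
  simple_integral mu (s \+ t) = simple_integral mu s + simple_integral mu t.
Proof.
move=> si ti.
have [V [uV VE mV fV IV]] := simple_integral_map2 (addr0 (0 : X)) si ti.
rewrite [LHS]IV.
rewrite -[in X in X + _](_ : (fst \o (fun x => (s x, t x))) = s)//.
rewrite -[in X in _ + X](_ : (snd \o (fun x => (s x, t x))) = t)//.
rewrite (@simple_integral_regroup _ _ _ V)//; last first.
  by move=> v v0; apply: fV; apply: contra v0 => /eqP ->.
rewrite (@simple_integral_regroup _ _ _ V)//; last first.
  by move=> v v0; apply: fV; apply: contra v0 => /eqP ->.
by rewrite -big_split/=; apply: eq_bigr => v _; rewrite scalerDr.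
Qed.

Lemma simple_integralZ X (a : R[i]) (s : T -> X) :
  simple_integrable mu s ->
  simple_integral mu (a \*: s) = a *: simple_integral mu s.
Proof.
move=> si; have [V uV VE] := finite_range_seq si.1.
rewrite -[RHS]/(a *: simple_integral mu (id \o s)).
rewrite (@simple_integral_regroup _ _ s V id)//; last 2 first.
- exact: si.1.2.
- exact: si.2.
rewrite -[LHS]/(simple_integral mu (( *:%R a) \o s)).
rewrite (@simple_integral_regroup _ _ s V)//; last 2 first.
- exact: si.1.2.
- by move=> v av; apply: si.2; apply: contra av => /eqP ->; rewrite scaler0.
by rewrite scaler_sumr; apply: eq_bigr => v _; rewrite !scalerA mulrC.
Qed.

Lemma le_simple_integral X (s : T -> X) : simple_integrable mu s ->
  ((rnorm (simple_integral mu s))%:E <= Lpnorm mu 1 s)%E.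
Proof.
move=> si; have [V uV VE] := finite_range_seq si.1.
rewrite -[X in rnorm X]/(simple_integral mu (id \o s)).
rewrite (@simple_integral_regroup _ _ s V id)//; last 2 first.
- exact: si.1.2.
- exact: si.2.
rewrite Lpnorm1.
have -> : (\int[mu]_x (rnorm (s x))%:E =
    \sum_(v <- V) (rnorm v)%:E * mu (s @^-1` [set v]))%E.
  transitivity (\int[mu]_x (\sum_(v <- V) (rnorm v * \1_(s @^-1` [set v]) x)%:E))%E.
    apply: eq_integral => x _; rewrite sumEFin; congr EFin.
    rewrite (bigD1_seq (s x))//= indicE mem_set// mulr1 big1 ?addr0// => v vs.
    by rewrite indicE memNset ?mulr0//= => sv; move: vs; rewrite sv eqxx.
  rewrite ge0_integral_sum//; last 2 first.
  - move=> v; apply/measurable_EFinP; apply: measurable_funM => //.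
    by apply: measurable_indic; exact: si.1.2.
  - by move=> v x _; rewrite lee_fin mulr_ge0// rnorm_ge0.
  apply: eq_bigr => v _; under eq_integral do rewrite EFinM.
  have ms : measurable (s @^-1` [set v]) by exact: si.1.2.
  rewrite ge0_integralZl_EFin ?rnorm_ge0 ?integral_indic ?setIT//.
  by apply/measurable_EFinP; exact: measurable_indic.
apply: (@le_trans _ _ (\sum_(v <- V) (rnorm ((fine (mu (s @^-1` [set v])))%:C *: v))%:E)%E).
  rewrite sumEFin lee_fin.
  elim/big_ind2 : _ => [|x1 x2 y1 y2 h1 h2|//]; first by rewrite rnorm0.
  by apply: le_trans (rnormD _ _) _; exact: lerD.
apply: lee_sum => v _; rewrite rnormZ rnormC ger0_norm ?fine_ge0//.
have [->|v0] := eqVneq v 0; first by rewrite rnorm0 mulr0 mul0e.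
by rewrite mulrC EFinM fineK// ge0_fin_numE// si.2.
Qed.

End simple_integral_theory.

(** * The Bochner integral *)

Section simple_approximation.
Context {d} {T : measurableType d} {R : realType} (mu : {measure set T -> \bar R}).
Implicit Types (X Y : normedModType R[i]).

Lemma simple_integrable_Lp X p (s : T -> X) : simple_fun s -> 0 < p -> Lp mu p s ->
  simple_integrable mu s.
Proof.
move=> ss p0 [ms Is]; split => // y y0.
have my : measurable (s @^-1` [set y]) by exact: ss.2.
have c0 : 0 < rnorm y `^ p by rewrite powR_gt0// lt_def rnorm_eq0 y0 rnorm_ge0.
have : ((rnorm y `^ p)%:E * mu (s @^-1` [set y]) <= powint mu p s)%E.
  have -> : mu (s @^-1` [set y]) = (\int[mu]_x (\1_(s @^-1` [set y]) x)%:E)%E.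
    by rewrite integral_indic ?setIT.
  rewrite -ge0_integralZl_EFin ?powR_ge0//; last first.
    by apply/measurable_EFinP; exact: measurable_indic.
  apply: ge0_le_integral => //.
  - by move=> x _; rewrite mule_ge0 ?lee_fin ?powR_ge0.
  - by apply: measurable_funeM; apply/measurable_EFinP; exact: measurable_indic.
  - exact: measurable_powint.
  move=> x _; rewrite indicE; case: (boolP (x \in _)) => [|_].
    by rewrite inE/= => ->; rewrite mule1.
  by rewrite mule0 lee_fin powR_ge0.
move=> h; have [/eqP Ey|] := eqVneq (mu (s @^-1` [set y])) +oo%E; last first.
  by rewrite -ltey.
exfalso; move: h; rewrite (eqP Ey) gt0_muley ?lte_fin//.
by rewrite leye_eq => /eqP Ep; move: Is; rewrite Lpnorm_lty ?gt_eqF// Ep.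
Qed.

(** Cutting the approximating simple functions at twice the norm of the limit
    keeps the pointwise convergence and provides the domination. *)
Lemma simple_approx X p (f : T -> X) : 0 < p -> Lp mu p f ->
  exists s : nat -> T -> X, [/\ forall k, simple_integrable mu (s k),
    forall x, s k x @[k --> \oo] --> f x,
    forall k x, rnorm (s k x) <= 2 * rnorm (f x) & Lcvg mu p s f].
Proof.
move=> p0 Lf; have [mf If] := Lf; have [s [ss sf]] := mf.
pose A k := [set x | rnorm (s k x) <= 2 * rnorm (f x)].
have mA k : measurable (A k).
  rewrite -[X in measurable X]setTI; apply: measurable_fun_ler => //.
    by apply: sm_rnorm; exact: sm_simple.
  by apply: measurable_funM => //; exact: sm_rnorm.
pose t k x := (\1_(A k) x : R)%:C *: s k x.
have st k : simple_fun (t k).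
  exact: (@simple_fun_map2 _ _ _ R[i] X X *:%R _ _ (simple_fun_indic (mA k)) (ss k)).
have tf k x : rnorm (t k x) <= 2 * rnorm (f x).
  rewrite /t indicE; case: (boolP (x \in A k)); first by rewrite inE scale1r.
  by rewrite scale0r rnorm0 mulr_ge0 ?rnorm_ge0.
have ctf x : t k x @[k --> \oo] --> f x.
  have [fx0|fx0] := eqVneq (f x) 0.
    rewrite (_ : (fun k => _) = fun=> f x); first exact: cvg_cst.
    apply/funext => k; apply/eqP; rewrite fx0 -rnorm_eq0 eq_le rnorm_ge0 andbT.
    by have := tf k x; rewrite fx0 rnorm0 mulr0.
  apply: cvg_trans (sf x); apply: near_eq_cvg.
  have r0 : 0 < rnorm (f x) by rewrite lt_def rnorm_eq0 fx0 rnorm_ge0.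
  have /cvgrPdist_lt/(_ _ r0) := rcvg_rnorm (sf x).
  apply: filterS => k; rewrite ltr_norml => /andP[h _].
  rewrite /t indicE mem_set ?scale1r// /A/=; lra.
have Lh : Lp mu p ((2 : R)%:C \*: f) by exact: LpZ.
have th k : \forall x \ae mu, rnorm (t k x) <= rnorm (((2 : R)%:C \*: f) x).
  by apply: aeW => x; rewrite /= rnormZ rnormC ger0_norm//; exact: tf.
exists t; split => //.
  move=> k; apply: (simple_integrable_Lp (st k) p0).
  by apply: Lp_le Lh (th k); [exact: ltW|exact: sm_simple].
apply: Lp_dominated Lh _ th => //; first by move=> k; exact: sm_simple.
exact: aeW.
Qed.

End simple_approximation.

Section bochner_integral_theory.
Context {d} {T : measurableType d} {R : realType} (mu : {measure set T -> \bar R}).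
Implicit Types (X Y : completeNormedModType R[i]).
Local Notation "'B[' f ]" := (bochner_integral mu f).

Lemma simple_integrable_L1 (X : normedModType R[i]) (s : T -> X) :
  simple_integrable mu s -> Lp mu 1 s.
Proof.
move=> si; split; first exact: (sm_simple si.1).
have [V uV VE] := finite_range_seq si.1.
rewrite Lpnorm1.
have -> : (\int[mu]_x (rnorm (s x))%:E =
    \int[mu]_x (\sum_(v <- V) (rnorm v * \1_(s @^-1` [set v]) x)%:E))%E.
  apply: eq_integral => x _; rewrite sumEFin; congr EFin.
  rewrite (bigD1_seq (s x))//= indicE mem_set// mulr1 big1 ?addr0// => v vs.
  by rewrite indicE memNset ?mulr0//= => sv; move: vs; rewrite sv eqxx.
rewrite ge0_integral_sum//; last 2 first.
- move=> v; apply/measurable_EFinP; apply: measurable_funM => //.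
  by apply: measurable_indic; exact: si.1.2.
- by move=> v x _; rewrite lee_fin mulr_ge0// rnorm_ge0.
apply: lte_sum_pinfty => v _; under eq_integral do rewrite EFinM.
have ms : measurable (s @^-1` [set v]) by exact: si.1.2.
rewrite ge0_integralZl_EFin ?rnorm_ge0 ?integral_indic ?setIT//; last first.
  by apply/measurable_EFinP; exact: measurable_indic.
have [->|v0] := eqVneq v 0; first by rewrite rnorm0 mul0e.
by apply: lte_mul_pinfty => //; [rewrite lee_fin rnorm_ge0|exact: si.2].
Qed.

Lemma simple_integralB (X : normedModType R[i]) (s t : T -> X) :
  simple_integrable mu s -> simple_integrable mu t ->
  simple_integral mu (s \- t) = simple_integral mu s - simple_integral mu t.
Proof.
move=> si ti.
have tN : simple_integrable mu ((-1 : R[i]) \*: t).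
  apply: (@simple_integrable_map2 _ _ _ mu X X X (fun x _ => (-1) *: x) t t) => //.
  by rewrite scaler0.
transitivity (simple_integral mu (s \+ ((-1 : R[i]) \*: t))).
  by congr simple_integral; apply/funext => x /=; rewrite scaleN1r.
by rewrite simple_integralD// simple_integralZ// scaleN1r.
Qed.

Lemma simple_integrableB (X : normedModType R[i]) (s t : T -> X) :
  simple_integrable mu s -> simple_integrable mu t ->
  simple_integrable mu (s \- t).
Proof.
by move=> si ti; apply: (@simple_integrable_map2 _ _ _ mu X X X (fun x y => x - y)) => //; rewrite subrr.
Qed.

(** Two approximating sequences are close in L^1, hence so are their integrals. *)
Lemma is_bochner_integral_Lcvg (X : normedModType R[i]) (f : T -> X) (v : X)
    (s : nat -> T -> X) :
  Lp mu 1 f -> is_bochner_integral mu f v ->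
  (forall k, simple_integrable mu (s k)) -> Lcvg mu 1 s f ->
  simple_integral mu (s k) @[k --> \oo] --> v.
Proof.
move=> [mf _] [t [_ ti /Lcvg0P tf tv]] si sf.
have ms k : strongly_measurable (s k) by exact: (sm_simple (si k).1).
have mt k : strongly_measurable (t k) by exact: (sm_simple (ti k).1).
apply/rcvgP; apply/cvgrPdist_lt => e e0.
have e3 : 0 < e / 3 by rewrite divr_gt0.
have tf3 := tf _ e3; have sf3 := sf _ e3.
move/rcvgP/cvgrPdist_lt : tv => /(_ _ e3) tv3.
near=> k.
rewrite sub0r normrN ger0_norm ?rnorm_ge0//.
have h1 : rnorm (simple_integral mu (t k) - v) < e / 3.
  have : `|0 - rnorm (simple_integral mu (t k) - v)| < e / 3 by near: k.
  by rewrite sub0r normrN ger0_norm ?rnorm_ge0.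
have h2 : (Lpnorm mu 1 (s k \- f)%R < (e / 3)%:E)%E by near: k.
have h3 : (Lpnorm mu 1 (t k \- f)%R < (e / 3)%:E)%E by near: k.
have h4 : ((rnorm (simple_integral mu (s k) - simple_integral mu (t k)))%:E < (e / 3 + e / 3)%:E)%E.
  rewrite -simple_integralB//.
  apply: le_lt_trans (le_simple_integral (simple_integrableB (si k) (ti k))) _.
  apply: le_lt_trans (LpnormB_ge (g := f) _ _ _ _ _) _ => //.
  by rewrite EFinD lteD// LpnormBC.
apply: le_lt_trans (rnormB _ (simple_integral mu (t k)) _) _.
by move: h4; rewrite lte_fin => h4; lra.
Unshelve. all: by end_near. Qed.

Lemma is_bochner_integral_exists X (f : T -> X) : Lp mu 1 f ->
  exists v, is_bochner_integral mu f v.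
Proof.
move=> Lf; have [s [si _ _ sf]] := simple_approx ltr01 Lf.
have [mf _] := Lf.
have ms k : strongly_measurable (s k) by exact: (sm_simple (si k).1).
suff : cvg (simple_integral mu (s k) @[k --> \oo]).
  move=> /cvg_ex[v sv]; exists v, s; split => //.
  exact/Lcvg0P.
apply/cauchy_cvgP/cauchyP => e e0.
have eE : e = (complex.Re e)%:C by rewrite RRe_real// gtr0_real.
have e0' : 0 < complex.Re e by rewrite -ltcR -eE.
have e2 : 0 < complex.Re e / 2 by rewrite divr_gt0.
have [N _ sN] := sf _ e2.
exists (simple_integral mu (s N)); exists N => // k /= Nk.
rewrite -ball_normE /= eE rnormE ltcR -lte_fin -simple_integralB//.
apply: le_lt_trans (le_simple_integral (simple_integrableB (si N) (si k))) _.
apply: le_lt_trans (LpnormB_ge (g := f) _ _ _ _ _) _ => //.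
rewrite [X in (_ < X%:E)%E]splitr EFinD lteD//; first exact: sN (leqnn N).
by rewrite LpnormBC; exact: sN.
Qed.

Lemma bochner_integralE X (f : T -> X) (v : X) : Lp mu 1 f ->
  is_bochner_integral mu f v -> B[f] = v.
Proof.
move=> Lf fv; rewrite /bochner_integral.
have fx := @xgetPex _ 0 (is_bochner_integral mu f) (ex_intro _ v fv).
have [s [_ si /Lcvg0P sf sv]] := fx.
have tv := is_bochner_integral_Lcvg Lf fv si sf.
by apply: (cvg_unique _ sv tv); exact: norm_hausdorff.
Qed.

Lemma bochner_integral_cvg X (f : T -> X) (s : nat -> T -> X) : Lp mu 1 f ->
  (forall k, simple_integrable mu (s k)) -> Lcvg mu 1 s f ->
  simple_integral mu (s k) @[k --> \oo] --> B[f].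
Proof.
move=> Lf si sf; have [v fv] := is_bochner_integral_exists Lf.
by rewrite (bochner_integralE Lf fv); exact: is_bochner_integral_Lcvg Lf fv si sf.
Qed.

Lemma le_bochner_integral X (f : T -> X) : Lp mu 1 f ->
  ((rnorm B[f])%:E <= Lpnorm mu 1 f)%E.
Proof.
move=> Lf; have [s [si _ _ sf]] := simple_approx ltr01 Lf.
have [mf If] := Lf.
have ms k : strongly_measurable (s k) by exact: (sm_simple (si k).1).
apply/lee_addgt0Pr => e e0.
have sB := bochner_integral_cvg Lf si sf.
have e2 : 0 < e / 2 by rewrite divr_gt0.
have sf2 := sf _ e2.
move/rcvgP/cvgrPdist_lt : sB => /(_ _ e2) sB.
near \oo => k.
have h1 : rnorm (simple_integral mu (s k) - B[f]) < e / 2.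
  have : `|0 - rnorm (simple_integral mu (s k) - B[f])| < e / 2 by near: k.
  by rewrite sub0r normrN ger0_norm ?rnorm_ge0.
have h2 : (Lpnorm mu 1 (s k \- f)%R < (e / 2)%:E)%E by near: k.
have h3 : (Lpnorm mu 1 (s k) <= Lpnorm mu 1 f + (e / 2)%:E)%E.
  have -> : s k = f \+ (s k \- f) by apply/funext => x /=; rewrite addrC subrK.
  apply: le_trans (LpnormD _ _ _ _) _ => //; first exact: smB.
  by rewrite leeD2l// ltW.
apply: (@le_trans _ _ ((rnorm (simple_integral mu (s k)))%:E + (e / 2)%:E)%E).
  rewrite -EFinD lee_fin; have := rnormB B[f] (simple_integral mu (s k)) 0.
  by rewrite !subr0 rnormBC; lra.
rewrite [e in leRHS]splitr EFinD addeA; apply: leeD => //.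
by apply: le_trans h3; exact: le_simple_integral.
Unshelve. all: by end_near. Qed.

Lemma LcvgD (X : normedModType R[i]) p (f g : nat -> T -> X) (f' g' : T -> X) :
  1 <= p -> (forall k, strongly_measurable (f k)) ->
  (forall k, strongly_measurable (g k)) ->
  strongly_measurable f' -> strongly_measurable g' ->
  Lcvg mu p f f' -> Lcvg mu p g g' -> Lcvg mu p (fun k => f k \+ g k) (f' \+ g').
Proof.
move=> p1 mf mg mf' mg' ff gg e e0.
have e2 : 0 < e / 2 by rewrite divr_gt0.
apply: filterS2 (ff _ e2) (gg _ e2) => k h1 h2.
rewrite (_ : (f k \+ g k) \- (f' \+ g') = (f k \- f') \+ (g k \- g')).
  apply: le_lt_trans (LpnormD _ _ _ _) _ => //; [exact: smB|exact: smB|].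
  by rewrite [e]splitr EFinD lteD.
by apply/funext => x /=; rewrite opprD addrACA.
Qed.

Lemma LcvgZ (X : normedModType R[i]) p a (f : nat -> T -> X) (f' : T -> X) :
  1 <= p -> (forall k, strongly_measurable (f k)) ->
  strongly_measurable f' ->
  Lcvg mu p f f' -> Lcvg mu p (fun k => a \*: f k) (a \*: f').
Proof.
move=> p1 mf mf' ff e e0.
have p0 : 0 < p by exact: lt_le_trans p1.
have a0 : 0 < rnorm a + 1 by rewrite ltr_wpDl ?rnorm_ge0.
have e2 : 0 < e / (rnorm a + 1) by rewrite divr_gt0.
apply: filterS (ff _ e2) => k h1.
rewrite (_ : (a \*: f k) \- (a \*: f') = a \*: (f k \- f')).
  rewrite LpnormZ//; last exact: smB.
  apply: (@le_lt_trans _ _ ((rnorm a + 1)%:E * Lpnorm mu p (f k \- f')%R)%E).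
    by rewrite lee_wpmul2r ?Lpnorm_ge0// lee_fin lerDl.
  rewrite -lte_pdivlMl// -EFinM mulrC//.
by apply/funext => x /=; rewrite scalerBr.
Qed.

Lemma bochner_integralD X (f g : T -> X) : Lp mu 1 f -> Lp mu 1 g ->
  B[f \+ g] = B[f] + B[g].
Proof.
move=> Lf Lg; have [s [si _ _ sf]] := simple_approx ltr01 Lf.
have [t [ti _ _ tg]] := simple_approx ltr01 Lg.
have ms k : strongly_measurable (s k) by exact: (sm_simple (si k).1).
have mt k : strongly_measurable (t k) by exact: (sm_simple (ti k).1).
have sti k : simple_integrable mu (s k \+ t k).
  by apply: (@simple_integrable_map2 _ _ _ mu X X X +%R) => //; rewrite addr0.
have h := LcvgD (lexx 1) ms mt Lf.1 Lg.1 sf tg.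
have c1 := bochner_integral_cvg (LpD (lexx 1) Lf Lg) sti h.
have c2 : simple_integral mu (s k) + simple_integral mu (t k) @[k --> \oo]
    --> B[f] + B[g].
  by apply: cvgD; [exact: bochner_integral_cvg sf|exact: bochner_integral_cvg tg].
have E : (fun k => simple_integral mu (s k \+ t k)) =
    (fun k => simple_integral mu (s k) + simple_integral mu (t k)).
  by apply/funext => k; rewrite simple_integralD.
by rewrite E in c1; apply: (cvg_unique _ c1 c2); exact: norm_hausdorff.
Qed.

(** On simple functions this is linearity of finite sums; boundedness of [L]
    carries it over to the limit. *)
Lemma bochner_integral_linear X Y (L : X -> Y) (M : R) (f : T -> X) :
  (forall x y, L (x + y) = L x + L y) ->
  (forall (r : R) x, L (r%:C *: x) = r%:C *: L x) ->
  (forall x, rnorm (L x) <= M * rnorm x) ->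
  Lp mu 1 f -> Lp mu 1 (L \o f) /\ B[L \o f] = L B[f].
Proof.
move=> LD LZ LM Lf.
have L0 : L 0 = 0.
  by have := LZ 0 0; rewrite -[(0 : R)%:C]/(0 : R[i]) !scale0r.
have LN x : L (- x) = - L x by apply/eqP; rewrite -addr_eq0 -LD addNr L0.
have Lc u (x : X) : u k @[k --> \oo] --> x -> L (u k) @[k --> \oo] --> L x.
  move=> /rcvgP ux; apply/rcvgP.
  apply: (@squeeze_cvgr _ _ _ _ (fun=> 0) (fun k => M * rnorm (u k - x))).
  - by apply: nearW => k; rewrite rnorm_ge0/= -LN -LD; exact: LM.
  - exact: cvg_cst.
  - by rewrite -[X in _ --> X](mulr0 M); apply: cvgM => //; exact: cvg_cst.
have LM' x : rnorm (L x) <= `|M| * rnorm x.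
  by apply: le_trans (LM x) _; rewrite ler_wpM2r ?rnorm_ge0// ler_norm.
have mLf : strongly_measurable (L \o f) by apply: sm_map Lf.1.
have LLf : Lp mu 1 (L \o f).
  apply: (@Lp_le _ _ _ _ _ _ _ _ (`|M|%:C \*: f)) => //; first exact: LpZ.
  by apply: aeW => x /=; rewrite rnormZ rnormC normr_id; exact: LM'.
split => //.
have [s [si sfx s2 sf]] := simple_approx ltr01 Lf.
have Lsi k : simple_integrable mu (L \o s k).
  exact: (@simple_integrable_map2 _ _ _ mu X X Y (fun x _ => L x) (s k) (s k)).
have LsLf : Lcvg mu 1 (fun k => L \o s k) (L \o f).
  apply: (@Lp_dominated _ _ _ _ _ _ _ _ _ ((`|M| * 2)%:C \*: f)) => //.
  - by move=> k; exact: (sm_simple (Lsi k).1).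
  - exact: LpZ.
  - by apply: aeW => x; exact: Lc.
  move=> k; apply: aeW => x /=; rewrite rnormZ rnormC ger0_norm ?mulr_ge0//.
  by rewrite -mulrA; apply: le_trans (LM' _) _; rewrite ler_wpM2l.
have c1 := bochner_integral_cvg LLf Lsi LsLf.
have c2 := Lc _ _ (bochner_integral_cvg Lf si sf).
apply: (cvg_unique _ c1); first exact: norm_hausdorff.
apply: cvg_trans c2; apply: near_eq_cvg; apply: nearW => k.
have [V uV VE] := finite_range_seq (si k).1.
rewrite -[simple_integral mu (s k)]/(simple_integral mu (id \o s k)).
rewrite (@simple_integral_regroup _ _ _ _ _ _ (s k) V id)//; last 2 first.
- exact: (si k).1.2.
- exact: (si k).2.
rewrite (@simple_integral_regroup _ _ _ _ _ _ (s k) V L)//; last 2 first.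
- exact: (si k).1.2.
- by move=> v Lv; apply: (si k).2; apply: contra Lv => /eqP ->; rewrite L0.
elim: V {uV VE} => [|v V IH]; first by rewrite !big_nil L0.
by rewrite !big_cons LD LZ IH.
Qed.

Lemma bochner_integralZ X (a : R[i]) (f : T -> X) : Lp mu 1 f ->
  B[a \*: f] = a *: B[f].
Proof.
move=> Lf; apply: (@bochner_integral_linear _ _ ( *:%R a) (rnorm a) f _ _ _ Lf).2.
- exact: scalerDr.
- by move=> r x; rewrite !scalerA mulrC.
- by move=> x; rewrite rnormZ.
Qed.

Lemma bochner_integralB X (f g : T -> X) : Lp mu 1 f -> Lp mu 1 g ->
  B[f \- g] = B[f] - B[g].
Proof.
move=> Lf Lg; rewrite -scaleN1r -bochner_integralZ// -bochner_integralD//.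
  by congr (B[_]); apply/funext => x /=; rewrite scaleN1r.
exact: LpZ.
Qed.

Lemma eq_bochner_integral X (f g : T -> X) : Lp mu 1 f -> Lp mu 1 g ->
  (\forall x \ae mu, f x = g x) -> B[f] = B[g].
Proof.
move=> Lf Lg fg; apply/eqP; rewrite -subr_eq0 -rnorm_eq0 -bochner_integralB//.
rewrite eq_le rnorm_ge0 andbT -lee_fin.
apply: le_trans (le_bochner_integral (LpB (lexx 1) Lf Lg)) _.
apply: (@le_trans _ _ (Lpnorm mu 1 (cst 0 : T -> X))); last first.
  by rewrite Lpnorm0// oner_eq0.
apply: le_Lpnorm => //; [exact: smB Lf.1 Lg.1|exact: sm_cst|].
by apply: filterS fg => x /= ->; rewrite subrr.
Qed.

Lemma bochner_integral_dominated X Y (f : nat -> T -> X) (g : T -> X) (h : T -> Y) :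
  (forall k, strongly_measurable (f k)) -> strongly_measurable g ->
  Lp mu 1 h -> (\forall x \ae mu, f k x @[k --> \oo] --> g x) ->
  (forall k, \forall x \ae mu, rnorm (f k x) <= rnorm (h x)) ->
  B[f k] @[k --> \oo] --> B[g].
Proof.
move=> mf mg Lh fg fh.
have Lfk k : Lp mu 1 (f k) by apply: Lp_le Lh (fh k).
have Lg : Lp mu 1 g.
  apply: Lp_le Lh _ => //; apply: filterS2 fg (ae_forall_nat fh) => x fgx fhx.
  have c := rcvg_rnorm fgx.
  rewrite -(cvg_lim _ c)//; apply: limr_le; first by apply/cvg_ex; exists (rnorm (g x)).
  exact: nearW.
have L := Lp_dominated ltr01 mf mg Lh fg fh.
apply/rcvgP; apply/cvgrPdist_lt => e e0.
apply: filterS (L _ e0) => k hk.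
rewrite sub0r normrN ger0_norm ?rnorm_ge0// -lte_fin -bochner_integralB//.
by apply: le_lt_trans hk; apply: le_bochner_integral; exact: LpB.
Qed.

End bochner_integral_theory.

(** * Measure-preserving maps and integrals of complex functions *)

Section measure_preserving.
Context {d} {T : measurableType d} {R : realType} (mu : {measure set T -> \bar R}).

Definition measure_preserving (U : T -> T) :=
  measurable_fun setT U /\ forall A, measurable A -> mu (U @^-1` A) = mu A.

Lemma measure_preserving_id : measure_preserving id.
Proof. by split => //; exact: measurable_id. Qed.

Lemma measure_preserving_comp U V : measure_preserving U -> measure_preserving V ->
  measure_preserving (U \o V).
Proof.
move=> [mU pU] [mV pV]; split; first exact: measurableT_comp.
move=> A mA; rewrite comp_preimage pV ?pU//.
by rewrite -[X in measurable X]setTI; exact: mU.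
Qed.

Lemma ge0_integral_mp U (f : T -> \bar R) : measure_preserving U ->
  measurable_fun setT f -> (forall x, 0 <= f x)%E ->
  (\int[mu]_x f (U x) = \int[mu]_x f x)%E.
Proof.
move=> [mU pU] mf f0.
have := @ge0_integral_pushforward _ _ _ _ R U mU mu setT f measurableT mf (fun x _ => f0 x).
rewrite preimage_setT => <-; apply: eq_measure_integral => A mA _.
exact: pU.
Qed.

Lemma ae_mp U (P : T -> Prop) : measure_preserving U ->
  (\forall x \ae mu, P x) -> \forall x \ae mu, P (U x).
Proof.
move=> [mU pU] [N [mN N0 PN]]; exists (U @^-1` N); split.
- by rewrite -[X in measurable X]setTI; exact: mU.
- by rewrite pU.
- by move=> x /= nP; exact: PN.
Qed.

Lemma powint_mp U p (X : normedModType R[i]) (f : T -> X) : measure_preserving U ->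
  strongly_measurable f -> powint mu p (f \o U) = powint mu p f.
Proof.
move=> pU mf.
apply: (@ge0_integral_mp U (fun x => ((rnorm (f x)) `^ p)%:E)) => //.
  exact: measurable_powint.
by move=> x; rewrite lee_fin powR_ge0.
Qed.

Lemma Lpnorm_mp U p (X : normedModType R[i]) (f : T -> X) : measure_preserving U ->
  strongly_measurable f -> Lpnorm mu p (f \o U) = Lpnorm mu p f.
Proof. by move=> pU mf; rewrite !LpnormE powint_mp. Qed.

Lemma Lp_mp U p (X : normedModType R[i]) (f : T -> X) : measure_preserving U ->
  Lp mu p f -> Lp mu p (f \o U).
Proof.
move=> pU [mf If]; split; last by rewrite Lpnorm_mp.
by apply: sm_comp => //; exact: pU.1.
Qed.

Lemma simple_integral_mp U (X : normedModType R[i]) (s : T -> X) :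
  measure_preserving U -> simple_integrable mu s ->
  simple_integrable mu (s \o U) /\
  simple_integral mu (s \o U) = simple_integral mu s.
Proof.
move=> pU si.
have msU v : measurable ((s \o U) @^-1` [set v]).
  rewrite comp_preimage -[X in measurable X]setTI; apply: pU.1 => //.
  exact: si.1.2.
have pv v : mu ((s \o U) @^-1` [set v]) = mu (s @^-1` [set v]).
  by rewrite comp_preimage pU.2//; exact: si.1.2.
have fU v : v != 0 -> (mu ((s \o U) @^-1` [set v]) < +oo)%E.
  by move=> v0; rewrite pv; exact: si.2.
split.
  split => //; split => //.
  by apply: sub_finite_set si.1.1 => _ [x _ <-]; exists (U x).
have [V uV VE] := finite_range_seq si.1.
rewrite -[LHS]/(simple_integral mu (id \o (s \o U))).
rewrite -[RHS]/(simple_integral mu (id \o s)).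
rewrite (@simple_integral_regroup _ _ _ _ _ _ (s \o U) V id)//; last first.
  by move=> x; exact: VE.
rewrite (@simple_integral_regroup _ _ _ _ _ _ s V id)//; last 2 first.
- exact: si.1.2.
- exact: si.2.
by apply: eq_bigr => v _; rewrite pv.
Qed.

Lemma bochner_integral_mp U (X : completeNormedModType R[i]) (f : T -> X) :
  measure_preserving U -> Lp mu 1 f ->
  bochner_integral mu (f \o U) = bochner_integral mu f.
Proof.
move=> pU Lf; have [s [si _ _ sf]] := simple_approx ltr01 Lf.
have c1 := bochner_integral_cvg Lf si sf.
have siU k := (simple_integral_mp pU (si k)).1.
have sfU : Lcvg mu 1 (fun k => s k \o U) (f \o U).
  move=> e e0; apply: filterS (sf e e0) => k.
  rewrite -[X in _ -> (Lpnorm _ _ X < _)%E]/((s k \- f) \o U) Lpnorm_mp//.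
  apply: smB Lf.1; exact: (sm_simple (si k).1).
have c2 := bochner_integral_cvg (Lp_mp pU Lf) siU sfU.
have E : (fun k => simple_integral mu (s k \o U)) =
    (fun k => simple_integral mu (s k)).
  by apply/funext => k; exact: (simple_integral_mp pU (si k)).2.
by rewrite E in c2; apply: (cvg_unique _ c2 c1); exact: norm_hausdorff.
Qed.

End measure_preserving.

Section complex_integral.
Context {d} {T : measurableType d} {R : realType} (mu : {measure set T -> \bar R}).
Local Notation C := R[i].

Lemma Lp1_real (f : T -> R) :
  Lp mu 1 (fun x => (f x)%:C : C) <-> mu.-integrable setT (EFin \o f).
Proof.
have IE : Lpnorm mu 1 (fun x => (f x)%:C : C) = (\int[mu]_x `|(EFin \o f) x|)%E.
  by rewrite Lpnorm1; apply: eq_integral => x _; rewrite rnormC.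
split=> [[/sm_complexP[mf _] If]|/integrableP[mf If]].
  by apply/integrableP; split; [exact/measurable_EFinP|rewrite -IE].
split; last by rewrite IE.
by apply: sm_realC; exact/measurable_EFinP.
Qed.

Lemma Lp1_Re (f : T -> C) : Lp mu 1 f ->
  mu.-integrable setT (EFin \o (fun x => complex.Re (f x))).
Proof.
move=> Lf; apply/Lp1_real; apply: (Lp_le _ _ Lf) => //.
  by apply: sm_realC; have /sm_complexP[] := Lf.1.
by apply: aeW => x; rewrite rnormC; exact: ler_Re_rnorm.
Qed.

Lemma Rintegral_simple (s : T -> C) : simple_integrable mu s ->
  (\int[mu]_x complex.Re (s x) = complex.Re (simple_integral mu s))%R.
Proof.
move=> si; have [V uV VE] := finite_range_seq si.1.
rewrite -[X in complex.Re X]/(simple_integral mu (id \o s)).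
rewrite (@simple_integral_regroup _ _ _ _ _ _ s V id)//; last 2 first.
- exact: si.1.2.
- exact: si.2.
pose h v x := (complex.Re v * \1_(s @^-1` [set v]) x)%:E : \bar R.
have hfin (v : C) : ((complex.Re v)%:E * mu (s @^-1` [set v]) =
    (complex.Re v * fine (mu (s @^-1` [set v])))%:E)%E.
  have [->|v0] := eqVneq v 0; first by rewrite mul0e mul0r.
  by rewrite EFinM fineK// ge0_fin_numE// si.2.
have iA v : v != 0 -> mu.-integrable setT (fun x => (\1_(s @^-1` [set v]) x)%:E).
  move=> v0; have ms : measurable (s @^-1` [set v]) by exact: si.1.2.
  apply/integrableP; split; first by apply/measurable_EFinP; exact: measurable_indic.
  under eq_integral do rewrite gee0_abs ?lee_fin//.
  by rewrite integral_indic ?setIT//; exact: si.2.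
have ih v : mu.-integrable setT (h v).
  have [->|v0] := eqVneq v 0.
    rewrite (_ : h 0 = cst 0%E); first exact: integrable0.
    by apply/funext => x; rewrite /h mul0r.
  apply: (eq_integrable _ (fun x => ((complex.Re v)%:E * (\1_(s @^-1` [set v]) x)%:E)%E)) => //.
  by apply: integrableZl => //; exact: iA.
have Ih v : (\int[mu]_x h v x = (complex.Re v)%:E * mu (s @^-1` [set v]))%E.
  have ms : measurable (s @^-1` [set v]) by exact: si.1.2.
  have [->|v0] := eqVneq v 0.
    by rewrite mul0e; under eq_integral do rewrite /h mul0r; rewrite integral0.
  rewrite /h; under eq_integral do rewrite EFinM.
  by rewrite integralZl ?integral_indic ?setIT//; exact: iA.
rewrite /Rintegral.
transitivity (fine (\int[mu]_x (\sum_(v <- V) h v x))%E).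
  congr fine; apply: eq_integral => x _; rewrite sumEFin; congr EFin.
  rewrite (bigD1_seq (s x))//= indicE mem_set// mulr1 big1 ?addr0// => v vs.
  by rewrite indicE memNset ?mulr0//= => sv; move: vs; rewrite sv eqxx.
rewrite integral_sum//.
under eq_bigr => v _ do rewrite Ih hfin.
rewrite sumEFin/= raddf_sum/=; apply: eq_bigr => v _.
by rewrite mulrC; case: v => a b /=; rewrite mul0r subr0.
Qed.

(** Makes the theory of the real Lebesgue integral available for complex
    functions. *)
Lemma bochner_integral_Re (f : T -> C) : Lp mu 1 f ->
  complex.Re (bochner_integral mu f) = (\int[mu]_x complex.Re (f x))%R.
Proof.
move=> Lf; have [s [si sfx s2 sf]] := simple_approx ltr01 Lf.
have c1 := rcvg_Re (bochner_integral_cvg Lf si sf).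
have ms k : strongly_measurable (s k) by exact: (sm_simple (si k).1).
suff c2 : complex.Re (simple_integral mu (s k)) @[k --> \oo] -->
    (\int[mu]_x complex.Re (f x))%R.
  by apply: (cvg_unique _ c1 c2); exact: Rhausdorff.
rewrite (_ : (fun k => _) = (fun k => \int[mu]_x complex.Re (s k x))%R); last first.
  by apply/funext => k; rewrite Rintegral_simple.
apply/cvgrPdist_lt => e e0; apply: filterS (sf e e0) => k h.
have Lsk := simple_integrable_L1 (si k).
rewrite distrC -RintegralB//; [|exact: Lp1_Re|exact: Lp1_Re].
apply: le_lt_trans (le_normr_Rintegral _ _) _ => //.
  exact: (@integrableB _ _ _ mu _ measurableT _ _ (Lp1_Re Lsk) (Lp1_Re Lf)).
have Lsf : Lp mu 1 (s k \- f) by exact: LpB.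
rewrite -lte_fin /Rintegral fineK; last first.
  rewrite ge0_fin_numE; last exact: integral_ge0.
  apply: le_lt_trans Lsf.2; rewrite Lpnorm1; apply: ge0_le_integral => //.
  - apply/measurable_EFinP; apply: measurableT_comp => //.
    by apply: measurable_funB; [have /sm_complexP[]:= ms k|have /sm_complexP[]:= Lf.1].
  - by apply/measurable_EFinP; exact: sm_rnorm Lsf.1.
  - by move=> x _; rewrite lee_fin -raddfB; exact: ler_Re_rnorm.
apply: le_lt_trans h; rewrite Lpnorm1; apply: ge0_le_integral => //.
- apply/measurable_EFinP; apply: measurableT_comp => //.
  by apply: measurable_funB; [have /sm_complexP[]:= ms k|have /sm_complexP[]:= Lf.1].
- by apply/measurable_EFinP; exact: sm_rnorm Lsf.1.
- by move=> x _; rewrite lee_fin -raddfB; exact: ler_Re_rnorm.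
Qed.

Lemma bochner_integral_complex (f : T -> C) : Lp mu 1 f ->
  bochner_integral mu f =
  (\int[mu]_x complex.Re (f x))%R +i* (\int[mu]_x complex.Im (f x))%R.
Proof.
move=> Lf; apply/eqP; rewrite eq_complex /= bochner_integral_Re// eqxx /=.
have E : complex.Re (- 'i * bochner_integral mu f) = complex.Im (bochner_integral mu f).
  by case: (bochner_integral mu f) => a b /=; rewrite oppr0 mul0r mulN1r opprK add0r.
rewrite -E -[- 'i * _]/(- 'i *: bochner_integral mu f) -bochner_integralZ//.
rewrite bochner_integral_Re; last exact: LpZ.
apply/eqP; apply: eq_Rintegral => x _.
by rewrite /=; case: (f x) => a b /=; rewrite oppr0 mul0r mulN1r opprK add0r.
Qed.

End complex_integral.

(** * Lebesgue measure on R^n by induction on n *)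

Section lebesgue_line.
Context {R : realType}.
Local Notation mR := (measurableTypeR R).
Local Notation leb := (@lebesgue_measure R).

Lemma measure_preserving_shift (c : R) :
  measure_preserving leb (fun x : mR => x + c : mR).
Proof.
have ms : measurable_fun setT (fun x : mR => x + c : mR).
  by apply: measurable_funD.
split => // A mA.
pose nu : {measure set mR -> \bar R} :=
  measure_function_pushforward__canonical__measure_function_Measure leb ms.
rewrite -[LHS]/(nu A); apply/esym/lebesgue_measure_unique => //.
move=> _ [[a b] _ <-]; rewrite /nu/= /pushforward.
rewrite (_ : _ @^-1` _ = `](a - c), (b - c)]%classic); last first.
  by apply/seteqP; split => x /=; rewrite !in_itv/= ltrBlDr lerBrDr.
rewrite !lebesgue_measure_itv/= !lte_fin ltrD2r.
by case: ifPn => // _; rewrite -!EFinD; congr (_%:E); rewrite opprD opprK addrACA addNr addr0.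
Qed.

Lemma measure_preserving_opp : measure_preserving leb (fun x : mR => - x : mR).
Proof.
split; first exact: measurable_funN.
by move=> A mA; exact: lebesgue_measureN.
Qed.

End lebesgue_line.

Section tonelli.
Context {R : realType}.
Local Notation mR := (measurableTypeR R).
Local Notation leb := (@lebesgue_measure R).
Local Notation mu n := (@lebesgue_Rn R n).

Lemma measurable_thead n : measurable_fun setT (@thead n mR).
Proof. exact: measurable_tnth. Qed.

Lemma measurable_behead_tuple n :
  measurable_fun setT (@behead_tuple n.+1 mR : Rn R n.+1 -> Rn R n).
Proof. exact: measurable_behead. Qed.

Lemma lebesgue_Rn_sigma_finite n : sigma_finite setT (mu n).
Proof.
elim: n => [|n [F TF Foo]].
  exists (fun=> setT); first by rewrite bigcup_const//; exists 0%N.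
  by move=> k; split => //; rewrite /= diracT ltry.
have [G TG Goo] := @sigma_finiteT _ _ _ leb.
exists (fun k => if unpickle k is Some (i, j) then
   [set v | G i (thead v) /\ F j (behead_tuple v)] else set0).
  apply/seteqP; split => // v _.
  have : setT (thead v) by [].
  rewrite TG => -[i _ Gi].
  have : setT (behead_tuple v) by [].
  rewrite TF => -[j _ Fj].
  by exists (pickle (i, j)) => //; rewrite pickleK.
move=> k; case: unpickle => [[i j]|]; last by split; rewrite ?measure0.
have [mG Gi] := Goo i; have [mF Fj] := Foo j.
have mGF : measurable ((@thead n mR) @^-1` G i `&` (@behead_tuple n.+1 mR) @^-1` F j).
  by apply: measurableI; rewrite -[X in measurable X]setTI;
    [exact: measurable_thead|exact: measurable_behead_tuple].
split => //.
rewrite /= /pushforward.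
rewrite (_ : _ @^-1` _ = G i `*` F j).
  by rewrite product_measure2E// lte_mul_pinfty// ge0_fin_numE.
apply/seteqP; split => -[x t] /= [Gx Ft]; split => //.
- by move: Ft; congr (F j _); apply: val_inj.
- by move: Ft; congr (F j _); apply: val_inj.
Qed.

(** A name for Lebesgue measure that carries its sigma-finiteness, as product
    measures require. *)
Definition vol n : set (Rn R n) -> \bar R := mu n.
HB.instance Definition _ n := Measure.copy (@vol n) (mu n).
HB.instance Definition _ n :=
  Measure_isSigmaFinite.Build _ _ _ (@vol n) (lebesgue_Rn_sigma_finite n).

Lemma integral_lebesgue_RnS n (f : Rn R n.+1 -> \bar R) :
  measurable_fun setT f -> (forall x, 0 <= f x)%E ->
  (\int[mu n.+1]_v f v =
   \int[(leb \x @vol n)%E]_z f [the n.+1.-tuple mR of z.1 :: z.2])%E.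
Proof.
move=> mf f0.
transitivity (\int[(leb \x^ mu n)%E]_z f [the n.+1.-tuple mR of z.1 :: z.2])%E.
  have := @ge0_integral_pushforward _ _ _ _ R _ (@measurable_tcons R n)
    (leb \x^ mu n)%E setT f measurableT mf (fun x _ => f0 x).
  by rewrite preimage_setT.
apply: eq_measure_integral => A mA _; apply/esym/product_measure_unique => //.
by move=> B D mB mD; exact: product_measure2E.
Qed.

Lemma tonelli1 n (f : Rn R n.+1 -> \bar R) :
  measurable_fun setT f -> (forall x, 0 <= f x)%E ->
  (\int[mu n.+1]_v f v =
   \int[leb]_x \int[mu n]_t f [the n.+1.-tuple mR of x :: t])%E.
Proof.
move=> mf f0; rewrite integral_lebesgue_RnS//.
apply: (@fubini_tonelli1 _ _ _ _ _ leb (@vol n)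
  (fun z => f [the n.+1.-tuple mR of z.1 :: z.2])) => //.
by apply: measurableT_comp => //; exact: measurable_tcons.
Qed.

Lemma tonelli2 n (f : Rn R n.+1 -> \bar R) :
  measurable_fun setT f -> (forall x, 0 <= f x)%E ->
  (\int[mu n.+1]_v f v =
   \int[mu n]_t \int[leb]_x f [the n.+1.-tuple mR of x :: t])%E.
Proof.
move=> mf f0; rewrite integral_lebesgue_RnS//.
apply: (@fubini_tonelli2 _ _ _ _ _ leb (@vol n)
  (fun z => f [the n.+1.-tuple mR of z.1 :: z.2])) => //.
by apply: measurableT_comp => //; exact: measurable_tcons.
Qed.

Lemma measure_preservingP d (T : measurableType d) (nu : {measure set T -> \bar R})
    (U : T -> T) : measurable_fun setT U ->
  (forall f : T -> \bar R, measurable_fun setT f -> (forall x, 0 <= f x)%E ->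
    \int[nu]_x f (U x) = \int[nu]_x f x)%E ->
  measure_preserving nu U.
Proof.
move=> mU h; split => // A mA.
have mUA : measurable (U @^-1` A) by rewrite -[X in measurable X]setTI; exact: mU.
have nuE B : measurable B -> nu B = (\int[nu]_x (\1_B x)%:E)%E.
  by move=> mB; rewrite integral_indic// setIT.
rewrite !nuE// -(h (fun x => (\1_A x)%:E))//.
by apply/measurable_EFinP; exact: measurable_indic.
Qed.

Lemma measurable_cons_fun n (g : Rn R n.+1 -> mR) (V : Rn R n.+1 -> Rn R n) :
  measurable_fun setT g -> measurable_fun setT V ->
  measurable_fun setT (fun v => [the n.+1.-tuple mR of g v :: V v]).
Proof. exact: measurable_cons. Qed.

Lemma thead_cons n (x : mR) (t : Rn R n) : thead [the n.+1.-tuple mR of x :: t] = x.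
Proof. by []. Qed.

Lemma behead_cons n (x : mR) (t : Rn R n) :
  behead_tuple [the n.+1.-tuple mR of x :: t] = t.
Proof. exact: val_inj. Qed.

(** A map of R^(n+1) acting on the first coordinate only, by a
    measure-preserving map of the line that depends on the other ones. *)
Lemma measure_preserving_head n (g : R -> Rn R n -> mR) :
  measurable_fun setT (fun v : Rn R n.+1 => g (thead v) (behead_tuple v)) ->
  (forall t, measure_preserving leb (g ^~ t)) ->
  measure_preserving (mu n.+1)
    (fun v => [the n.+1.-tuple mR of g (thead v) (behead_tuple v) :: behead_tuple v]).
Proof.
move=> mg pg.
have mU := measurable_cons_fun mg (@measurable_behead_tuple n).
apply: measure_preservingP => // f mf f0.
rewrite [RHS]tonelli2// [LHS]tonelli2//; last exact: measurableT_comp.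
apply: eq_integral => t _ /=; under eq_integral do rewrite thead_cons behead_cons.
apply: (@ge0_integral_mp _ _ _ leb (g ^~ t) (fun x => f [the n.+1.-tuple mR of x :: t])) => //.
by apply: measurableT_comp => //; apply: measurable_cons => //; exact: measurable_cst.
Qed.

Lemma measure_preserving_tail n (V : R -> Rn R n -> Rn R n) :
  measurable_fun setT (fun v : Rn R n.+1 => V (thead v) (behead_tuple v)) ->
  (forall x, measure_preserving (mu n) (V x)) ->
  measure_preserving (mu n.+1)
    (fun v => [the n.+1.-tuple mR of thead v :: V (thead v) (behead_tuple v)]).
Proof.
move=> mV pV.
have mU := measurable_cons_fun (@measurable_thead n) mV.
apply: measure_preservingP => // f mf f0.
rewrite [RHS]tonelli1// [LHS]tonelli1//; last exact: measurableT_comp.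
apply: eq_integral => x _ /=; under eq_integral do rewrite thead_cons behead_cons.
apply: (@ge0_integral_mp _ _ _ (mu n) (V x) (fun t => f [the n.+1.-tuple mR of x :: t])) => //.
by apply: measurableT_comp => //; apply: measurable_cons => //; exact: measurable_cst.
Qed.

End tonelli.

(** * Linear isometries of R^n *)

Section euclidean_theory.
Context {R : realType}.
Local Notation mR := (measurableTypeR R).
Local Notation mu n := (@lebesgue_Rn R n).
Local Notation "x :::  t" := [the _.+1.-tuple mR of x :: t] (at level 60).

Lemma tuple_split n (v : Rn R n.+1) : v = thead v ::: behead_tuple v.
Proof. by rewrite {1}(tuple_eta v); exact: val_inj. Qed.

Lemma eq_tcons n (x y : mR) (t u : Rn R n) : x = y -> t = u -> x ::: t = y ::: u.
Proof. by move=> -> ->. Qed.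

Lemma dotp_cons n (x y : mR) (t u : Rn R n) :
  dotp (x ::: t) (y ::: u) = x * y + dotp t u.
Proof.
rewrite /dotp big_ord_recl !tnth0; congr (_ + _).
by apply: eq_bigr => i _; rewrite !tnthS.
Qed.

Lemma dotpC n (x y : Rn R n) : dotp x y = dotp y x.
Proof. by apply: eq_bigr => i _; rewrite mulrC. Qed.

Lemma enormE n (x : Rn R n) : enorm x = Num.sqrt (dotp x x).
Proof. by congr Num.sqrt; apply: eq_bigr => i _; rewrite expr2. Qed.

Lemma dotp_ge0 n (x : Rn R n) : 0 <= dotp x x.
Proof. by apply: sumr_ge0 => i _; rewrite -expr2 sqr_ge0. Qed.

Lemma enorm_ge0 n (x : Rn R n) : 0 <= enorm x.
Proof. exact: sqrtr_ge0. Qed.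

Lemma sqr_enorm n (x : Rn R n) : enorm x ^+ 2 = dotp x x.
Proof. by rewrite enormE sqr_sqrtr// dotp_ge0. Qed.

Lemma measurable_dotp n (y : Rn R n) : measurable_fun setT (fun x => dotp x y).
Proof.
apply: measurable_sum => i; apply: measurable_funM => //.
exact: measurable_tnth.
Qed.

Lemma measurable_dotpr n (y : Rn R n) : measurable_fun setT (fun x => dotp y x).
Proof.
apply: measurable_sum => i; apply: measurable_funM => //.
exact: measurable_tnth.
Qed.

Definition tsub n (x y : Rn R n) : Rn R n := [tuple tnth x i - tnth y i | i < n].

Lemma tnth_tsub n (x y : Rn R n) i : tnth (tsub x y) i = tnth x i - tnth y i.
Proof. by rewrite tnth_mktuple. Qed.

Lemma dotp_tsub n (x y z : Rn R n) : dotp (tsub x y) z = dotp x z - dotp y z.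
Proof.
rewrite /dotp -sumrB; apply: eq_bigr => i _.
by rewrite tnth_tsub mulrBl.
Qed.

Lemma dotp_tsub_sqr n (x y : Rn R n) :
  dotp (tsub x y) (tsub x y) = dotp x x - 2 * dotp x y + dotp y y.
Proof.
rewrite dotp_tsub !(dotpC _ (tsub x y)) !dotp_tsub (dotpC y x); ring.
Qed.

Lemma enorm_tsubC n (x y : Rn R n) : enorm (tsub x y) = enorm (tsub y x).
Proof. by rewrite !enormE !dotp_tsub_sqr (dotpC y x); congr Num.sqrt; ring. Qed.

Lemma ler_tnth_enorm n (x : Rn R n) i : `|tnth x i| <= enorm x.
Proof.
rewrite -(@ler_pXn2r _ 2) ?nnegrE ?enorm_ge0// sqr_enorm real_normK ?num_real//.
rewrite /dotp (bigD1 i)//= -expr2 lerDl.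
by apply: sumr_ge0 => j _; rewrite -expr2 sqr_ge0.
Qed.

Lemma enorm_le_sum n (x : Rn R n) : enorm x <= \sum_(i < n) `|tnth x i|.
Proof.
have s0 : 0 <= \sum_(i < n) `|tnth x i| by exact: sumr_ge0.
rewrite -(@ler_pXn2r _ 2) ?nnegrE ?enorm_ge0// sqr_enorm /dotp expr2 mulr_suml.
apply: ler_sum => i _; apply: le_trans (ler_norm _) _; rewrite normrM.
by rewrite ler_wpM2l// (bigD1 i)//= lerDl sumr_ge0.
Qed.

Lemma measurable_tsub n : measurable_fun setT (fun z : Rn R n * Rn R n => tsub z.1 z.2).
Proof.
apply/measurable_fun_tnthP => i.
rewrite (_ : _ \o _ = (fun z : Rn R n * Rn R n => tnth z.1 i - tnth z.2 i)); last first.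
  by apply/funext => z /=; rewrite tnth_tsub.
apply: measurable_funB.
  exact: (@measurableT_comp _ _ _ _ _ _ (fun x => tnth x i) _ fst (measurable_tnth i)).
exact: (@measurableT_comp _ _ _ _ _ _ (fun x => tnth x i) _ snd (measurable_tnth i)).
Qed.

Lemma measurable_enorm n : measurable_fun setT (@enorm R n).
Proof.
apply: (@measurableT_comp _ _ _ _ _ _ (@Num.sqrt R)).
  by apply: continuous_measurable_fun; exact: sqrt_continuous.
apply: measurable_sum => i.
by apply: measurable_funX; exact: measurable_tnth.
Qed.

Lemma tsub_cons n (x b : mR) (t u : Rn R n) :
  tsub (x ::: t) (b ::: u) = (x - b) ::: tsub t u.
Proof.
apply: eq_from_tnth => i; rewrite tnth_tsub.
by case: (unliftP ord0 i) => [j|] ->; rewrite ?tnthS ?tnth0// tnth_tsub.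
Qed.

Lemma measure_preserving_tsub n (b : Rn R n) : measure_preserving (mu n) (fun x => tsub x b).
Proof.
elim: n b => [b|n IH b].
  rewrite (_ : (fun x => tsub x b) = id); first exact: measure_preserving_id.
  by apply/funext => x; rewrite [LHS]tuple0 [RHS]tuple0.
rewrite (_ : (fun x => tsub x b) =
   (fun v => (thead v + - thead b) ::: behead_tuple v) \o
   (fun v => thead v ::: tsub (behead_tuple v) (behead_tuple b))); last first.
  apply/funext => v; rewrite [in LHS](tuple_split v) [in LHS](tuple_split b).
  by rewrite tsub_cons /= thead_cons behead_cons.
apply: measure_preserving_comp.
  apply: (@measure_preserving_head _ _ (fun x _ => x + - thead b)).
    by apply: measurable_funD => //; exact: measurable_thead.
  by move=> t; exact: measure_preserving_shift.
apply: (@measure_preserving_tail _ _ (fun _ t => tsub t (behead_tuple b))).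
  exact: (measurableT_comp (IH (behead_tuple b)).1 (@measurable_behead_tuple R n)).
by move=> x; exact: IH.
Qed.

(** Linear isometries are recorded as pairs made of a map and its adjoint, which
    is also its inverse. *)
Record isometry n (U V : Rn R n -> Rn R n) : Prop := Isometry {
  iso_mp : measure_preserving (mu n) U;
  iso_mpV : measure_preserving (mu n) V;
  isoK : cancel U V;
  isoKV : cancel V U;
  iso_adj : forall x y, dotp (U x) y = dotp x (V y) }.

Lemma iso_sym n (U V : Rn R n -> Rn R n) : isometry U V -> isometry V U.
Proof.
move=> [pU pV UV VU a]; split => // x y.
by rewrite dotpC -a dotpC.
Qed.

Lemma iso_id n : isometry (@id (Rn R n)) id.
Proof. by split => //; exact: measure_preserving_id. Qed.

Lemma iso_comp n (U V U' V' : Rn R n -> Rn R n) : isometry U V -> isometry U' V' ->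
  isometry (U \o U') (V' \o V).
Proof.
move=> [pU pV UV VU a] [pU' pV' UV' VU' a']; split.
- exact: measure_preserving_comp.
- exact: measure_preserving_comp.
- exact: can_comp.
- exact: can_comp.
- by move=> x y /=; rewrite a a'.
Qed.

Lemma iso_dotp n (U V : Rn R n -> Rn R n) x y : isometry U V ->
  dotp (U x) (U y) = dotp x y.
Proof. by move=> iU; rewrite (iso_adj iU) (isoK iU). Qed.

Lemma iso_enorm n (U V : Rn R n -> Rn R n) x : isometry U V ->
  enorm (U x) = enorm x.
Proof. by move=> iU; rewrite !enormE (iso_dotp _ _ iU). Qed.

Lemma iso_dist n (U V : Rn R n -> Rn R n) x y : isometry U V ->
  enorm (tsub (U x) (U y)) = enorm (tsub x y).
Proof. by move=> iU; rewrite !enormE !dotp_tsub_sqr !(iso_dotp _ _ iU). Qed.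

Lemma iso_tail n (U V : Rn R n -> Rn R n) : isometry U V ->
  isometry (fun v => thead v ::: U (behead_tuple v))
           (fun v => thead v ::: V (behead_tuple v)).
Proof.
move=> iU; split.
- apply: (@measure_preserving_tail _ _ (fun _ => U)); last by move=> _; exact: iso_mp iU.
  exact: (measurableT_comp (iso_mp iU).1 (@measurable_behead_tuple R n)).
- apply: (@measure_preserving_tail _ _ (fun _ => V)); last by move=> _; exact: iso_mpV iU.
  exact: (measurableT_comp (iso_mpV iU).1 (@measurable_behead_tuple R n)).
- by move=> v; rewrite behead_cons thead_cons (isoK iU) -tuple_split.
- by move=> v; rewrite behead_cons thead_cons (isoKV iU) -tuple_split.
- move=> x y; rewrite [in LHS](tuple_split y) [in RHS](tuple_split x).
  by rewrite !dotp_cons (iso_adj iU).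
Qed.

Lemma iso_flip n : isometry (fun v : Rn R n.+1 => (- thead v) ::: behead_tuple v)
                            (fun v => (- thead v) ::: behead_tuple v).
Proof.
have p : measure_preserving (mu n.+1) (fun v => (- thead v) ::: behead_tuple v).
  apply: (@measure_preserving_head _ _ (fun x _ => - x)).
    by apply: measurableT_comp => //; exact: measurable_thead.
  by move=> _; exact: measure_preserving_opp.
have K : cancel (fun v : Rn R n.+1 => (- thead v) ::: behead_tuple v)
    (fun v => (- thead v) ::: behead_tuple v).
  by move=> v; rewrite behead_cons thead_cons opprK -tuple_split.
split => // x y; rewrite [in LHS](tuple_split y) [in RHS](tuple_split x).
by rewrite !dotp_cons mulNr mulrN.
Qed.

(** The rotation of the plane of the first two coordinates with cosine [c] and
    sine [- s]. *)
Definition plane_rot n (c s : R) (v : Rn R n.+2) : Rn R n.+2 :=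
  let x := thead v in let y := thead (behead_tuple v) in
  (c * x + s * y) ::: ((- s * x + c * y) ::: behead_tuple (behead_tuple v)).

Lemma measure_preserving_shear1 n (k : R) : measure_preserving (mu n.+2)
  (fun v => (thead v + k * thead (behead_tuple v)) ::: behead_tuple v).
Proof.
apply: (@measure_preserving_head _ _ (fun x t => x + k * thead t)).
  apply: measurable_funD; first exact: measurable_thead.
  apply: measurable_funM => //.
  exact: (measurableT_comp (@measurable_thead R n) (@measurable_behead_tuple R n.+1)).
by move=> t; exact: measure_preserving_shift.
Qed.

Lemma measure_preserving_shear2 n (k : R) : measure_preserving (mu n.+2)
  (fun v => thead v :::
    ((thead (behead_tuple v) + k * thead v) ::: behead_tuple (behead_tuple v))).
Proof.
apply: (@measure_preserving_tail _ _
  (fun x t => (thead t + k * x) ::: behead_tuple t)).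
  apply: measurable_cons; last first.
    exact: (measurableT_comp (@measurable_behead_tuple R n) (@measurable_behead_tuple R n.+1)).
  apply: measurable_funD.
    exact: (measurableT_comp (@measurable_thead R n) (@measurable_behead_tuple R n.+1)).
  by apply: measurable_funM => //; exact: measurable_thead.
move=> x; apply: (@measure_preserving_head _ _ (fun y _ => y + k * x)).
  by apply: measurable_funD => //; exact: measurable_thead.
by move=> t; exact: measure_preserving_shift.
Qed.

(** A rotation is a product of three shears; the parameter of the outer ones is
    the tangent of the half angle. *)
Lemma plane_rot_mp n c s : c ^+ 2 + s ^+ 2 = 1 -> 0 <= c ->
  measure_preserving (mu n.+2) (plane_rot c s).
Proof.
move=> cs c0; have c1 : 1 + c != 0 by rewrite gt_eqF// ltr_pwDl.
pose k := s / (1 + c).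
rewrite (_ : plane_rot c s =
  (fun v => (thead v + k * thead (behead_tuple v)) ::: behead_tuple v) \o
  (fun v => thead v :::
    ((thead (behead_tuple v) + (- s) * thead v) ::: behead_tuple (behead_tuple v))) \o
  (fun v => (thead v + k * thead (behead_tuple v)) ::: behead_tuple v)).
  apply: measure_preserving_comp; last exact: measure_preserving_shear1.
  apply: measure_preserving_comp; first exact: measure_preserving_shear1.
  exact: measure_preserving_shear2.
apply/funext => v; rewrite /plane_rot /=.
rewrite !(thead_cons, behead_cons).
set x := thead v; set y := thead (behead_tuple v).
have e1 : - s * x + c * y = y + - s * (x + k * y).
  have -> : c = 1 - s * k.
    rewrite /k; apply: (mulIf c1); rewrite mulrBl mulrA divfK//.
    by have -> : s * s = 1 - c ^+ 2; [rewrite -cs; ring|ring].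
  by ring.
have e2 : c * x + s * y = x + k * y + k * (y + - s * (x + k * y)).
  rewrite -e1 /k; apply: (mulIf c1).
  have -> : (x + s / (1 + c) * y + s / (1 + c) * (- s * x + c * y)) * (1 + c) =
     x * (1 + c) + s * y - s * s * x + s * c * y by field.
  have -> : s * s = 1 - c ^+ 2 by rewrite -cs; ring.
  by ring.
by rewrite e1 {1}e2.
Qed.

Lemma iso_plane_rot n c s : c ^+ 2 + s ^+ 2 = 1 -> 0 <= c ->
  isometry (@plane_rot n c s) (plane_rot c (- s)).
Proof.
move=> cs c0.
have K (r : R) : c ^+ 2 + r ^+ 2 = 1 -> cancel (@plane_rot n c r) (plane_rot c (- r)).
  move=> cr v; rewrite /plane_rot !(thead_cons, behead_cons).
  set x := thead v; set y := thead (behead_tuple v).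
  have -> : c * (c * x + r * y) + - r * (- r * x + c * y) = x.
    by rewrite -[RHS]mul1r -cr; ring.
  have -> : - - r * (c * x + r * y) + c * (- r * x + c * y) = y.
    by rewrite -[RHS]mul1r -cr; ring.
  by rewrite -!tuple_split.
have cs' : c ^+ 2 + (- s) ^+ 2 = 1 by rewrite sqrrN.
split; [exact: plane_rot_mp|exact: plane_rot_mp|exact: K| |].
  by have := K _ cs'; rewrite opprK.
move=> x y; rewrite [in LHS](tuple_split y) [in LHS](tuple_split (behead_tuple y)).
rewrite [in RHS](tuple_split x) [in RHS](tuple_split (behead_tuple x)).
rewrite /plane_rot !dotp_cons; ring.
Qed.

Definition on_axis n (r : R) : Rn R n.+1 := r ::: [tuple of nseq n 0].

(** By induction the last coordinates are moved to a half-axis; a rotation of the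
    plane of the first two coordinates finishes the proof. The flips make these two
    coordinates nonnegative, so that only rotations by acute angles occur. *)
Lemma iso_transitive n (x : Rn R n.+1) :
  exists UV, isometry UV.1 UV.2 /\ UV.1 x = on_axis n (enorm x).
Proof.
have flip m (a : mR) (t : Rn R m) : exists UV, isometry UV.1 UV.2 /\
    UV.1 (a ::: t) = (`|a| : mR) ::: t.
  have [a0|a0] := leP 0 a.
    by exists (id, id); split; [exact: iso_id|rewrite /= ger0_norm].
  exists (fun v => (- thead v) ::: behead_tuple v, fun v => (- thead v) ::: behead_tuple v).
  split; first exact: iso_flip.
  rewrite ltr0_norm//; change ((- thead (a ::: t)) ::: behead_tuple (a ::: t) = (- a) ::: t).
  by rewrite thead_cons behead_cons.
elim: n x => [x|n IH x].
  rewrite (tuple_split x); set a := thead x.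
  have [[U V] /= [iU Ux]] := flip _ a (behead_tuple x).
  exists (U, V); split => //=; rewrite Ux /on_axis.
  apply: eq_tcons; last by rewrite [LHS]tuple0 [RHS]tuple0.
  have d0 (t : Rn R 0) : dotp t t = 0 by exact: big_ord0.
  rewrite enormE (dotp_cons a a) d0.
  by rewrite addr0 -expr2 sqrtr_sqr.
have [[U1 V1] /= [iU1 U1x]] := IH (behead_tuple x).
have [[U2 V2] /= [iU2 U2x]] := flip _ (thead x) (on_axis n (enorm (behead_tuple x))).
set a := `|thead x| in U2x; set b := enorm (behead_tuple x) in U1x U2x.
have r2 : enorm x ^+ 2 = a ^+ 2 + b ^+ 2.
  rewrite sqr_enorm [in LHS](tuple_split x) dotp_cons /a /b sqr_enorm.
  by rewrite real_normK ?num_real// expr2.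
set r := enorm x in r2 *.
have [r0|r0] := eqVneq r 0.
  exists (U2 \o (fun v => thead v ::: U1 (behead_tuple v)),
     (fun v => thead v ::: V1 (behead_tuple v)) \o V2).
  split; first by apply: iso_comp => //; exact: iso_tail.
  rewrite /= U1x U2x r0.
  have [-> ->] : a = 0 /\ b = 0.
    move: r2; rewrite r0 expr0n/= => /esym/eqP.
    by rewrite paddr_eq0 ?sqr_ge0// !sqrf_eq0 => /andP[/eqP -> /eqP ->].
  rewrite /on_axis; apply: eq_tcons => //; exact: val_inj.
have csr : (a / r) ^+ 2 + (b / r) ^+ 2 = 1.
  by rewrite !expr_div_n -mulrDl -r2 divff// expf_neq0.
have c0 : 0 <= a / r by apply: divr_ge0; [exact: normr_ge0|exact: enorm_ge0].
exists (plane_rot (a / r) (b / r) \o (U2 \o (fun v => thead v ::: U1 (behead_tuple v))),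
  ((fun v => thead v ::: V1 (behead_tuple v)) \o V2) \o plane_rot (a / r) (- (b / r))).
split.
  apply: iso_comp; first exact: iso_plane_rot.
  by apply: iso_comp => //; exact: iso_tail.
rewrite /= U1x U2x /plane_rot /on_axis !(thead_cons, behead_cons).
have -> : a / r * a + b / r * b = r.
  by rewrite mulrAC (mulrAC b) -mulrDl -!expr2 -r2 expr2 mulfK.
have -> : - (b / r) * a + a / r * b = 0 by ring.
apply: eq_tcons => //; exact: val_inj.
Qed.

End euclidean_theory.

(** * The inverse Fourier transform *)

Section sequentially_continuous.
Context {R : realType} (n : nat) (X : normedModType R[i]).
Local Notation E := (Rn R n).

(** R^n is only considered as a measurable space of tuples, hence this
    coordinatewise form of continuity. *)
Definition seq_cont (f : E -> X) := forall (u : nat -> E) (x : E),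
  (forall i, tnth (u k) i @[k --> \oo] --> tnth x i) ->
  f (u k) @[k --> \oo] --> f x.

(** The approximations are obtained by rounding the coordinates of the argument
    to finitely many values. *)
Lemma sm_seq_cont (f : E -> X) : seq_cont f -> strongly_measurable f.
Proof.
move=> fc.
have [s [ss sx]] := sm_realC (@measurable_id _ (measurableTypeR R) setT).
pose r k x := complex.Re (s k x).
have rx (x : measurableTypeR R) : r k x @[k --> \oo] --> (x : R) := rcvg_Re (sx x).
pose q k (v : E) : E := [tuple r k (tnth v i) | i < n].
exists (fun k => f \o q k); split => [k|x]; last first.
  apply: fc => i; apply: cvg_trans (rx (tnth x i)); apply: near_eq_cvg.
  by apply: nearW => k; rewrite tnth_mktuple.
have [V _ VE] := finite_range_seq (ss k).
pose V' := map (@complex.Re R) V.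
have VE' x : r k x \in V' by exact: map_f.
have fq : finite_set (range (q k)).
  pose g (t : n.-tuple (seq_sub V')) : E := [tuple ssval (tnth t i) | i < n].
  apply: (@sub_finite_set _ _ (range g)); last exact/finite_image/finite_finset.
  move=> _ [v _ <-]; exists [tuple SeqSub (VE' (tnth v i)) | i < n] => //.
  by apply: eq_from_tnth => i; rewrite !tnth_mktuple.
have mq z : measurable (q k @^-1` [set z]).
  rewrite (_ : _ @^-1` _ =
      \bigcap_(i in [set: 'I_n]) [set v | r k (tnth v i) = tnth z i]).
    apply: fin_bigcap_measurable => // i _.
    have mB := simple_fun_preimage (ss k) [set w | complex.Re w = tnth z i].
    have := measurable_tnth i measurableT mB; rewrite setTI; exact.
  apply/seteqP; split => [v /= <- i _ /=|v /= h].
    by rewrite tnth_mktuple.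
  by apply: eq_from_tnth => i; rewrite tnth_mktuple; exact: h.
split.
  apply: (@sub_finite_set _ _ (f @` range (q k))); last exact: finite_image.
  by move=> _ [v _ <-]; exists (q k v) => //; exists v.
move=> y.
rewrite (_ : _ @^-1` _ = \bigcup_(z in range (q k) `&` f @^-1` [set y]) q k @^-1` [set z]).
  by apply: fin_bigcup_measurable => //; exact: finite_setIl.
apply/seteqP; split => [v /= fy|v [z [_ /= fz] /= vz]]; last by rewrite vz.
by exists (q k v) => //; split => //; exists v.
Qed.

End sequentially_continuous.

Lemma cvg_rsum {R : realType} (I : Type) (r : seq I) (f : nat -> I -> R) (a : I -> R) :
  (forall i, f k i @[k --> \oo] --> a i) ->
  \sum_(i <- r) f k i @[k --> \oo] --> \sum_(i <- r) a i.
Proof.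
move=> fa; elim: r => [|i r IH].
  rewrite big_nil (_ : (fun k => _) = fun=> 0); first exact: cvg_cst.
  by apply/funext => k; rewrite big_nil.
rewrite big_cons (_ : (fun k => _) = fun k => f k i + \sum_(i <- r) f k i).
  exact: cvgD.
by apply/funext => k; rewrite big_cons.
Qed.

Section expi.
Context {R : realType}.
Definition expi (t : R) : R[i] := cos t +i* sin t.

Lemma rnorm_expi t : rnorm (expi t) = 1.
Proof.
apply/eqP; rewrite -(@eqrXn2 _ 2) ?rnorm_ge0// rnorm_sqr /= expr1n.
by rewrite cos2Dsin2.
Qed.

Lemma expiD s t : expi (s + t) = expi s * expi t.
Proof.
rewrite /expi cosD sinD; apply/eqP; rewrite eq_complex /=.
by rewrite eqxx/= addrC.
Qed.

Lemma cvg_expi (u : nat -> R) t : u k @[k --> \oo] --> t ->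
  expi (u k) @[k --> \oo] --> expi t.
Proof.
move=> ut; apply: rcvg_complex => /=; apply: continuous_cvg => //.
- exact: continuous_cos.
- exact: continuous_sin.
Qed.

Lemma sm_expi d (T : measurableType d) (u : T -> R) : measurable_fun setT u ->
  strongly_measurable (fun x => expi (u x)).
Proof.
move=> mu; apply/sm_complexP; split => /=.
  by apply: measurableT_comp => //; apply: continuous_measurable_fun; exact: continuous_cos.
by apply: measurableT_comp => //; apply: continuous_measurable_fun; exact: continuous_sin.
Qed.
End expi.

Section fourier.
Context {R : realType} (n : nat).
Local Notation E := (Rn R n).
Local Notation mu := (@lebesgue_Rn R n).
Implicit Types (X : completeNormedModType R[i]).

Definition kernel (x xi : E) : R[i] := expi (2 * pi * dotp x xi).

Lemma inverse_fourierE X (g : E -> X) x :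
  inverse_fourier g x = bochner_integral mu (fun xi => kernel x xi *: g xi).
Proof. by []. Qed.

Lemma sm_kernel x : strongly_measurable (kernel x).
Proof.
by apply: sm_expi; apply: measurable_funM => //; exact: measurable_dotpr.
Qed.

Lemma Lp1_kernel X (g : E -> X) x : Lp mu 1 g ->
  Lp mu 1 (fun xi => kernel x xi *: g xi).
Proof.
move=> Lg; apply: (Lp_le _ _ Lg) => //; first by apply: smZ Lg.1; exact: sm_kernel.
by apply: aeW => xi; rewrite rnormZ rnorm_expi mul1r.
Qed.

Lemma inverse_fourierD X (f g : E -> X) x : Lp mu 1 f -> Lp mu 1 g ->
  inverse_fourier (f \+ g) x = inverse_fourier f x + inverse_fourier g x.
Proof.
move=> Lf Lg; rewrite !inverse_fourierE -bochner_integralD; [|exact: Lp1_kernel..].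
by congr (bochner_integral mu); apply/funext => xi /=; rewrite scalerDr.
Qed.

Lemma inverse_fourierZ X a (f : E -> X) x : Lp mu 1 f ->
  inverse_fourier (a \*: f) x = a *: inverse_fourier f x.
Proof.
move=> Lf; rewrite !inverse_fourierE -bochner_integralZ; last exact: Lp1_kernel.
by congr (bochner_integral mu); apply/funext => xi /=; rewrite !scalerA mulrC.
Qed.

Lemma inverse_fourierB X (f g : E -> X) x : Lp mu 1 f -> Lp mu 1 g ->
  inverse_fourier (f \- g) x = inverse_fourier f x - inverse_fourier g x.
Proof.
move=> Lf Lg; rewrite !inverse_fourierE -bochner_integralB; [|exact: Lp1_kernel..].
by congr (bochner_integral mu); apply/funext => xi /=; rewrite scalerBr.
Qed.

(** The kernel depends on scalar products only, and isometries preserve the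
    measure. *)
Lemma inverse_fourier_iso X (g : E -> X) (U V : E -> E) x : isometry U V ->
  Lp mu 1 g -> inverse_fourier (g \o U) x = inverse_fourier g (U x).
Proof.
move=> iU Lg; rewrite !inverse_fourierE -[RHS](bochner_integral_mp (iso_mp iU)); last exact: Lp1_kernel.
congr (bochner_integral mu); apply/funext => xi /=.
by rewrite /kernel (iso_dotp _ _ iU).
Qed.

Lemma inverse_fourier_translate X (g : E -> X) (b x : E) : Lp mu 1 g ->
  inverse_fourier (g \o (fun xi => tsub xi b)) x =
  kernel x b *: inverse_fourier g x.
Proof.
move=> Lg; rewrite -inverse_fourierZ// !inverse_fourierE.
have Lb : Lp mu 1 (kernel x b \*: g) by exact: LpZ.
rewrite -[RHS](bochner_integral_mp (measure_preserving_tsub b)); last exact: Lp1_kernel.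
congr (bochner_integral mu); apply/funext => xi /=.
rewrite scalerA /kernel -expiD; congr (expi _ *: _).
by rewrite dotpC -mulrDr [dotp x (tsub _ _)]dotpC dotp_tsub [dotp b x]dotpC subrK.
Qed.

Lemma seq_cont_inverse_fourier X (g : E -> X) : Lp mu 1 g ->
  seq_cont (@inverse_fourier R n X g).
Proof.
move=> Lg u x ux; rewrite inverse_fourierE.
rewrite (_ : (fun k => _) = (fun k => bochner_integral mu
  (fun xi => kernel (u k) xi *: g xi)))//.
apply: (bochner_integral_dominated (h := g)) => //.
- by move=> k; exact: (Lp1_kernel _ Lg).1.
- exact: (Lp1_kernel _ Lg).1.
- apply: aeW => xi; apply: cvgZ; last exact: cvg_cst.
  apply: cvg_expi; apply: cvgM; first exact: cvg_cst.
  apply: cvg_rsum => i; apply: cvgM; [exact: ux|exact: cvg_cst].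
- by move=> k; apply: aeW => xi; rewrite rnormZ rnorm_expi mul1r.
Qed.

Lemma sm_inverse_fourier X (g : E -> X) : Lp mu 1 g ->
  strongly_measurable (@inverse_fourier R n X g).
Proof. by move=> Lg; apply: sm_seq_cont; exact: seq_cont_inverse_fourier. Qed.

Lemma Lp1_fmul X (phi : E -> R[i]) (g : E -> X) : Linfty mu phi -> Lp mu 1 g ->
  Lp mu 1 (fmul phi g).
Proof.
move=> [mphi [M phiM]] Lg.
apply: (@Lp_le _ _ _ _ _ _ _ _ ((`|M|)%:C \*: g)) => //; first exact: smZ mphi Lg.1.
  exact: LpZ.
apply: filterS phiM => xi h /=; rewrite !rnormZ rnormC normr_id.
by rewrite ler_wpM2r ?rnorm_ge0// (le_trans h)// ler_norm.
Qed.

(** The transforms are integrals of integrable functions, so that dominated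
    convergence gives a limit at every point. *)
Lemma inverse_fourier_multiplier_cvg X (phi : nat -> E -> R[i]) (m : E -> R[i])
    (M : R) (g : E -> X) x :
  (forall k, strongly_measurable (phi k)) -> strongly_measurable m ->
  (forall k, \forall xi \ae mu, rnorm (phi k xi) <= M) ->
  (\forall xi \ae mu, phi k xi @[k --> \oo] --> m xi) -> Lp mu 1 g ->
  inverse_fourier (fmul (phi k) g) x @[k --> \oo] --> inverse_fourier (fmul m g) x.
Proof.
move=> mphi mm phiM phim Lg; rewrite inverse_fourierE.
rewrite (_ : (fun k => _) = (fun k => bochner_integral mu
  (fun xi => kernel x xi *: fmul (phi k) g xi)))//.
apply: (bochner_integral_dominated (h := (`|M|)%:C \*: g)).
- by move=> k; apply: smZ; [exact: sm_kernel|exact: smZ (mphi k) Lg.1].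
- by apply: smZ; [exact: sm_kernel|exact: smZ mm Lg.1].
- exact: LpZ.
- apply: filterS phim => xi h; apply: cvgZ; first exact: cvg_cst.
  by apply: cvgZ => //; exact: cvg_cst.
move=> k; apply: filterS (phiM k) => xi h.
rewrite rnormZ rnorm_expi mul1r /= !rnormZ rnormC normr_id.
by rewrite ler_wpM2r ?rnorm_ge0// (le_trans h)// ler_norm.
Qed.

End fourier.

(** * An explicit Fourier pair *)

Section poisson_line.
Context {R : realType}.
Local Notation leb := (@lebesgue_measure R).

(** The constant 1 keeps the integrand nonnegative, so that neither this
    integral nor its n-dimensional version requires integrability. *)
Lemma integral0y_expR_cos (a c : R) : `|c| <= 1 ->
  (\int[leb]_(x in `[0%R, +oo[) ((1 + c * cos (a * x)) * expR (- x))%:E =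
   (1 + c / (1 + a ^+ 2))%:E)%E.
Proof.
move=> c1; set b := c / (1 + a ^+ 2).
have a1 : 1 + a ^+ 2 != 0 by rewrite gt_eqF// ltr_pwDl// sqr_ge0.
pose f x := (1 + c * cos (a * x)) * expR (- x).
pose F x := expR (- x) * (-1 + b * (a * sin (a * x) - cos (a * x))).
have dF (x : R) : is_derive x (1 : R) F (f x).
  have d0 : is_derive x (1 : R) (fun y : R => a * y) a.
    by apply: is_derive_eq; rewrite ?mulr0 ?scaler0 ?addr0 ?add0r /GRing.scale/= ?mulr1 ?mulr0 ?addr0 ?add0r.
  have d1 : is_derive x (1 : R) (fun y : R => expR (- y)) (- expR (- x)).
    by rewrite -mulrN1; apply: (@is_derive1_comp _ expR -%R).
  have d2 : is_derive x (1 : R) (fun y : R => sin (a * y)) (cos (a * x) * a).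
    by apply: (@is_derive1_comp _ sin (fun y => a * y)).
  have d3 : is_derive x (1 : R) (fun y : R => cos (a * y)) (- sin (a * x) * a).
    by apply: (@is_derive1_comp _ cos (fun y => a * y)).
  apply: is_derive_eq.
  rewrite /GRing.scale/= /f.
  have -> : c = b * (1 + a ^+ 2) by rewrite /b divfK.
  by ring.
have cf : continuous f.
  move=> x; apply: cvgM.
    apply: cvgD; first exact: cvg_cst.
    apply: cvgM; first exact: cvg_cst.
    apply: continuous_comp; last exact: continuous_cos.
    by apply: cvgM; [exact: cvg_cst|exact: cvg_id].
  apply: continuous_comp; last exact: continuous_expR.
  by apply: cvgN; exact: cvg_id.
have cF : continuous F.
  by move=> x; apply/differentiable_continuous/derivable1_diffP; have [] := dF x.
rewrite (@ge0_continuous_FTC2y _ f F 0 0).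
- rewrite /F oppr0 expR0 mulr0 sin0 cos0 mulr0 sub0r mul1r mulrN1.
  by rewrite -EFinB sub0r opprD !opprK.
- move=> x _; apply: mulr_ge0; last exact: expR_ge0.
  have : `|c * cos (a * x)| <= 1.
    by rewrite normrM mulr_ile1// ler_norml cos_geN1 cos_le1.
  by rewrite ler_norml => /andP[+ _]; rewrite -subr_ge0 opprK addrC.
- exact: continuous_subspaceT.
- pose M := 1 + `|b| * (`|a| + 1).
  apply/cvgr0Pnorm_lt => e e0.
  have M0 : 0 < M by rewrite ltr_pwDl// mulr_ge0// addr_ge0.
  have e'0 : 0 < e / M by rewrite divr_gt0.
  have /cvgr0Pnorm_lt/(_ _ e'0) := @cvgr_expR R.
  apply: filterS => x h; rewrite /F normrM.
  have : `|-1 + b * (a * sin (a * x) - cos (a * x))| <= M.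
    apply: le_trans (ler_normD _ _) _; rewrite normrN1 lerD2l normrM ler_wpM2l//.
    apply: le_trans (ler_normB _ _) _; apply: lerD; last by rewrite ler_norml cos_geN1 cos_le1.
    by rewrite normrM ler_piMr// ler_norml sin_geN1 sin_le1.
  move=> hM; apply: le_lt_trans (ler_wpM2l (normr_ge0 _) hM) _.
  by rewrite -ltr_pdivlMr.
- by move=> x _; have [] := dF x.
- by apply: cvg_at_right_filter; exact: cF.
- by move=> x _; rewrite derive1E; have [_ ->] := dF x.
Qed.

(** The contribution of the sine is odd and cancels. *)
Lemma integralT_expR_cos (a b : R) :
  (\int[leb]_x ((1 + cos (a * x + b)) * expR (- `|x|))%:E =
   (2 + cos b * (2 / (1 + a ^+ 2)))%:E)%E.
Proof.
pose f (x : R) := (1 + cos (a * x + b)) * expR (- `|x|).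
pose g (x : R) := (1 + cos b * cos (a * x)) * expR (- `|x|).
have cos1 y : 0 <= 1 + cos y by rewrite -lerBlDl sub0r cos_geN1.
have f0 x : 0 <= f x by rewrite mulr_ge0// expR_ge0.
have ca : continuous (fun x : R => a * x).
  by move=> y; apply: cvgM; [exact: cvg_cst|exact: cvg_id].
have ce : continuous (fun x : R => expR (- `|x|)).
  move=> x; apply: (@continuous_comp _ _ _ (fun x : R => - `|x|) expR); last exact: continuous_expR.
  by apply: cvgN; exact: norm_continuous.
have cf : continuous f.
  move=> x; apply: cvgM; last exact: ce.
  apply: cvgD; first exact: cvg_cst.
  apply: (@continuous_comp _ _ _ (fun x => a * x + b) cos); last exact: continuous_cos.
  by apply: cvgD; [exact: ca|exact: cvg_cst].
have cg : continuous g.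
  move=> x; apply: cvgM; last exact: ce.
  apply: cvgD; first exact: cvg_cst.
  apply: cvgM; first exact: cvg_cst.
  by apply: (@continuous_comp _ _ _ (fun x => a * x) cos); [exact: ca|exact: continuous_cos].
have cb1 : `|cos b| <= 1 by rewrite ler_norml cos_geN1 cos_le1.
have g0 x : 0 <= g x.
  apply: mulr_ge0; last exact: expR_ge0.
  have : `|cos b * cos (a * x)| <= 1.
    by rewrite normrM mulr_ile1// ler_norml cos_geN1 cos_le1.
  by rewrite ler_norml => /andP[+ _]; rewrite -subr_ge0 opprK addrC.
have mf : measurable_fun setT (EFin \o f).
  by apply/measurable_EFinP; exact: continuous_measurable_fun.
have mg : measurable_fun setT (EFin \o g).
  by apply/measurable_EFinP; exact: continuous_measurable_fun.
have Ig : (\int[leb]_x (g x)%:E = (2 + cos b * (2 / (1 + a ^+ 2)))%:E)%E.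
  rewrite ge0_symfun_integralT//; last first.
    by move=> x; rewrite /g /= mulrN cosN normrN.
  rewrite -set_itvcy.
  transitivity (2%:E * (1 + cos b / (1 + a ^+ 2))%:E)%E.
    rewrite -integral0y_expR_cos//; congr (_ * _)%E.
    apply: eq_integral => x; rewrite inE/= in_itv/= andbT => x0.
    by rewrite /g ger0_norm.
  by rewrite -EFinM; congr EFin; ring.
have fg x : f x + f (- x) = 2 * g x.
  rewrite /f /g normrN mulrN -mulrDl; set y := a * x.
  by rewrite cosD [cos (- y + b)]cosD cosN sinN; ring.
have fN : (\int[leb]_x (f (- x))%:E = \int[leb]_x (f x)%:E)%E.
  by apply: (@ge0_integral_mp _ _ _ leb _ _ (@measure_preserving_opp R) mf) => x; rewrite lee_fin.
have mfN : measurable_fun setT (EFin \o (f \o -%R)).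
  by apply/measurable_EFinP; apply: measurableT_comp => //; exact: continuous_measurable_fun.
have : (\int[leb]_x (f x)%:E + \int[leb]_x (f x)%:E =
    2%:E * \int[leb]_x (g x)%:E)%E.
  rewrite -{2}fN -ge0_integralD//; last 2 first.
  - by move=> x _; rewrite lee_fin.
  - by move=> x _; rewrite lee_fin.
  rewrite -ge0_integralZl_EFin//; last by move=> x _; rewrite lee_fin.
  by apply: eq_integral => x _; rewrite -EFinD fg EFinM.
rewrite Ig => h.
have I0 : (0 <= \int[leb]_x (f x)%:E)%E by apply: integral_ge0 => x _; rewrite lee_fin.
move: h I0; change (\int[leb]_x ((1 + cos (a * x + b)) * expR (- `|x|))%:E)%E with (\int[leb]_x (f x)%:E)%E.
case: (\int[leb]_x (f x)%:E)%E => [r| |]//=.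
rewrite -EFinD -EFinM => -[h] _; congr EFin.
by move: h; set X := cos b * _ => h; lra.
Qed.

End poisson_line.

Section product_integrals.
Context {R : realType}.
Local Notation leb := (@lebesgue_measure R).
Local Notation mu n := (@lebesgue_Rn R n).

Definition tprod n (h : R -> R) (x : Rn R n) : R := \prod_(i < n) h (tnth x i).

Lemma tprod_cons n (h : R -> R) (x : measurableTypeR R) (t : Rn R n) :
  tprod h [the n.+1.-tuple (measurableTypeR R) of x :: t] = h x * tprod h t.
Proof.
rewrite /tprod big_ord_recl tnth0; congr (_ * _).
by apply: eq_bigr => i _; rewrite tnthS.
Qed.

Lemma tprod_ge0 n (h : R -> R) (x : Rn R n) : (forall y, 0 <= h y) -> 0 <= tprod h x.
Proof. by move=> h0; apply: prodr_ge0. Qed.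

Lemma measurable_tprod n (h : R -> R) : measurable_fun setT h ->
  measurable_fun setT (@tprod n h).
Proof.
move=> mh; apply: measurable_prod => i _.
by apply: measurableT_comp => //; exact: measurable_tnth.
Qed.

Lemma integral_tprod n (h : R -> R) (a : R) : measurable_fun setT h ->
  (forall y, 0 <= h y) -> (\int[leb]_x (h x)%:E = a%:E)%E ->
  (\int[mu n]_x (tprod h x)%:E = (a ^+ n)%:E)%E.
Proof.
move=> mh h0 Ih.
have a0 : 0 <= a.
  by rewrite -lee_fin -Ih; apply: integral_ge0 => x _; rewrite lee_fin.
have mt m : measurable_fun setT (fun x => (@tprod m h x)%:E).
  by apply/measurable_EFinP; exact: measurable_tprod.
elim: n => [|n IH].
  transitivity (\int[mu 0]_x (1%:E))%E.
    by apply: eq_integral => x _; rewrite /tprod big_ord0.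
  by rewrite integral_cst//= diracT mul1e.
rewrite tonelli1//; last by move=> x; rewrite lee_fin tprod_ge0.
transitivity (\int[leb]_x ((a ^+ n)%:E * (h x)%:E))%E.
  apply: eq_integral => x _; rewrite -IH muleC -ge0_integralZl_EFin//.
  - by apply: eq_integral => t _; rewrite tprod_cons EFinM.
  - by move=> ? _; rewrite lee_fin tprod_ge0.
  - exact: mt.
rewrite ge0_integralZl_EFin ?exprn_ge0//; last 2 first.
- by move=> x _; rewrite lee_fin.
- exact/measurable_EFinP.
by rewrite Ih -EFinM exprS mulrC.
Qed.

Lemma integral_tprod_lty n (h : R -> R) : measurable_fun setT h ->
  (forall y, 0 <= h y) -> (\int[leb]_x (h x)%:E < +oo)%E ->
  (\int[mu n]_x (tprod h x)%:E < +oo)%E.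
Proof.
move=> mh h0 Ih; rewrite (@integral_tprod _ h (fine (\int[leb]_x (h x)%:E)))//.
  by rewrite ltry.
by rewrite fineK// ge0_fin_numE// integral_ge0// => x _; rewrite lee_fin.
Qed.

End product_integrals.

Section poisson.
Context {R : realType}.
Local Notation leb := (@lebesgue_measure R).
Local Notation mu n := (@lebesgue_Rn R n).
Local Notation mR := (measurableTypeR R).

(** An integrable function whose inverse transform [poisson] is explicit,
    integrable, bounded and positive everywhere. *)
Definition laplace n (xi : Rn R n) : R := tprod (fun t => expR (- `|t|)) xi.
Definition poisson n (x : Rn R n) : R := tprod (fun t => 2 / (1 + (2 * pi * t) ^+ 2)) x.

Let den_gt0 (t : R) : 0 < 1 + t ^+ 2.
Proof. by rewrite ltr_pwDl// sqr_ge0. Qed.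

Lemma laplace_ge0 n (xi : Rn R n) : 0 <= laplace xi.
Proof. by apply: tprod_ge0 => y; exact: expR_ge0. Qed.

Lemma poisson_gt0 n (x : Rn R n) : 0 < poisson x.
Proof. by apply: prodr_gt0 => i _; rewrite divr_gt0. Qed.

Lemma measurable_laplace n : measurable_fun setT (@laplace n).
Proof.
apply: measurable_tprod; apply: measurableT_comp => //.
by apply: measurableT_comp => //; exact: measurableT_comp.
Qed.

Lemma measurable_poisson n : measurable_fun setT (@poisson n).
Proof.
apply: measurable_tprod; apply: continuous_measurable_fun => x.
apply: cvgM; first exact: cvg_cst.
apply: cvgV; first by rewrite gt_eqF.
apply: cvgD; first exact: cvg_cst.
by apply: cvgM; apply: cvgM; [exact: cvg_cst|exact: cvg_id|exact: cvg_cst|exact: cvg_id].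
Qed.

Lemma cos_add1_ge0 (t : R) : 0 <= 1 + cos t.
Proof. by rewrite -lerBlDl sub0r cos_geN1. Qed.

Lemma integral_laplace n : (\int[mu n]_xi (laplace xi)%:E = (2 ^+ n)%:E)%E.
Proof.
have me : measurable_fun setT (fun x : R => expR (- `|x|)).
  by apply: measurableT_comp => //; apply: measurableT_comp => //; exact: measurableT_comp.
have e0 (x : R) : 0 <= expR (- `|x|) by exact: expR_ge0.
apply: integral_tprod => //.
have E2 : (2%:E * \int[leb]_x (expR (- `|x|))%:E = 4%:E)%E.
  rewrite -ge0_integralZl_EFin//; last exact/measurable_EFinP.
  transitivity (\int[leb]_x ((1 + cos (0 * x + 0)) * expR (- `|x|))%:E)%E.
    by apply: eq_integral => x _; rewrite -EFinM mul0r addr0 cos0.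
  by rewrite integralT_expR_cos cos0 expr0n/= addr0 divr1 mul1r -natrD.
have : (0 <= \int[leb]_x (expR (- `|x|))%:E)%E.
  by apply: integral_ge0 => x _; rewrite lee_fin.
move: E2; case: (\int[leb]_x (expR (- `|x|))%:E)%E => [r| |]//=; last first.
  by rewrite gt0_muley// lte_fin.
by rewrite -!EFinM => -[h] _; congr EFin; lra.
Qed.

(** The phase [b] makes the induction on the dimension possible; it also yields
    the sine transform. *)
Lemma integral_cos_laplace n (x : Rn R n) (b : R) :
  (\int[mu n]_xi ((1 + cos (2 * pi * dotp x xi + b)) * laplace xi)%:E =
   (2 ^+ n + cos b * poisson x)%:E)%E.
Proof.
have mf m (y : Rn R m) c : measurable_fun setT
    (fun xi => ((1 + cos (2 * pi * dotp y xi + c)) * laplace xi)%:E).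
  apply/measurable_EFinP; apply: measurable_funM; last exact: measurable_laplace.
  apply: measurable_funD => //.
  have md : measurable_fun setT (fun xi => 2 * pi * dotp y xi + c).
    apply: measurable_funD => //; apply: measurable_funM => //.
    exact: measurable_dotpr.
  by apply: measurableT_comp => //; apply: continuous_measurable_fun; exact: continuous_cos.
have f0 m (y xi : Rn R m) c : (0 <= ((1 + cos (2 * pi * dotp y xi + c)) * laplace xi)%:E)%E.
  by rewrite lee_fin mulr_ge0 ?cos_add1_ge0// laplace_ge0.
have ml m : measurable_fun setT (fun xi => (@laplace m xi)%:E).
  by apply/measurable_EFinP; exact: measurable_laplace.
have l0 m (xi : Rn R m) : (0 <= (laplace xi)%:E)%E by rewrite lee_fin laplace_ge0.
elim: n x b => [|n IH] x b.
  transitivity (\int[mu 0]_x ((1 + cos b)%:E))%E.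
    apply: eq_integral => xi _; rewrite /laplace /tprod big_ord0 /dotp big_ord0.
    by rewrite mulr0 add0r mulr1.
  by rewrite integral_cst//= diracT mule1 /poisson /tprod big_ord0 mulr1.
rewrite tonelli2//.
rewrite (tuple_split x); set x0 := thead x; set y := behead_tuple x.
set c := 2 / (1 + (2 * pi * x0) ^+ 2).
have c0 : 0 <= c by rewrite divr_ge0// ltW.
have c2 : 0 <= 2 - c.
  by rewrite subr_ge0 /c ler_pdivrMr// ler_peMr// lerDl sqr_ge0.
transitivity (\int[mu n]_t (c%:E * ((1 + cos (2 * pi * dotp y t + b)) * laplace t)%:E
    + (2 - c)%:E * (laplace t)%:E))%E.
  apply: eq_integral => t _.
  transitivity (\int[leb]_u ((laplace t)%:E *
      ((1 + cos (2 * pi * x0 * u + (2 * pi * dotp y t + b))) * expR (- `|u|))%:E))%E.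
    apply: eq_integral => u _; rewrite -EFinM; congr EFin.
    rewrite dotp_cons [laplace _]tprod_cons -/(laplace t).
    rewrite (_ : 2 * pi * (x0 * u + dotp y t) + b =
      2 * pi * x0 * u + (2 * pi * dotp y t + b)); last by ring.
    by ring.
  rewrite ge0_integralZl_EFin ?laplace_ge0//; last first.
    apply/measurable_EFinP; apply: measurable_funM.
      apply: measurable_funD => //; apply: measurableT_comp.
        by apply: continuous_measurable_fun; exact: continuous_cos.
      by apply: measurable_funD => //; exact: measurable_funM.
    apply: measurableT_comp => //.
    by apply: measurableT_comp => //; exact: measurableT_comp.
  by rewrite integralT_expR_cos -/c -!EFinM -EFinD; congr EFin; ring.
rewrite ge0_integralD; [|by []|by move=> t _; rewrite mule_ge0|
  by apply: measurable_funeM; exact: mf|by move=> t _; rewrite mule_ge0|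
  by apply: measurable_funeM; exact: ml].
rewrite ge0_integralZl_EFin; [|by []|by move=> t _; exact: f0|exact: mf|by []].
rewrite ge0_integralZl_EFin; [|by []|by move=> t _; exact: l0|exact: ml|by []].
rewrite IH integral_laplace -!EFinM -EFinD; congr EFin.
rewrite (_ : poisson [the n.+1.-tuple mR of x0 :: y] = c * poisson y).
  by rewrite exprS; ring.
exact: tprod_cons.
Qed.

Lemma poisson_le n (x : Rn R n) : poisson x <= 2 ^+ n.
Proof.
apply: le_trans (_ : _ <= \prod_(i < n) 2) _; last by rewrite prodr_const card_ord.
apply: ler_prod => i _; rewrite divr_ge0 ?(ltW (den_gt0 _))//=.
by rewrite ler_pdivrMr// ler_peMr// lerDl sqr_ge0.
Qed.

Lemma integral_poisson_lty n : (\int[mu n]_x (poisson x)%:E < +oo)%E.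
Proof.
apply: integral_tprod_lty.
- apply: continuous_measurable_fun => x.
  apply: cvgM; first exact: cvg_cst.
  apply: cvgV; first by rewrite gt_eqF.
  apply: cvgD; first exact: cvg_cst.
  by apply: cvgM; apply: cvgM; [exact: cvg_cst|exact: cvg_id|exact: cvg_cst|exact: cvg_id].
- by move=> y; rewrite divr_ge0// ltW.
have oneD0 (t : R) : 0 <= (oneDsqr t)^-1 by rewrite invr_ge0 ltW.
have moneD : measurable_fun setT (fun t : R => (oneDsqr t)^-1).
  by apply: continuous_measurable_fun; exact: continuous_oneDsqrV.
apply: (@le_lt_trans _ _ (\int[leb]_x (2%:E * ((oneDsqr x)^-1)%:E))%E).
  apply: ge0_le_integral => //.
  - by move=> x _; rewrite lee_fin divr_ge0// ltW.
  - apply/measurable_EFinP; apply: continuous_measurable_fun => x.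
    apply: cvgM; first exact: cvg_cst.
    apply: cvgV; first by rewrite gt_eqF.
    apply: cvgD; first exact: cvg_cst.
    by apply: cvgM; apply: cvgM; [exact: cvg_cst|exact: cvg_id|exact: cvg_cst|exact: cvg_id].
  - by apply: measurable_funeM; exact/measurable_EFinP.
  move=> x _; rewrite -EFinM lee_fin ler_wpM2l// lef_pV2 ?posrE//.
  rewrite /oneDsqr lerD2l exprMn ler_peMl ?sqr_ge0//.
  have : 1 <= 2 * pi :> R by have := @pi_ge2 R; lra.
  by move=> h; rewrite exprn_ege1.
rewrite ge0_integralZl_EFin//; last exact/measurable_EFinP.
rewrite ge0_symfun_integralT//; last 2 first.
- exact: continuous_oneDsqrV.
- by move=> x; rewrite /= /oneDsqr sqrrN.
rewrite -set_itvcy; have := @integral0y_oneDsqr R => ->.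
by rewrite -!EFinM ltry.
Qed.

End poisson.

Section poisson_transform.
Context {R : realType} (n : nat).
Local Notation E := (Rn R n).
Local Notation mu := (@lebesgue_Rn R n).
Implicit Types X : completeNormedModType R[i].

Lemma integrable_laplace : mu.-integrable setT (EFin \o (@laplace R n)).
Proof.
apply/integrableP; split; first by apply/measurable_EFinP; exact: measurable_laplace.
under eq_integral do rewrite gee0_abs ?lee_fin ?laplace_ge0//.
by rewrite integral_laplace ltry.
Qed.

Lemma Rintegral_cos_laplace (x : E) (b : R) :
  (\int[mu]_xi (cos (2 * pi * dotp x xi + b) * laplace xi))%R = cos b * poisson x.
Proof.
pose f xi := (1 + cos (2 * pi * dotp x xi + b)) * laplace xi.
have mf : measurable_fun setT f.
  apply: measurable_funM; last exact: measurable_laplace.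
  apply: measurable_funD => //; apply: measurableT_comp.
    by apply: continuous_measurable_fun; exact: continuous_cos.
  by apply: measurable_funD => //; apply: measurable_funM => //; exact: measurable_dotpr.
have If : mu.-integrable setT (EFin \o f).
  apply/integrableP; split; first exact/measurable_EFinP.
  apply: (@le_lt_trans _ _ (\int[mu]_xi (f xi)%:E)%E); last first.
    by rewrite integral_cos_laplace ltry.
  rewrite le_eqVlt; apply/orP; left; apply/eqP; apply: eq_integral => xi _.
  by rewrite gee0_abs// lee_fin mulr_ge0 ?cos_add1_ge0 ?laplace_ge0.
transitivity (\int[mu]_xi (f xi - laplace xi))%R.
  by apply: eq_Rintegral => xi _; rewrite /f; ring.
rewrite RintegralB//; last exact: integrable_laplace.
rewrite /Rintegral integral_laplace integral_cos_laplace /=.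
by ring.
Qed.

Lemma Lp1_laplace X (v : X) : Lp mu 1 (fun xi => (laplace xi)%:C *: v).
Proof.
have L1 : Lp mu 1 (fun xi => (@laplace R n xi)%:C) by apply/Lp1_real; exact: integrable_laplace.
apply: (bochner_integral_linear (L := fun z : R[i] => z *: v) (M := rnorm v) _ _ _ L1).1.
- by move=> x y; rewrite scalerDl.
- by move=> r x; rewrite scalerA.
- by move=> x; rewrite rnormZ mulrC.
Qed.

Lemma inverse_fourier_laplace X (v : X) (x : E) :
  inverse_fourier (fun xi => (laplace xi)%:C *: v) x = (poisson x)%:C *: v.
Proof.
have L1 : Lp mu 1 (fun xi => (@laplace R n xi)%:C) by apply/Lp1_real; exact: integrable_laplace.
pose f xi := kernel x xi * (laplace xi)%:C.
have Lf : Lp mu 1 f by exact: (Lp1_kernel x L1).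
have [_ h] := @bochner_integral_linear _ _ _ mu R[i] X (fun z => z *: v) (rnorm v) f
  (fun x y => scalerDl v x y) (fun r x => esym (scalerA _ _ v))
  (fun x => eq_ind_r (fun t => t <= rnorm v * rnorm x) (eq_ind_r (fun t => rnorm x * rnorm v <= t) (lexx _) (mulrC (rnorm v) (rnorm x))) (rnormZ x v)) Lf.
rewrite inverse_fourierE.
transitivity (bochner_integral mu ((fun z => z *: v) \o f)).
  by congr (bochner_integral mu); apply/funext => xi; rewrite /= scalerA.
rewrite h bochner_integral_complex//; congr (_ *: _).
apply/eqP; rewrite eq_complex/=; apply/andP; split; apply/eqP.
  transitivity (cos 0 * poisson x); last by rewrite cos0 mul1r.
  rewrite -(Rintegral_cos_laplace x 0); apply: eq_Rintegral => xi _; rewrite addr0 /f /kernel /expi.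
  by rewrite /=; ring.
transitivity (cos (- (pi / 2)) * poisson x); last by rewrite cosN cos_pihalf mul0r.
rewrite -(Rintegral_cos_laplace x); apply: eq_Rintegral => xi _; rewrite /f /kernel /expi.
by rewrite cosB cos_pihalf sin_pihalf /=; ring.
Qed.

(** A bounded integrable function belongs to every L^p. *)
Lemma Lp_poisson X (v : X) p : 1 <= p -> Lp mu p (fun x => (poisson x)%:C *: v).
Proof.
move=> p1; have p0 : 0 < p by exact: lt_le_trans p1.
have mP : strongly_measurable (fun x => (@poisson R n x)%:C *: v).
  by apply: smZ; [apply: sm_realC; exact: measurable_poisson|exact: sm_cst].
split => //; rewrite Lpnorm_lty ?gt_eqF//.
pose M := 2 ^+ n * (rnorm v + 1); pose c := M `^ p * (rnorm v / M).
have v1 : 0 < rnorm v + 1 by rewrite ltr_wpDl// rnorm_ge0.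
have M0 : 0 < M by rewrite mulr_gt0// exprn_gt0.
have c0 : 0 <= c by rewrite mulr_ge0 ?powR_ge0// divr_ge0 ?rnorm_ge0// ltW.
apply: (@le_lt_trans _ _ (\int[mu]_x (c%:E * (poisson x)%:E))%E); last first.
  rewrite ge0_integralZl_EFin; [|by []|by move=> x _; rewrite lee_fin ltW// poisson_gt0|
    by apply/measurable_EFinP; exact: measurable_poisson|by []].
  by rewrite lte_mul_pinfty ?lee_fin//; exact: integral_poisson_lty.
apply: ge0_le_integral => //.
- by move=> x _; rewrite lee_fin powR_ge0.
- exact: measurable_powint.
- by apply: measurable_funeM; apply/measurable_EFinP; exact: measurable_poisson.
move=> x _; rewrite -EFinM lee_fin rnormZ rnormC gtr0_norm ?poisson_gt0//.
have t0 : 0 <= poisson x * rnorm v by rewrite mulr_ge0 ?rnorm_ge0// ltW// poisson_gt0.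
have tM : poisson x * rnorm v <= M.
  by apply: ler_pM; rewrite ?rnorm_ge0 ?poisson_le ?lerDl// ltW// poisson_gt0.
pose s := poisson x * rnorm v / M.
have s0 : 0 <= s by rewrite divr_ge0// ltW.
have -> : poisson x * rnorm v = M * s by rewrite /s mulrCA divff ?mulr1// gt_eqF.
have -> : c * poisson x = M `^ p * s by rewrite /c /s; ring.
rewrite powRM ?(ltW M0)// ler_wpM2l ?powR_ge0//.
have [->|sn0] := eqVneq s 0; first by rewrite powR0// gt_eqF.
apply: ge1r_powR => //.
by rewrite lt_def sn0 s0/= ler_pdivrMr// mul1r.
Qed.

Lemma fourier_domain_laplace X (v : X) p : 1 <= p ->
  fourier_domain p (fun xi : E => (laplace xi)%:C *: v).
Proof.
move=> p1; split; first exact: Lp1_laplace.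
rewrite (_ : inverse_fourier _ = (fun x : E => (poisson x)%:C *: v)).
  exact: Lp_poisson.
by apply/funext => x; exact: inverse_fourier_laplace.
Qed.

End poisson_transform.

(** * Density of the initial domain of multipliers *)

Section density.
Context {R : realType} (n : nat) (X : completeNormedModType R[i]) (p : R).
Hypothesis p1 : 1 <= p.
Local Notation E := (Rn R n).
Local Notation mu := (@lebesgue_Rn R n).

Let p0 : 0 < p. Proof. exact: lt_le_trans p1. Qed.

Definition approximable (f : E -> X) := Lp mu p f /\
  forall e, 0 < e -> exists2 g : E -> X, fourier_domain p g &
    (Lpnorm mu p (inverse_fourier g \- f)%R < e%:E)%E.

Lemma approximable_domain (g : E -> X) : fourier_domain p g ->
  approximable (inverse_fourier g).
Proof.
move=> dg; split; first exact: dg.2.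
move=> e e0; exists g => //.
rewrite (_ : _ \- _ = cst 0); first by rewrite Lpnorm0 ?gt_eqF.
by apply/funext => x /=; rewrite subrr.
Qed.

Lemma approximable_lim (f : nat -> E -> X) (g : E -> X) :
  (forall k, approximable (f k)) -> Lp mu p g -> Lcvg mu p f g -> approximable g.
Proof.
move=> af Lg fg; split => // e e0.
have e2 : 0 < e / 2 by rewrite divr_gt0.
have [N _ /(_ N (leqnn N)) fN] := fg _ e2.
have [Lf /(_ _ e2)[h dh hf]] := af N; exists h => //.
apply: le_lt_trans (LpnormB_ge (g := f N) _ _ _ _ _) _ => //.
- exact: dh.2.1.
- exact: Lf.1.
- exact: Lg.1.
by rewrite [e]splitr EFinD lteD.
Qed.

Lemma fourier_domainD (g h : E -> X) : fourier_domain p g -> fourier_domain p h ->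
  fourier_domain p (g \+ h).
Proof.
move=> [Lg Fg] [Lh Fh]; split; first exact: LpD.
rewrite (_ : inverse_fourier _ = inverse_fourier g \+ inverse_fourier h).
  exact: LpD.
by apply/funext => x; exact: inverse_fourierD.
Qed.

Lemma fourier_domainZ a (g : E -> X) : fourier_domain p g ->
  fourier_domain p (a \*: g).
Proof.
move=> [Lg Fg]; split; first exact: LpZ.
rewrite (_ : inverse_fourier _ = a \*: inverse_fourier g).
  exact: LpZ.
by apply/funext => x; exact: inverse_fourierZ.
Qed.

Lemma fourier_domainB (g h : E -> X) : fourier_domain p g -> fourier_domain p h ->
  fourier_domain p (g \- h).
Proof.
move=> dg dh; rewrite (_ : g \- h = g \+ ((-1 : R[i]) \*: h)).
  by apply: fourier_domainD => //; exact: fourier_domainZ.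
by apply/funext => x /=; rewrite scaleN1r.
Qed.

Lemma approximableD (f g : E -> X) : approximable f -> approximable g ->
  approximable (f \+ g).
Proof.
move=> [Lf af] [Lg ag]; split; first exact: LpD.
move=> e e0; have e2 : 0 < e / 2 by rewrite divr_gt0.
have [u du uf] := af _ e2; have [v dv vg] := ag _ e2.
exists (u \+ v); first exact: fourier_domainD.
rewrite (_ : _ \- _ = (inverse_fourier u \- f) \+ (inverse_fourier v \- g)).
  apply: le_lt_trans (LpnormD _ _ _ _) _ => //.
  - exact: smB du.2.1 Lf.1.
  - exact: smB dv.2.1 Lg.1.
  by rewrite [e]splitr EFinD lteD.
apply/funext => x /=; rewrite inverse_fourierD; [|exact: du.1|exact: dv.1].
by rewrite opprD addrACA.
Qed.

Lemma approximableZ a (f : E -> X) : approximable f -> approximable (a \*: f).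
Proof.
move=> [Lf af]; split; first exact: LpZ.
move=> e e0.
have a0 : 0 < rnorm a + 1 by rewrite ltr_wpDl ?rnorm_ge0.
have [u du uf] := af _ (divr_gt0 e0 a0).
exists (a \*: u); first exact: fourier_domainZ.
rewrite (_ : _ \- _ = a \*: (inverse_fourier u \- f)).
  rewrite LpnormZ//; last exact: smB du.2.1 Lf.1.
  apply: (@le_lt_trans _ _ ((rnorm a + 1)%:E * Lpnorm mu p (inverse_fourier u \- f)%R)%E).
    by rewrite lee_wpmul2r ?Lpnorm_ge0// lee_fin lerDl.
  by rewrite -lte_pdivlMl// -EFinM mulrC.
by apply/funext => x /=; rewrite inverse_fourierZ ?scalerBr//; exact: du.1.
Qed.

Lemma approximable0 : approximable (cst 0).
Proof.
have := approximableZ 0 (approximable_domain (@fourier_domain_laplace R n X 0 p p1)).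
by congr approximable; apply/funext => x /=; rewrite scale0r.
Qed.

Lemma approximable_sum (I : Type) (r : seq I) (F : I -> E -> X) :
  (forall i, approximable (F i)) -> approximable (fun x => \sum_(i <- r) F i x).
Proof.
move=> aF; elim: r => [|i r IH].
  rewrite (_ : (fun x => _) = cst 0); first exact: approximable0.
  by apply/funext => x; rewrite big_nil.
rewrite (_ : (fun x => _) = F i \+ (fun x => \sum_(i <- r) F i x)).
  exact: approximableD.
by apply/funext => x; rewrite big_cons.
Qed.

(** The closure of the transforms is stable under multiplication by characters,
    since these correspond to translations on the Fourier side. *)
Lemma approximable_kernel (b : E) (f : E -> X) : approximable f ->
  approximable (fun x => kernel x b *: f x).
Proof.
move=> [Lf af].
have mk : strongly_measurable (fun x : E => kernel x b).
  by apply: sm_expi; apply: measurable_funM => //; exact: measurable_dotp.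
have Lk (h : E -> X) : Lp mu p h -> Lp mu p (fun x => kernel x b *: h x).
  move=> Lh; apply: (Lp_le _ _ Lh); [exact: ltW|exact: smZ mk Lh.1|].
  by apply: aeW => x; rewrite rnormZ rnorm_expi mul1r.
split; first exact: Lk.
move=> e e0; have [g [Lg Fg] gf] := af _ e0.
have E1 : inverse_fourier (g \o (fun xi => tsub xi b)) =
    (fun x => kernel x b *: inverse_fourier g x).
  by apply/funext => x; exact: inverse_fourier_translate.
exists (g \o (fun xi => tsub xi b)).
  split; first by apply: Lp_mp => //; exact: measure_preserving_tsub.
  by rewrite E1; exact: Lk.
rewrite E1; apply: le_lt_trans gf; apply: le_Lpnorm; first exact: ltW.
- by apply: smB; [exact: (Lk _ Fg).1|exact: (Lk _ Lf).1].
- exact: smB Fg.1 Lf.1.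
by apply: aeW => x /=; rewrite -scalerBr rnormZ rnorm_expi mul1r.
Qed.

(** The bounded functions that multiply the closure of the initial domain into
    itself. *)
Definition admissible (m : E -> R[i]) :=
  [/\ strongly_measurable m, exists M, forall x, rnorm (m x) <= M &
    forall f, approximable f -> approximable (fun x => m x *: f x)].

Lemma admissible_cst a : admissible (cst a).
Proof.
split; first exact: sm_cst.
- by exists (rnorm a).
- by move=> f; exact: approximableZ.
Qed.

Lemma admissibleM m m' : admissible m -> admissible m' ->
  admissible (fun x => m x * m' x).
Proof.
move=> [mm [M mM] am] [mm' [M' mM'] am']; split; first exact: smM.
  exists (M * M') => x; rewrite rnormM.
  by apply: ler_pM => //; exact: rnorm_ge0.
move=> f af; have := am _ (am' _ af).
by congr approximable; apply/funext => x; rewrite scalerA.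
Qed.

Lemma admissibleD m m' : admissible m -> admissible m' ->
  admissible (fun x => m x + m' x).
Proof.
move=> [mm [M mM] am] [mm' [M' mM'] am']; split; first exact: smD.
  by exists (M + M') => x; apply: le_trans (rnormD _ _) _; exact: lerD.
move=> f af; have := approximableD (am _ af) (am' _ af).
by congr approximable; apply/funext => x; rewrite /= scalerDl.
Qed.

Lemma admissibleZ a m : admissible m -> admissible (fun x => a * m x).
Proof. exact: (admissibleM (admissible_cst a)). Qed.

Lemma admissibleX m k : admissible m -> admissible (fun x => m x ^+ k).
Proof.
move=> am; elim: k => [|k IH]; first exact: admissible_cst.
by under eq_fun do rewrite exprS; exact: admissibleM.
Qed.

Lemma admissible_lim (m : nat -> E -> R[i]) (l : E -> R[i]) (M : R) :
  (forall k, admissible (m k)) -> (forall k x, rnorm (m k x) <= M) ->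
  (forall x, m k x @[k --> \oo] --> l x) -> admissible l.
Proof.
move=> am mM ml.
have smm k : strongly_measurable (m k) by case: (am k).
have ml' : strongly_measurable l by exact: sm_lim ml.
have lM x : rnorm (l x) <= M.
  have c := rcvg_rnorm (ml x).
  rewrite -(cvg_lim _ c)//; apply: limr_le; first by apply/cvg_ex; exists (rnorm (l x)).
  exact: nearW.
split => //; first by exists M.
move=> f af.
have Lh : Lp mu p ((`|M|)%:C \*: f) by apply: LpZ => //; exact: af.1.
have bound (q : E -> R[i]) : (forall x, rnorm (q x) <= M) ->
    \forall x \ae mu, rnorm (q x *: f x) <= rnorm (((`|M|)%:C \*: f) x).
  move=> qM; apply: aeW => x; rewrite /= !rnormZ rnormC normr_id.
  by rewrite ler_wpM2r ?rnorm_ge0// (le_trans (qM x))// ler_norm.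
apply: (@approximable_lim (fun k x => m k x *: f x)).
- by move=> k; case: (am k) => _ _; exact.
- by apply: (Lp_le _ _ Lh) (bound _ lM); [exact: ltW|exact: smZ ml' af.1.1].
apply: (Lp_dominated p0 _ _ Lh).
- by move=> k; exact: smZ (smm k) af.1.1.
- exact: smZ ml' af.1.1.
- by apply: aeW => x; apply: cvgZ; [exact: ml|exact: cvg_cst].
- by move=> k; exact: bound (mM k).
Qed.

Lemma admissible_expi (i : 'I_n) (t : R) :
  admissible (fun x => expi (t * tnth x i)).
Proof.
pose b : E := [tuple if j == i then t / (2 * pi) else 0 | j < n].
have pi0 : 2 * pi != 0 :> R by rewrite mulf_neq0// gt_eqF// pi_gt0.
have kE (x : E) : kernel x b = expi (t * tnth x i).
  rewrite /kernel; congr expi; rewrite /dotp (bigD1 i)//= big1 ?addr0.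
    by rewrite tnth_mktuple eqxx mulrCA (mulrC (2 * pi)) divfK// mulrC.
  by move=> j ji; rewrite tnth_mktuple (negbTE ji) mulr0.
split.
- by apply: sm_expi; apply: measurable_funM => //; exact: measurable_tnth.
- by exists 1 => x; rewrite rnorm_expi.
move=> f af; have := approximable_kernel b af.
by congr approximable; apply/funext => x; rewrite kE.
Qed.

Lemma admissible_sin (i : 'I_n) (t b : R) :
  admissible (fun x => (sin (t * (tnth x i - b)))%:C).
Proof.
have h : admissible (fun x => (2 * 'i)^-1 * (expi (t * tnth x i) * expi (- (t * b)) +
    (-1) * (expi ((- t) * tnth x i) * expi (t * b)))).
  apply: admissibleZ; apply: admissibleD.
    by apply: admissibleM; [exact: admissible_expi|exact: admissible_cst].
  apply: admissibleZ.
  by apply: admissibleM; [exact: admissible_expi|exact: admissible_cst].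
suff <- : (fun x => (2 * 'i)^-1 * (expi (t * tnth x i) * expi (- (t * b)) +
    (-1) * (expi ((- t) * tnth x i) * expi (t * b)))) =
    (fun x : E => (sin (t * (tnth x i - b)))%:C :> R[i]) by [].
apply/funext => x; rewrite -!expiD.
set y := t * (tnth x i - b).
have -> : t * tnth x i + - (t * b) = y by rewrite /y; ring.
have -> : - t * tnth x i + t * b = - y by rewrite /y; ring.
have i0 : (2 * 'i : R[i]) != 0 by rewrite mulf_neq0// neq0Ci.
apply: (mulfI i0); rewrite mulrA divff// mul1r.
rewrite /expi cosN sinN; apply/eqP; rewrite eq_complex /=.
by apply/andP; split; apply/eqP; ring.
Qed.

End density.

Section step_limit.
Context {R : realType}.
Implicit Types (u r s y : R).

Lemma bernoulli_ge y K : 0 <= y <= 1 -> 1 - y *+ K <= (1 - y) ^+ K.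
Proof.
move=> /andP[y0 y1]; elim: K => [|K IH]; first by rewrite mulr0n subr0 expr0.
rewrite exprS; apply: le_trans (ler_wpM2l _ IH); last by rewrite subr_ge0.
rewrite mulrS mulrBr mulr1 mulrBl mul1r.
have : 0 <= y * (y *+ K) by rewrite mulr_ge0// mulrn_wge0.
by lra.
Qed.

Lemma cvg_natmul_expr r : 0 <= r < 1 -> N%:R * r ^+ N @[N --> \oo] --> (0 : R).
Proof.
move=> /andP[r0 r1]; pose s := Num.sqrt r.
have s0 : 0 <= s by exact: sqrtr_ge0.
have s2 : s ^+ 2 = r by exact: sqr_sqrtr.
have s1 : s < 1 by rewrite -(@ltr_pXn2r _ 2)// ?nnegrE// s2 expr1n.
have h N : N%:R * s ^+ N * (1 - s) <= 1 - s ^+ N.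
  elim: N => [|N IH]; first by rewrite !mul0r expr0 subrr.
  have := ler_wpM2l s0 IH.
  have q0 : 0 <= s ^+ N by exact: exprn_ge0.
  have q1 : s * s ^+ N <= 1 by rewrite -exprS exprn_ile1// ltW.
  rewrite exprS -natr1; move: q0 q1; set q := s ^+ N => q0 q1.
  have : s * q * (1 - s) <= 1 * (1 - s) by rewrite ler_wpM2r// subr_ge0 ltW.
  set a := N%:R; have -> : s * (a * q * (1 - s)) = a * (s * q) * (1 - s) by ring.
  have -> : (a + 1) * (s * q) * (1 - s) = a * (s * q) * (1 - s) + s * q * (1 - s) by ring.
  by lra.
have s1' : 0 < 1 - s by rewrite subr_gt0.
apply: (@squeeze_cvgr _ _ _ _ (fun=> 0) (fun N => (1 - s)^-1 * s ^+ N)).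
- apply: nearW => N; rewrite mulr_ge0 ?exprn_ge0//=.
  rewrite -s2 -exprM mulnC exprM expr2 mulrA ler_wpM2r ?exprn_ge0//.
  rewrite -[(1 - s)^-1]mul1r ler_pdivlMr// (le_trans (h N))// gerBl exprn_ge0//.
- exact: cvg_cst.
- rewrite -[X in _ --> X](mulr0 (1 - s)^-1); apply: cvgM; first exact: cvg_cst.
  by apply: cvg_expr; rewrite ger0_norm.
Qed.

(** The factor N in the exponent makes the limit vanish also at u = 1/2. *)
Lemma cvg_step u : 0 <= u <= 1 ->
  (1 - u ^+ N) ^+ (N * 2 ^ N)%N @[N --> \oo] --> ((u < 2^-1)%R%:R : R).
Proof.
move=> /andP[u0 u1].
have uN N : 0 <= u ^+ N <= 1 by rewrite exprn_ge0// exprn_ile1.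
have w01 N : 0 <= (1 - u ^+ N) ^+ (N * 2 ^ N)%N <= 1.
  have /andP[a b] := uN N.
  by rewrite exprn_ge0 ?subr_ge0// exprn_ile1 ?subr_ge0// gerBl.
have yK N : u ^+ N *+ (N * 2 ^ N)%N = N%:R * (2 * u) ^+ N.
  by rewrite -mulr_natr natrM natrX exprMn; ring.
case: ltP => hu /=.
  apply: (@squeeze_cvgr _ _ _ _ (fun N => 1 - N%:R * (2 * u) ^+ N) (fun=> 1)).
  - apply: nearW => N; have /andP[_ ->] := w01 N; rewrite andbT -yK.
    exact: bernoulli_ge.
  - rewrite -[X in _ --> X]subr0; apply: cvgB; first exact: cvg_cst.
    by apply: cvg_natmul_expr; rewrite mulr_ge0//=; lra.
  - exact: cvg_cst.
apply: (@squeeze_cvgr _ _ _ _ (fun=> 0) (fun N => expR (-1) ^+ N)).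
- apply: nearW => N; have /andP[-> _] := w01 N; rewrite /=.
  apply: (@le_trans _ _ (expR (- u ^+ N) ^+ (N * 2 ^ N)%N)).
    by apply: lerXn2r; rewrite ?nnegrE ?expR_ge0 ?subr_ge0//; [have /andP[] := uN N|exact: expR_ge1Dx].
  rewrite -!expRM_natr ler_expR !mulNr mul1r lerN2 mulr_natr yK.
  by rewrite ler_peMr// exprn_ege1//; lra.
- exact: cvg_cst.
- by apply: cvg_expr; rewrite ger0_norm ?expR_ge0// expR_lt1; lra.
Qed.

Lemma sin_scaled_sign (d : R) :
  \forall j \near \oo, (0 < sin (j.+1%:R^-1 * d)) = (0 < d).
Proof.
have : j.+1%:R^-1 * d @[j --> \oo] --> (0 : R).
  rewrite -[X in _ --> X](mul0r d); apply: cvgM; last exact: cvg_cst.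
  exact: cvg_harmonic.
move=> /cvgrPdist_lt/(_ pi (pi_gt0 R)); apply: filterS => j.
rewrite sub0r normrN ltr_norml => /andP[h1 h2].
have j0 : 0 < j.+1%:R^-1 :> R by rewrite invr_gt0.
have [d0|d0|d0] := ltgtP d 0.
- have : sin (j.+1%:R^-1 * d) < 0.
    rewrite -[_ * d]opprK sinN oppr_lt0 sin_gt0_pi//.
    by rewrite oppr_gt0 nmulr_llt0// j0 ltrNl.
  by move=> /lt_gtF.
- by rewrite sin_gt0_pi// mulr_gt0.
- by rewrite d0 mulr0 sin0 ltxx.
Qed.

End step_limit.

Section density_theorem.
Context {R : realType} (n : nat) (X : completeNormedModType R[i]) (p : R).
Hypothesis p1 : 1 <= p.
Local Notation E := (Rn R n).
Local Notation mu := (@lebesgue_Rn R n).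
Local Notation adm := (@admissible R n X p).

Let p0 : 0 < p. Proof. exact: lt_le_trans p1. Qed.

(** For large j the sign of sin ((x_i - b) / (j + 1)) is that of x_i - b, and [cvg_step]
    recovers the indicator of this sign as a bounded limit of polynomials. *)
Lemma admissible_indic_half (i : 'I_n) (b : R) :
  adm (fun x => (((b < tnth x i)%R%:R : R))%:C).
Proof.
pose u j (x : E) : R := 2^-1 * (1 - sin (j.+1%:R^-1 * (tnth x i - b))).
have u01 j x : 0 <= u j x <= 1.
  have := sin_geN1 (j.+1%:R^-1 * (tnth x i - b)).
  have := sin_le1 (j.+1%:R^-1 * (tnth x i - b)).
  by rewrite /u; lra.
have au j : adm (fun x => (u j x)%:C).
  have := admissibleZ p1 (2^-1) (admissibleD p1 (admissible_cst n X p1 1)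
    (admissibleZ p1 (-1) (admissible_sin X p1 i (j.+1%:R^-1) b))).
  congr admissible; apply/funext => x; rewrite /u.
  by apply/eqP; rewrite eq_complex /=; apply/andP; split; apply/eqP; field.
have aw j : adm (fun x => (((u j x < 2^-1)%R%:R : R))%:C).
  apply: (@admissible_lim _ _ _ _ p1
    (fun N x => (((1 - u j x ^+ N) ^+ (N * 2 ^ N)%N : R))%:C) _ 1).
  - move=> N.
    have := admissibleX p1 (N * 2 ^ N)%N (admissibleD p1 (admissible_cst n X p1 1)
      (admissibleZ p1 (-1) (admissibleX p1 N (au j)))).
    congr admissible; apply/funext => x.
    by rewrite !(rmorphXn, rmorphB, rmorph1)/= mulN1r.
  - move=> N x; have /andP[a c] := u01 j x.
    have uN : 0 <= u j x ^+ N <= 1 by rewrite exprn_ge0// exprn_ile1.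
    have /andP[uN0 uN1] := uN.
    rewrite rnormC ger0_norm; last by rewrite exprn_ge0// subr_ge0.
    by rewrite exprn_ile1 ?subr_ge0// gerBl.
  - by move=> x; apply: rcvg_realC; exact: cvg_step.
apply: (admissible_lim p1 aw (M := 1)).
- by move=> j x; rewrite rnormC; case: (_ < _) => /=; rewrite ?normr1 ?normr0.
move=> x; apply: rcvg_realC.
have := sin_scaled_sign (tnth x i - b); rewrite subr_gt0 => h.
apply: cvg_near_cst; apply: filterS h => j <-; congr (_%:R).
by congr nat_of_bool; rewrite /u; apply/idP/idP; lra.
Qed.

Let adm_set (A : set E) := adm (fun x => (\1_A x : R)%:C).

Let adm_setC A : adm_set A -> adm_set (~` A).
Proof.
move=> aA.
have := admissibleD p1 (admissible_cst n X p1 1) (admissibleZ p1 (-1) aA).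
congr admissible; apply/funext => x; rewrite !indicE in_setC.
case: (x \in A); rewrite /=; apply/eqP; rewrite eq_complex/=;
  by apply/andP; split; apply/eqP; ring.
Qed.

Let adm_setI A B : adm_set A -> adm_set B -> adm_set (A `&` B).
Proof.
move=> aA aB; have := admissibleM aA aB.
congr admissible; apply/funext => x; rewrite indicI /= rmorphM//.
Qed.

Let adm_set0 : adm_set set0.
Proof.
have := admissible_cst n X p1 0; congr admissible.
by apply/funext => x; rewrite indic0.
Qed.

Let adm_bigcup (F : nat -> set E) : (forall k, adm_set (F k)) ->
  adm_set (\bigcup_k F k).
Proof.
move=> aF.
have aU N : adm_set (\big[setU/set0]_(k < N) F k).
  elim: N => [|N IH]; first by rewrite big_ord0.
  rewrite big_ord_recr/= -[X in adm_set X]setCK setCU.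
  by apply: adm_setC; apply: adm_setI; exact: adm_setC.
apply: (admissible_lim p1 aU (M := 1)).
  by move=> N x; rewrite rnormC indicE; case: (_ \in _) => /=; rewrite ?normr1 ?normr0.
move=> x; apply: rcvg_realC; apply: cvg_near_cst.
have [[k _ Fk]|nF] := pselect ((\bigcup_k F k) x).
  exists k.+1 => // N /= kN; rewrite !indicE !mem_set//; first by exists k.
  by rewrite -bigcup_mkord; exists k.
apply: nearW => N; rewrite !indicE !memNset//.
by rewrite -bigcup_mkord => -[k _ Fk]; apply: nF; exists k.
Qed.

(** The sets with admissible indicators form a sigma-algebra that contains the
    half-spaces. *)
Lemma admissible_indic (A : set E) : measurable A -> adm_set A.
Proof.
have sa (T : Type) (f : E -> T) : sigma_algebra setT [set B | adm_set (f @^-1` B)].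
  split => /=.
  - by rewrite preimage_set0.
  - by move=> B aB; rewrite setTD preimage_setC; exact: adm_setC.
  - by move=> F aF; rewrite preimage_bigcup; exact: adm_bigcup.
have coord (i : 'I_n) (B : set (measurableTypeR R)) : measurable B ->
    adm_set ((fun x : E => tnth x i) @^-1` B).
  rewrite RGenOInfty.measurableE => mB.
  apply: (smallest_sub (sa _ (fun x : E => tnth x i)) _ mB) => _ [b ->] /=.
  have := admissible_indic_half i b.
  congr admissible; apply/funext => x; rewrite indicE; congr (_%:C); congr (_%:R).
  congr nat_of_bool; apply/idP/idP => h.
    by rewrite inE /= in_itv/= h.
  by move: h; rewrite inE/= in_itv/= andbT.
move=> mA.
apply: (smallest_sub (sa _ id) _ mA) => B; move: B.
elim/big_ind: _ => [//|S S' hS hS' B [/hS//|/hS'//]|i _ _ [D mD <-]].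
by rewrite /= setTI; exact: coord.
Qed.

Lemma admissible_simple (s : E -> R[i]) : simple_fun s -> adm s.
Proof.
move=> ss; have [V uV VE] := finite_range_seq ss.
suff : adm (fun x => \sum_(v <- V) v * ((\1_(s @^-1` [set v]) x : R)%:C)).
  congr admissible; apply/funext => x.
  rewrite (bigD1_seq (s x))//= indicE mem_set// mulr1 big1 ?addr0// => v vs.
  by rewrite indicE memNset ?mulr0//= => sv; move: vs; rewrite sv eqxx.
elim: V {uV VE} => [|v V IH].
  rewrite (_ : (fun x => _) = cst 0); first exact: admissible_cst.
  by apply/funext => x; rewrite big_nil.
rewrite (_ : (fun x => _) = (fun x => v * (\1_(s @^-1` [set v]) x : R)%:C +
    \sum_(v <- V) v * ((\1_(s @^-1` [set v]) x : R)%:C))).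
  apply: admissibleD => //; apply: admissibleZ => //.
  by apply: admissible_indic; exact: ss.2.
by apply/funext => x; rewrite big_cons.
Qed.

Lemma admissible_bounded (m : E -> R[i]) (M : R) : strongly_measurable m ->
  (forall x, rnorm (m x) <= M) -> adm m.
Proof.
move=> [s [ss sm]] mM.
pose A k := s k @^-1` [set z | rnorm z <= M + 1].
have mA k : measurable (A k) by exact: simple_fun_preimage.
pose t k x := (\1_(A k) x : R)%:C * s k x.
have M0 : 0 <= M by apply: le_trans (mM [tuple 0 | i < n]); exact: rnorm_ge0.
apply: (admissible_lim p1 (m := t) (M := M + 1)).
- by move=> k; apply: admissibleM; [exact: admissible_indic|exact: admissible_simple].
- move=> k x; rewrite /t indicE; case: (boolP (x \in A k)).
    by rewrite inE mul1r.
  by rewrite mul0r rnorm0 addr_ge0.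
move=> x; apply: cvg_trans (sm x); apply: near_eq_cvg.
have /cvgrPdist_lt/(_ _ ltr01) := rcvg_rnorm (sm x); apply: filterS => k h.
rewrite /t indicE mem_set ?mul1r// /A /=.
by have := mM x; move: h; rewrite ltr_norml => /andP[h _]; lra.
Qed.

(** The transform [poisson] vanishes nowhere, so that 1_A y is a limit of bounded
    multiples of [poisson *: y]. *)
Lemma approximable_indic (A : set E) (y : X) : measurable A -> (mu A < +oo)%E ->
  approximable p (fun x => (\1_A x : R)%:C *: y).
Proof.
move=> mA fA.
pose B k := [set x : E | k.+1%:R^-1 <= poisson x].
have mB k : measurable (B k).
  rewrite -[X in measurable X]setTI; apply: measurable_fun_ler => //.
  exact: measurable_poisson.
pose r k x : R := \1_(A `&` B k) x / poisson x.
have P0 (x : E) : 0 < poisson x by exact: poisson_gt0.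
have mr k : strongly_measurable (fun x => (r k x)%:C).
  apply: sm_realC; apply: measurable_funM.
    by apply: measurable_indic; exact: measurableI.
  rewrite (_ : (fun x => _) = tprod (fun t => (2 / (1 + (2 * pi * t) ^+ 2))^-1)).
    apply: measurable_tprod; apply: continuous_measurable_fun => x.
    have d0 : 0 < 1 + (2 * pi * x) ^+ 2 by rewrite ltr_pwDl// sqr_ge0.
    apply: cvgV; first by rewrite gt_eqF// divr_gt0.
    apply: cvgM; first exact: cvg_cst.
    apply: cvgV; first by rewrite gt_eqF.
    apply: cvgD; first exact: cvg_cst.
    by apply: cvgM; apply: cvgM; [exact: cvg_cst|exact: cvg_id|exact: cvg_cst|exact: cvg_id].
  by apply/funext => x; rewrite /poisson /tprod prodfV.
have rk k x : rnorm (r k x)%:C <= k.+1%:R.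
  rewrite rnormC ger0_norm; last by rewrite divr_ge0// ltW.
  rewrite /r indicE; case: (boolP (x \in _)); last by rewrite mul0r.
  rewrite inE => -[_ /= h]; rewrite mul1r -[leRHS]invrK.
  by rewrite lef_pV2 ?posrE ?invr_gt0.
have ak k : approximable p (fun x => (r k x)%:C *: ((poisson x)%:C *: y)).
  have [_ _] := admissible_bounded (mr k) (rk k); apply.
  have := approximable_domain p1 (@fourier_domain_laplace R n X y p p1).
  by congr approximable; apply/funext => x; exact: inverse_fourier_laplace.
have mL : strongly_measurable (fun x => (\1_A x : R)%:C *: y).
  by apply: smZ; [apply: sm_realC; exact: measurable_indic|exact: sm_cst].
have LA : Lp mu p (fun x => (\1_A x : R)%:C *: y).
  split => //; rewrite Lpnorm_lty ?gt_eqF//.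
  apply: (@le_lt_trans _ _ (\int[mu]_x ((rnorm y `^ p)%:E * (\1_A x)%:E))%E).
    apply: ge0_le_integral => //.
    - by move=> x _; rewrite lee_fin powR_ge0.
    - exact: measurable_powint.
    - by apply: measurable_funeM; apply/measurable_EFinP; exact: measurable_indic.
    move=> x _; rewrite -EFinM lee_fin indicE; case: (x \in A).
      by rewrite scale1r mulr1.
    by rewrite scale0r rnorm0 mulr0 powR0// gt_eqF.
  rewrite ge0_integralZl_EFin ?powR_ge0//; last first.
    by apply/measurable_EFinP; exact: measurable_indic.
  by rewrite integral_indic// setIT lte_mul_pinfty// lee_fin powR_ge0.
have rE k x : (r k x)%:C *: ((poisson x)%:C *: y) = (\1_(A `&` B k) x : R)%:C *: y.
  by rewrite scalerA -rmorphM /= /r divfK// gt_eqF.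
apply: (approximable_lim p1 ak LA).
apply: (Lp_dominated p0 _ _ LA) => //.
- by move=> k; case: (ak k) => -[].
- apply: aeW => x; apply: cvg_near_cst.
  have : k.+1%:R^-1 @[k --> \oo] --> (0 : R) by exact: cvg_harmonic.
  move=> /cvgrPdist_lt/(_ _ (P0 x)); apply: filterS => k.
  rewrite sub0r normrN ger0_norm// => /ltW h.
  rewrite rE; congr (_%:C *: _); rewrite !indicE; congr (_%:R).
  congr nat_of_bool; apply/idP/idP; rewrite !inE; last by split.
  by case.
move=> k; apply: aeW => x; rewrite rE !rnormZ ler_wpM2r ?rnorm_ge0// !rnormC.
rewrite !ger0_norm// !indicE ler_nat; case: (boolP (x \in A `&` B k)) => //.
by rewrite inE => -[Ax _]; rewrite mem_set.
Qed.

Theorem fourier_domain_dense (f : E -> X) : Lp mu p f -> approximable p f.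
Proof.
move=> Lf; have [s [si _ _ sf]] := simple_approx p0 Lf.
apply: (approximable_lim p1 _ Lf sf) => k.
have [V uV VE] := finite_range_seq (si k).1.
have : approximable p (fun x => \sum_(v <- V) (\1_(s k @^-1` [set v]) x : R)%:C *: v).
  apply: approximable_sum => // v.
  have [->|v0] := eqVneq v 0.
    rewrite (_ : (fun x => _) = cst 0); first exact: approximable0.
    by apply/funext => x; rewrite scaler0.
  by apply: approximable_indic; [exact: (si k).1.2|exact: (si k).2].
congr approximable; apply/funext => x.
rewrite (bigD1_seq (s k x))//= indicE mem_set// scale1r big1 ?addr0// => v vs.
by rewrite indicE memNset ?scale0r//= => sv; move: vs; rewrite sv eqxx.
Qed.

End density_theorem.

(** * The operator associated to a multiplier *)

Section bounded_operators.
Context {d} {T : measurableType d} {R : realType} (mu : {measure set T -> \bar R}).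
Variables (X : completeNormedModType R[i]) (p : R).
Hypothesis p1 : 1 <= p.

Let p0 : 0 < p. Proof. exact: lt_le_trans p1. Qed.

Lemma eqae_Lpnorm (f g : T -> X) : strongly_measurable f -> strongly_measurable g ->
  f = g %[ae mu] -> Lpnorm mu p f = Lpnorm mu p g.
Proof.
move=> mf mg fg; apply: eq_Lpnorm => //; first exact: ltW.
by apply: filterS fg => x /(_ Logic.I) ->.
Qed.

Lemma bounded_operatorB (U : (T -> X) -> T -> X) (f g : T -> X) :
  bounded_operator mu p U -> Lp mu p f -> Lp mu p g ->
  U f \- U g = U (f \- g) %[ae mu].
Proof.
move=> [UL _ Ulin _] Lf Lg.
have := Ulin 1 _ _ (LpB p1 Lf Lg) Lg.
rewrite (_ : 1 \*: (f \- g) \+ g = f); last first.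
  by apply/funext => x /=; rewrite scale1r subrK.
by apply: filterS => x h /h /= ->; rewrite scale1r addrK.
Qed.

Lemma bounded_operatorZ (U : (T -> X) -> T -> X) a (f : T -> X) :
  bounded_operator mu p U -> Lp mu p f -> U (a \*: f) = a \*: U f %[ae mu].
Proof.
move=> bU Lf; have [UL _ Ulin _] := bU.
have h1 := Ulin a _ _ Lf Lf.
have h2 := bounded_operatorB bU (LpD p1 (LpZ a p0 Lf) Lf) Lf.
rewrite (_ : (a \*: f \+ f) \- f = a \*: f) in h2; last first.
  by apply/funext => x /=; rewrite addrK.
by apply: filterS2 h1 h2 => x h1 h2 _; rewrite -h2//= h1//= addrK.
Qed.

Lemma le_operator_norm (U : (T -> X) -> T -> X) :
  bounded_operator mu p U -> exists K : R, [/\ 0 <= K,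
    (K%:E <= operator_norm mu p U)%E &
    forall f, Lp mu p f -> (Lpnorm mu p (U f) <= K%:E * Lpnorm mu p f)%E].
Proof.
move=> bU; have [UL Uae Ulin [C UC]] := bU.
have ub : (operator_norm mu p U <= `|C|%:E)%E.
  apply: ge_ereal_sup => _ [f [Lf f1] <-]; apply: le_trans (UC _ Lf) _.
  apply: (@le_trans _ _ (`|C|%:E * Lpnorm mu p f)%E).
    by apply: lee_wpmul2r; [exact: Lpnorm_ge0|rewrite lee_fin ler_norm].
  by rewrite -[leRHS]mule1; apply: lee_wpmul2l => //; rewrite lee_fin.
have L0 : Lp mu p (cst 0 : T -> X) by apply: Lp0; rewrite gt_eqF.
have lb : (0 <= operator_norm mu p U)%E.
  apply: le_trans (Lpnorm_ge0 mu p (U (cst 0))) _; apply: ereal_sup_ubound.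
  by exists (cst 0) => //; split => //; rewrite Lpnorm0 ?gt_eqF.
have fin : operator_norm mu p U \is a fin_num.
  by rewrite ge0_fin_numE// (le_lt_trans ub)// ltry.
exists (fine (operator_norm mu p U)); rewrite fineK//; split => //.
  exact: fine_ge0.
move=> f Lf; have [mf If] := Lf.
have Nf : Lpnorm mu p f \is a fin_num by rewrite ge0_fin_numE ?Lpnorm_ge0.
have [f0|f0] := eqVneq (Lpnorm mu p f) 0%E.
  by rewrite f0 mule0; apply: le_trans (UC _ Lf) _; rewrite f0 mule0.
set N := fine (Lpnorm mu p f).
have NE : Lpnorm mu p f = N%:E by rewrite /N fineK.
have N0 : 0 < N by rewrite fine_gt0// lt0e f0 Lpnorm_ge0 If.
pose g := (N^-1)%:C \*: f.
have Lg : Lp mu p g by exact: LpZ.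
have N1 : rnorm (N^-1)%:C = N^-1 by rewrite rnormC ger0_norm// invr_ge0 ltW.
have g1 : Lpnorm mu p g = 1%:E.
  by rewrite LpnormZ// N1 NE -EFinM mulVf// gt_eqF.
have : (Lpnorm mu p (U g) <= operator_norm mu p U)%E.
  by apply: ereal_sup_ubound; exists g => //; split => //; rewrite g1.
rewrite (eqae_Lpnorm _ _ (bounded_operatorZ (N^-1)%:C bU Lf)); last 2 first.
- exact: (UL _ Lg).1.
- exact: smZl (UL _ Lf).1.
rewrite LpnormZ//; last exact: (UL _ Lf).1.
by rewrite N1 lee_pdivrMl// NE muleC.
Qed.

Lemma operator_norm_le (U : (T -> X) -> T -> X) (K : R) : 0 <= K ->
  (forall f, Lp mu p f -> (Lpnorm mu p (U f) <= K%:E * Lpnorm mu p f)%E) ->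
  (operator_norm mu p U <= K%:E)%E.
Proof.
move=> K0 UK; apply: ge_ereal_sup => _ [f [Lf f1] <-].
apply: le_trans (UK _ Lf) _; rewrite -[leRHS]mule1.
by apply: lee_wpmul2l => //; rewrite lee_fin.
Qed.

End bounded_operators.

Section extension.
Context {R : realType} (n : nat) (X : completeNormedModType R[i]) (p : R).
Hypothesis p1 : 1 <= p.
Local Notation E := (Rn R n).
Local Notation mu := (@lebesgue_Rn R n).
Variable phi : E -> R[i].
Hypothesis Lphi : Linfty mu phi.
Hypothesis phiL : forall g : E -> X, fourier_domain p g ->
  Lp mu p (inverse_fourier (fmul phi g)).
Variable C : R.
Hypothesis C0 : 0 <= C.
Hypothesis phiC : forall g : E -> X, fourier_domain p g ->
  (Lpnorm mu p (inverse_fourier (fmul phi g)) <=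
    C%:E * Lpnorm mu p (inverse_fourier g))%E.

Let p0 : 0 < p. Proof. exact: lt_le_trans p1. Qed.

(** The graph of the extension, for which linearity and boundedness can be
    proved before any choice of values. *)
Definition extension_value (f h : E -> X) := Lp mu p h /\
  exists g : nat -> E -> X, [/\ forall j, fourier_domain p (g j),
    Lcvg mu p (fun j => inverse_fourier (g j)) f &
    Lcvg mu p (fun j => inverse_fourier (fmul phi (g j))) h].

Lemma inverse_fourier_fmulB (g h : E -> X) : fourier_domain p g -> fourier_domain p h ->
  inverse_fourier (fmul phi g) \- inverse_fourier (fmul phi h) =
  inverse_fourier (fmul phi (g \- h)).
Proof.
move=> dg dh; apply/funext => x /=; rewrite -inverse_fourierB; last 2 first.
- exact: Lp1_fmul Lphi dg.1.
- exact: Lp1_fmul Lphi dh.1.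
by congr inverse_fourier; apply/funext => y; rewrite /fmul /= scalerBr.
Qed.

Lemma inverse_fourier_subE (g h : E -> X) : fourier_domain p g -> fourier_domain p h ->
  inverse_fourier (g \- h) = inverse_fourier g \- inverse_fourier h.
Proof.
by move=> dg dh; apply/funext => x; apply: inverse_fourierB; [exact: dg.1|exact: dh.1].
Qed.

Lemma fmul_contract (g h f : E -> X) : fourier_domain p g -> fourier_domain p h ->
  Lp mu p f ->
  (Lpnorm mu p (inverse_fourier (fmul phi g) \- inverse_fourier (fmul phi h))%R <=
   C%:E * (Lpnorm mu p (inverse_fourier g \- f)%R +
           Lpnorm mu p (inverse_fourier h \- f)%R))%E.
Proof.
move=> dg dh Lf; rewrite inverse_fourier_fmulB//.
apply: le_trans (phiC (fourier_domainB p1 dg dh)) _.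
apply: lee_wpmul2l; first by rewrite lee_fin.
rewrite inverse_fourier_subE//; apply: le_trans (LpnormB_ge (g := f) _ _ _ _ _) _ => //.
- exact: dg.2.1.
- exact: Lf.1.
- exact: dh.2.1.
by rewrite leeD2l// LpnormBC.
Qed.

(** Approximants chosen with geometric precision have images converging almost
    everywhere; Fatou's lemma turns this into convergence in L^p. *)
Lemma extension_exists (f : E -> X) : Lp mu p f -> exists h, extension_value f h.
Proof.
move=> Lf; have [_ af] := fourier_domain_dense p1 Lf.
pose del j : R := 4^-1 ^+ j / (2 * (C + 1)).
have C1 : 0 < C + 1 by rewrite ltr_wpDl.
have q0 j : 0 < 4^-1 ^+ j :> R by rewrite exprn_gt0// invr_gt0.
have del0 j : 0 < del j by rewrite divr_gt0// mulr_gt0.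
have /choice[g gP] j : exists g : E -> X, fourier_domain p g /\
    (Lpnorm mu p (inverse_fourier g \- f)%R < (del j)%:E)%E.
  by have [g dg gf] := af _ (del0 j); exists g.
have dg j : fourier_domain p (g j) by case: (gP j).
have gdel j : (Lpnorm mu p (inverse_fourier (g j) \- f)%R <= (del j)%:E)%E.
  by apply: ltW; case: (gP j).
pose u j := inverse_fourier (fmul phi (g j)).
have mu_ j : strongly_measurable (u j) by case: (phiL (dg j)).
have delS j : del j.+1 <= del j.
  rewrite /del ler_wpM2r ?invr_ge0 ?mulr_ge0 ?(ltW C1)//.
  by rewrite exprS ler_piMl// ?(ltW (q0 _))//; lra.
have [h mh uh] : exists2 h, strongly_measurable h &
    \forall x \ae mu, u k x @[k --> \oo] --> h x.
  apply: (riesz_fischer p1 mu_) => k.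
  apply: le_trans (fmul_contract (dg k.+1) (dg k) Lf) _.
  apply: (@le_trans _ _ (C%:E * ((del k)%:E + (del k)%:E))%E).
    apply: lee_wpmul2l; first by rewrite lee_fin.
    by apply: leeD => //; apply: le_trans (gdel _) _; rewrite lee_fin.
  rewrite -EFinD -EFinM lee_fin /del.
  have -> : C * (4^-1 ^+ k / (2 * (C + 1)) + 4^-1 ^+ k / (2 * (C + 1))) =
     4^-1 ^+ k * (C / (C + 1)).
    by set q := 4^-1 ^+ k; field; rewrite gt_eqF.
  by rewrite ler_piMr ?(ltW (q0 _))// ler_pdivrMr// mul1r lerDl.
have gf : Lcvg mu p (fun j => inverse_fourier (g j)) f.
  move=> e e0.
  have : (2 * (C + 1))^-1 * 4^-1 ^+ j @[j --> \oo] --> (0 : R).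
    rewrite -[X in _ --> X](mulr0 (2 * (C + 1))^-1); apply: cvgM; first exact: cvg_cst.
    by apply: cvg_expr; rewrite ger0_norm; lra.
  move=> /cvgrPdist_lt/(_ _ e0); apply: filterS => j.
  rewrite sub0r normrN mulrC -/(del j) ger0_norm ?(ltW (del0 _))// => hj.
  by apply: le_lt_trans (gdel j) _; rewrite lte_fin.
have uh' : Lcvg mu p u h.
  move=> e e0.
  have e2 : 0 < e / 2 by rewrite divr_gt0.
  have e4 : 0 < e / 2 / (2 * (C + 1)) by rewrite !divr_gt0// mulr_gt0.
  have [N _ hN] := gf _ e4; exists N => // k /= Nk.
  apply: (@le_lt_trans _ _ (e / 2)%:E); last by rewrite lte_fin; lra.
  apply: (@Lpnorm_fatou _ _ _ mu p X (fun l => u k \- u l)) => //.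
  - by move=> l; exact: smB.
  - exact: smB.
  - apply: filterS uh => x ux; apply: cvgB => //; exact: cvg_cst.
  exists N => // l /= Nl; apply: le_trans (fmul_contract (dg k) (dg l) Lf) _.
  apply: (@le_trans _ _ (C%:E * ((e / 2 / (2 * (C + 1)))%:E + (e / 2 / (2 * (C + 1)))%:E))%E).
    apply: lee_wpmul2l; first by rewrite lee_fin.
    by apply: leeD; apply: ltW; exact: hN.
  rewrite -EFinD -EFinM lee_fin.
  have -> : C * (e / 2 / (2 * (C + 1)) + e / 2 / (2 * (C + 1))) = e / 2 * (C / (C + 1)).
    by field; rewrite gt_eqF.
  by rewrite ler_piMr// ?(ltW e2)// ler_pdivrMr// mul1r lerDl.
exists h; split; last by exists g.
have [N _ /(_ N (leqnn N)) hN] := uh' _ ltr01.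
rewrite (_ : h = u N \- (u N \- h)).
  apply: LpB => //; first exact: phiL (dg N).
  by split; [exact: smB|rewrite (lt_trans hN)// ltry].
by apply/funext => x /=; rewrite opprB addrC subrK.
Qed.

Lemma extension_lin a (f f' h h' : E -> X) : Lp mu p f -> Lp mu p f' ->
  extension_value f h -> extension_value f' h' ->
  extension_value (a \*: f \+ f') (a \*: h \+ h').
Proof.
move=> Lf Lf' [Lh [g [dg gf gh]]] [Lh' [g' [dg' gf' gh']]].
split; first by apply: LpD => //; exact: LpZ.
have mg k : strongly_measurable (inverse_fourier (g k)) by case: (dg k).2.
have mg' k : strongly_measurable (inverse_fourier (g' k)) by case: (dg' k).2.
have mpg k : strongly_measurable (inverse_fourier (fmul phi (g k))).
  by case: (phiL (dg k)).
have mpg' k : strongly_measurable (inverse_fourier (fmul phi (g' k))).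
  by case: (phiL (dg' k)).
exists (fun k => a \*: g k \+ g' k); split.
- by move=> k; apply: fourier_domainD => //; exact: fourier_domainZ.
- rewrite (_ : (fun k => _) = (fun k => a \*: inverse_fourier (g k) \+ inverse_fourier (g' k))).
    apply: LcvgD => //.
    + by move=> k; exact: smZl.
    + exact: smZl Lf.1.
    + exact: Lf'.1.
    + by apply: LcvgZ => //; exact: Lf.1.
  apply/funext => k; apply/funext => x.
  rewrite inverse_fourierD ?inverse_fourierZ//; [exact: (dg k).1| |exact: (dg' k).1].
  exact: LpZ ltr01 (dg k).1.
rewrite (_ : (fun k => _) = (fun k => a \*: inverse_fourier (fmul phi (g k)) \+
    inverse_fourier (fmul phi (g' k)))).
  apply: LcvgD => //.
  + by move=> k; exact: smZl.
  + exact: smZl Lh.1.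
  + exact: Lh'.1.
  + by apply: LcvgZ => //; exact: Lh.1.
apply/funext => k; apply/funext => x /=.
have L1 := Lp1_fmul Lphi (dg k).1; have L2 := Lp1_fmul Lphi (dg' k).1.
rewrite -inverse_fourierZ// -inverse_fourierD//; last exact: LpZ.
congr inverse_fourier; apply/funext => y; rewrite /fmul /= scalerDr.
by rewrite !scalerA mulrC.
Qed.

Lemma extension_bound (f h : E -> X) : Lp mu p f -> extension_value f h ->
  (Lpnorm mu p h <= C%:E * Lpnorm mu p f)%E.
Proof.
move=> Lf [Lh [g [dg gf gh]]].
have C1 : 0 < C + 1 by rewrite ltr_wpDl.
apply/lee_addgt0Pr => e e0.
have e2 : 0 < e / 2 by rewrite divr_gt0.
have e3 : 0 < e / 2 / (C + 1) by rewrite divr_gt0.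
near \oo => k.
have h1 : (Lpnorm mu p (inverse_fourier (fmul phi (g k)) \- h)%R < (e / 2)%:E)%E.
  by near: k; exact: gh.
have h2 : (Lpnorm mu p (inverse_fourier (g k) \- f)%R < (e / 2 / (C + 1))%:E)%E.
  by near: k; exact: gf.
have mk := (phiL (dg k)).1.
have hE : h = inverse_fourier (fmul phi (g k)) \- (inverse_fourier (fmul phi (g k)) \- h).
  by apply/funext => x /=; rewrite opprB addrC subrK.
rewrite [in leLHS]hE; apply: le_trans (LpnormB _ _ _ _) _ => //.
  exact: smB mk Lh.1.
have fE : inverse_fourier (g k) = f \+ (inverse_fourier (g k) \- f).
  by apply/funext => x /=; rewrite addrC subrK.
apply: (@le_trans _ _ (C%:E * (Lpnorm mu p f + (e / 2 / (C + 1))%:E) + (e / 2)%:E)%E).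
  apply: leeD; last exact: ltW.
  apply: le_trans (phiC (dg k)) _; apply: lee_wpmul2l; first by rewrite lee_fin.
  rewrite [in leLHS]fE; apply: le_trans (LpnormD _ _ _ _) _ => //.
  - exact: Lf.1.
  - exact: smB (dg k).2.1 Lf.1.
  by rewrite leeD2l// ltW.
have Nf : Lpnorm mu p f \is a fin_num by rewrite ge0_fin_numE ?Lpnorm_ge0//; exact: Lf.2.
rewrite -(fineK Nf) -!(EFinD, EFinM) lee_fin mulrDr -addrA lerD2l.
have : C * (e / 2 / (C + 1)) <= e / 2.
  by rewrite mulrCA ler_piMr ?(ltW e2)// ler_pdivrMr// mul1r lerDl.
by lra.
Unshelve. all: by end_near. Qed.

Lemma extension_unique (f f' h h' : E -> X) : Lp mu p f -> Lp mu p f' ->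
  f = f' %[ae mu] -> extension_value f h -> extension_value f' h' ->
  h = h' %[ae mu].
Proof.
move=> Lf Lf' ff' fh fh'.
have L : Lp mu p ((-1) \*: f \+ f') by apply: LpD => //; exact: LpZ.
have := extension_bound L (extension_lin (-1) Lf Lf' fh fh').
rewrite (_ : Lpnorm mu p ((-1) \*: f \+ f') = 0%E); last first.
  rewrite -(@Lpnorm0 _ _ _ mu p X) ?gt_eqF//.
  apply: eqae_Lpnorm => //; [exact: L.1|exact: sm_cst|].
  by apply: filterS ff' => x /[apply] /= ->; rewrite scaleN1r addNr.
rewrite mule0 => h0.
have Lh : Lp mu p ((-1) \*: h \+ h').
  by apply: LpD; [|apply: LpZ => //; case: fh|case: fh'].
have : Lpnorm mu p ((-1) \*: h \+ h') = 0%E.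
  by apply/eqP; rewrite eq_le h0 Lpnorm_ge0.
move=> /(Lpnorm_eq0 p0 Lh.1); apply: filterS => x /= + _.
by rewrite scaleN1r addrC => /eqP; rewrite subr_eq0 => /eqP.
Qed.

Lemma extension_domain (g : E -> X) : fourier_domain p g ->
  extension_value (inverse_fourier g) (inverse_fourier (fmul phi g)).
Proof.
move=> dg; split; first exact: phiL.
have c0 (u : E -> X) : Lcvg mu p (fun _ : nat => u) u.
  move=> e e0; apply: nearW => _; rewrite (_ : u \- u = cst 0).
    by rewrite Lpnorm0 ?gt_eqF.
  by apply/funext => x /=; rewrite subrr.
by exists (fun=> g); split.
Qed.

Lemma extends_multiplier_exists : exists U : (E -> X) -> E -> X, extends_multiplier p phi U.
Proof.
pose U f : E -> X := xget (cst 0) (extension_value f).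
have UP f : Lp mu p f -> extension_value f (U f).
  by move=> /extension_exists; exact: xgetPex.
exists U; split; last first.
  move=> g dg; apply: (@extension_unique (inverse_fourier g) (inverse_fourier g)).
  - exact: dg.2.
  - exact: dg.2.
  - exact: aeW.
  - exact/UP/dg.2.
  - exact: extension_domain.
split.
- by move=> f /UP[].
- by move=> f g Lf Lg fg; apply: (extension_unique Lf Lg fg); exact: UP.
- move=> a f g Lf Lg.
  have L : Lp mu p (a \*: f \+ g) by apply: LpD => //; exact: LpZ.
  apply: (@extension_unique (a \*: f \+ g) (a \*: f \+ g)) => //; first exact: aeW.
  - exact: UP.
  - by apply: extension_lin => //; exact: UP.
- by exists C => f Lf; apply: extension_bound => //; exact: UP.
Qed.

End extension.

Section multiplier_operators.
Context {R : realType} (n : nat) (X : completeNormedModType R[i]) (p : R).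
Hypothesis p1 : 1 <= p.
Local Notation E := (Rn R n).
Local Notation mu := (@lebesgue_Rn R n).

Let p0 : 0 < p. Proof. exact: lt_le_trans p1. Qed.

Lemma multiplier_operatorP (phi : E -> R[i]) : multiplier p X phi ->
  extends_multiplier p phi (multiplier_operator p X phi).
Proof.
move=> [Lphi phiL [C phiC]]; apply: xgetPex.
apply: (@extends_multiplier_exists _ _ _ _ p1 _ Lphi phiL `|C|) => // g dg.
apply: le_trans (phiC _ dg) _; apply: lee_wpmul2r; first exact: Lpnorm_ge0.
by rewrite lee_fin ler_norm.
Qed.

(** Density lets any bound on the initial domain pass to the extension. *)
Lemma extends_multiplier_bound (phi : E -> R[i]) (U : (E -> X) -> E -> X) (K : R) :
  Linfty mu phi -> extends_multiplier p phi U -> 0 <= K ->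
  (forall g : E -> X, fourier_domain p g ->
    (Lpnorm mu p (inverse_fourier (fmul phi g)) <= K%:E * Lpnorm mu p (inverse_fourier g))%E) ->
  forall f, Lp mu p f -> (Lpnorm mu p (U f) <= K%:E * Lpnorm mu p f)%E.
Proof.
move=> Lphi [bU Ug] K0 phiK f Lf; have [UL Uae Ulin [C UC]] := bU.
have C0 : 0 < `|C| + K + 1 by rewrite ltr_wpDl// addr_ge0.
apply/lee_addgt0Pr => e e0.
have [_ /(_ _ (divr_gt0 e0 C0))[g dg gf]] := fourier_domain_dense p1 Lf.
set d := e / _ in gf.
have Lg := dg.2.
have LU : Lp mu p (U f \- U (inverse_fourier g)) by apply: LpB => //; exact: UL.
rewrite (_ : U f = (U f \- U (inverse_fourier g)) \+ U (inverse_fourier g)); last first.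
  by apply/funext => x /=; rewrite subrK.
apply: le_trans (LpnormD _ _ _ _) _ => //; [exact: LU.1|exact: (UL _ Lg).1|].
have h1 : (Lpnorm mu p (U f \- U (inverse_fourier g))%R <= (`|C| * d)%:E)%E.
  rewrite (eqae_Lpnorm p1 _ _ (bounded_operatorB p1 bU Lf Lg)); last 2 first.
  - exact: LU.1.
  - by apply: (UL _ _).1; exact: LpB.
  apply: le_trans (UC _ (LpB p1 Lf Lg)) _.
  apply: (@le_trans _ _ (`|C|%:E * Lpnorm mu p (f \- inverse_fourier g)%R)%E).
    by apply: lee_wpmul2r; [exact: Lpnorm_ge0|rewrite lee_fin ler_norm].
  rewrite EFinM; apply: lee_wpmul2l; first by rewrite lee_fin.
  by rewrite LpnormBC ltW.
have h2 : (Lpnorm mu p (inverse_fourier g) <= Lpnorm mu p f + d%:E)%E.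
  rewrite (_ : inverse_fourier g = f \+ (inverse_fourier g \- f)); last first.
    by apply/funext => x /=; rewrite addrC subrK.
  apply: le_trans (LpnormD _ _ _ _) _ => //; [exact: Lf.1|exact: smB Lg.1 Lf.1|].
  by rewrite leeD2l// ltW.
have h3 : (Lpnorm mu p (U (inverse_fourier g)) <= K%:E * (Lpnorm mu p f + d%:E))%E.
  have ULg := UL _ Lg.
  have mI : strongly_measurable (inverse_fourier (fmul phi g)).
    by apply: sm_inverse_fourier; exact: Lp1_fmul dg.1.
  rewrite (eqae_Lpnorm p1 ULg.1 mI (Ug _ dg)).
  apply: le_trans (phiK _ dg) _; apply: lee_wpmul2l => //.
apply: le_trans (leeD h1 h3) _.
have Nf : Lpnorm mu p f \is a fin_num by rewrite ge0_fin_numE ?Lpnorm_ge0//; exact: Lf.2.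
rewrite -(fineK Nf) -!(EFinD, EFinM) lee_fin.
have : d * (`|C| + K + 1) = e by rewrite /d divfK// gt_eqF.
have : 0 < d by rewrite divr_gt0.
set c := `|C|; set N := fine _; nra.
Qed.

End multiplier_operators.

(** * The hull of the orbit of a function *)

Section hull.
Context {R : realType} (n : nat).
Local Notation E := (Rn R n).
Local Notation mu := (@lebesgue_Rn R n).
Local Notation C := R[i].
Implicit Types (phi c m : E -> C) (U V : E -> E).

(** Finite averages over isometries, in the form that the parallelogram law
    calls for. *)
Inductive hull phi : (E -> C) -> Prop :=
| hull_iso U V of isometry U V : hull phi (phi \o U)
| hull_mid c c' of hull phi c & hull phi c' :
    hull phi (fun x => (2^-1 : R)%:C * (c x + c' x)).

Lemma hull_self phi : hull phi phi.
Proof. exact: (@hull_iso phi id id (@iso_id R n)). Qed.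

Lemma hull_sm phi c : strongly_measurable phi -> hull phi c -> strongly_measurable c.
Proof.
move=> mphi; elim=> [U V iU|c1 c2 _ m1 _ m2].
  by apply: sm_comp => //; exact: (iso_mp iU).1.
by apply: smM; [exact: sm_cst|exact: smD].
Qed.

Lemma hull_bound phi c (M : R) : (\forall x \ae mu, rnorm (phi x) <= M) ->
  hull phi c -> \forall x \ae mu, rnorm (c x) <= M.
Proof.
move=> phiM; elim=> [U V iU|c1 c2 _ m1 _ m2].
  exact: (ae_mp (iso_mp iU) phiM).
apply: filterS2 m1 m2 => x h1 h2; rewrite rnormM rnormC ger0_norm ?invr_ge0//.
by have := rnormD (c1 x) (c2 x); lra.
Qed.

Lemma hull_comp phi c U V : isometry U V -> hull phi c -> hull phi (c \o U).
Proof.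
move=> iU; elim=> [U' V' iU'|c1 c2 _ h1 _ h2].
  exact: (@hull_iso phi (U' \o U) (V \o V') (iso_comp iU' iU)).
exact: hull_mid h1 h2.
Qed.

(** Being integrable and invariant under isometries, it makes bounded functions
    square integrable without breaking the symmetry. *)
Definition gauss_weight (x : E) : R := expR (- dotp x x).

Lemma gauss_weight_gt0 x : 0 < gauss_weight x.
Proof. exact: expR_gt0. Qed.

Lemma gauss_weight_iso U V x : isometry U V -> gauss_weight (U x) = gauss_weight x.
Proof. by move=> iU; rewrite /gauss_weight (iso_dotp _ _ iU). Qed.

Lemma gauss_weightE x : gauss_weight x = tprod (fun t => expR (- t ^+ 2)) x.
Proof.
rewrite /gauss_weight /dotp -sumrN expR_sum; apply: eq_bigr => i _.
by rewrite expr2.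
Qed.

Lemma measurable_gauss_weight : measurable_fun setT gauss_weight.
Proof.
rewrite (_ : gauss_weight = tprod (fun t => expR (- t ^+ 2))); last first.
  by apply/funext => x; exact: gauss_weightE.
apply: measurable_tprod; apply: continuous_measurable_fun => x.
by have := @continuous_gauss_fun R x.
Qed.

Lemma sm_gauss_weight : strongly_measurable (fun x => (gauss_weight x)%:C : C).
Proof. by apply: sm_realC; exact: measurable_gauss_weight. Qed.

Lemma integral_gauss_weight_lty : (\int[mu]_x (gauss_weight x)%:E < +oo)%E.
Proof.
under eq_integral do rewrite gauss_weightE.
apply: integral_tprod_lty.
- by apply: continuous_measurable_fun => x; have := @continuous_gauss_fun R x.
- by move=> y; exact: expR_ge0.
- by have := @integralT_gauss R => ->; rewrite ltry.
Qed.

Lemma gauss_weight_le1 x : gauss_weight x <= 1.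
Proof. by rewrite /gauss_weight -expR0 ler_expR oppr_le0 dotp_ge0. Qed.

Lemma Lp1_gauss_weight : Lp mu 1 (fun x => (gauss_weight x)%:C : C).
Proof.
split; first exact: sm_gauss_weight.
rewrite Lpnorm1; under eq_integral do rewrite rnormC gtr0_norm ?gauss_weight_gt0//.
exact: integral_gauss_weight_lty.
Qed.

Lemma powint2E (X : normedModType C) (f : E -> X) :
  powint mu 2 f = (\int[mu]_x (rnorm (f x) ^+ 2)%:E)%E.
Proof.
by apply: eq_integral => x _; rewrite (@powR_mulrn _ _ 2)// rnorm_ge0.
Qed.

Lemma powint2_parallelogram (f g : E -> C) :
  strongly_measurable f -> strongly_measurable g ->
  (powint mu 2 (f \- g)%R + powint mu 2 (f \+ g)%R =
   2%:E * (powint mu 2 f + powint mu 2 g))%E.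
Proof.
move=> mf mg; rewrite !powint2E.
have mE (h : E -> C) : strongly_measurable h ->
    measurable_fun setT (fun x => (rnorm (h x) ^+ 2)%:E).
  move=> mh; apply/measurable_EFinP; apply: measurable_funX; exact: sm_rnorm.
have p0 (h : E -> C) : forall x, setT x -> (0 <= (rnorm (h x) ^+ 2)%:E)%E.
  by move=> x _; rewrite lee_fin sqr_ge0.
rewrite -ge0_integralD; [|by []|exact: p0|by apply: mE; exact: smB|exact: p0|
  by apply: mE; exact: smD].
rewrite -ge0_integralD; [|by []|exact: p0|exact: mE|exact: p0|exact: mE].
rewrite -ge0_integralZl_EFin; [|by []|by move=> x _; rewrite adde_ge0// lee_fin sqr_ge0|
  by apply: emeasurable_funD; exact: mE|by []].
apply: eq_integral => x _; rewrite -!EFinD -EFinM; congr EFin.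
by rewrite /= !rnorm_sqr !raddfB !raddfD /=; ring.
Qed.

Definition weighted c : E -> C := fun x => (gauss_weight x)%:C * c x.

Lemma sm_weighted c : strongly_measurable c -> strongly_measurable (weighted c).
Proof. by apply: smM; exact: sm_gauss_weight. Qed.

Lemma powint_weighted_lty c : Linfty mu c -> (powint mu 2 (weighted c) < +oo)%E.
Proof.
move=> [mc [M cM]].
have mw := sm_weighted mc.
apply: (@le_lt_trans _ _ (\int[mu]_x ((M ^+ 2)%:E * (gauss_weight x)%:E))%E).
  rewrite powint2E; apply: ae_ge0_le_integral => //.
  - by move=> x _; rewrite lee_fin sqr_ge0.
  - by apply/measurable_EFinP; apply: measurable_funX; exact: sm_rnorm.
  - by move=> x _; rewrite mule_ge0// lee_fin ?sqr_ge0// ltW// gauss_weight_gt0.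
  - by apply: measurable_funeM; apply/measurable_EFinP; exact: measurable_gauss_weight.
  apply: filterS cM => x cx _; rewrite -EFinM lee_fin /weighted rnormM rnormC.
  rewrite gtr0_norm ?gauss_weight_gt0// exprMn mulrC.
  have g0 := gauss_weight_gt0 x; have g1 := gauss_weight_le1 x.
  have c0 := rnorm_ge0 (c x).
  apply: ler_pM; rewrite ?sqr_ge0//; first by rewrite lerXn2r// nnegrE (le_trans c0).
  by rewrite expr2 ler_piMr// ltW.
rewrite ge0_integralZl_EFin ?sqr_ge0//; last 2 first.
- by move=> x _; rewrite lee_fin ltW// gauss_weight_gt0.
- by apply/measurable_EFinP; exact: measurable_gauss_weight.
by rewrite lte_mul_pinfty ?lee_fin ?sqr_ge0//; exact: integral_gauss_weight_lty.
Qed.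

Lemma hull_Linfty phi c : Linfty mu phi -> hull phi c -> Linfty mu c.
Proof.
move=> [mphi [M phiM]] hc; split; first exact: hull_sm hc.
by exists M; exact: hull_bound hc.
Qed.

(** Two almost minimal elements are close to each other, because their midpoint
    cannot be much smaller than they are. *)
Lemma hull_close phi (d del : R) c c' : Linfty mu phi ->
  (forall c, hull phi c -> (d%:E <= powint mu 2 (weighted c))%E) ->
  hull phi c -> hull phi c' ->
  (powint mu 2 (weighted c) <= (d + del)%:E)%E ->
  (powint mu 2 (weighted c') <= (d + del)%:E)%E ->
  (powint mu 2 (weighted c \- weighted c')%R <= (4 * del)%:E)%E.
Proof.
move=> Lphi dmin hc hc' cd cd'.
have mc := sm_weighted (hull_sm Lphi.1 hc).
have mc' := sm_weighted (hull_sm Lphi.1 hc').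
have := powint2_parallelogram mc mc'.
have mid : powint mu 2 (weighted c \+ weighted c')%R =
    (4%:E * powint mu 2 (weighted (fun x => ((2^-1 : R)%:C * (c x + c' x))%R)))%E.
  rewrite (_ : weighted c \+ weighted c' = (2 : R)%:C \*:
     (weighted (fun x => (2^-1 : R)%:C * (c x + c' x)))).
    rewrite (powintZ mu _ (ler0n R 2) (sm_weighted (hull_sm Lphi.1 (hull_mid hc hc')))).
    by rewrite rnormC ger0_norm// (@powR_mulrn _ _ 2)// -natrX.
  apply/funext => x; rewrite /weighted /= -mulrDr.
  have h2 : (2 : R)%:C * (2^-1 : R)%:C = 1 :> C.
    by rewrite -[LHS](rmorphM (real_complex R)) (@mulfV R 2).
  have alg (K : comNzRingType) (a b g y : K) : a * b = 1 -> g * y = a * (g * (b * y)).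
    by move=> ab; rewrite mulrCA [a * _]mulrA ab mul1r.
  exact: alg h2.
have := dmin _ (hull_mid hc hc').
rewrite mid; have := powint_ge0 mu 2 (weighted c \- weighted c').
move: cd cd'.
have fin c0 (h : hull phi c0) : powint mu 2 (weighted c0) \is a fin_num.
  rewrite ge0_fin_numE; last exact: powint_ge0.
  exact: powint_weighted_lty (hull_Linfty Lphi h).
move: (fin _ hc) (fin _ hc') (fin _ (hull_mid hc hc')).
move: (powint mu 2 (weighted c)) (powint mu 2 (weighted c'))
  (powint mu 2 (weighted (fun x => (2^-1 : R)%:C * (c x + c' x))))
  (powint mu 2 (weighted c \- weighted c')%R) => a b m q /fineK <- /fineK <- /fineK <-.
rewrite !lee_fin => h1 h2 h3 h4; rewrite -EFinM -EFinD -EFinM => h5.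
case: q h3 h5 => [q||]//.
by move=> _ [h5]; rewrite lee_fin; lra.
Qed.

End hull.

Section hull_limit.
Context {R : realType} (n : nat).
Local Notation E := (Rn R n).
Local Notation mu := (@lebesgue_Rn R n).
Local Notation C := R[i].
Implicit Types (phi c m : E -> C) (U V : E -> E).

Lemma weighted_iso c U V : isometry U V -> weighted (c \o U) = weighted c \o U.
Proof.
by move=> iU; apply/funext => x; rewrite /weighted /= (gauss_weight_iso _ iU).
Qed.

Lemma gauss_weightC_neq0 (x : E) : (gauss_weight x)%:C != 0 :> C.
Proof. by rewrite fmorph_eq0 gt_eqF// gauss_weight_gt0. Qed.

Lemma cvg_weighted (c : nat -> E -> C) m x :
  weighted (c k) x @[k --> \oo] --> weighted m x <-> c k x @[k --> \oo] --> m x.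
Proof.
split=> h; last by apply: cvgM; [exact: cvg_cst|exact: h].
have E1 (q : E -> C) : q x = ((gauss_weight x)%:C)^-1 * weighted q x.
  by rewrite /weighted mulKf// gauss_weightC_neq0.
rewrite (E1 m) (_ : (fun k => c k x) = fun k => ((gauss_weight x)%:C)^-1 * weighted (c k) x).
  by apply: cvgM; [exact: cvg_cst|exact: h].
by apply/funext => k; exact: E1.
Qed.

(** The element of minimal weighted L^2 norm in the closure of the hull is
    unique; since the weight is radial, isometries permute the elements of given
    norm of the hull, and therefore fix the minimal one. *)
Lemma hull_invariant_limit phi : Linfty mu phi ->
  exists m, Linfty mu m /\ exists c : nat -> E -> C,
    [/\ forall k, hull phi (c k),
        \forall x \ae mu, c k x @[k --> \oo] --> m x &
        forall U V, isometry U V -> \forall x \ae mu, m (U x) = m x].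
Proof.
move=> Lphi; have [mphi [M phiM]] := Lphi.
have h12 : 1 <= 2 :> R by rewrite ler1n.
pose J c := fine (powint mu 2 (weighted c)).
have JE c : hull phi c -> powint mu 2 (weighted c) = (J c)%:E.
  move=> hc; rewrite fineK// ge0_fin_numE; last exact: powint_ge0.
  exact: powint_weighted_lty (hull_Linfty Lphi hc).
pose S := [set J c | c in [set c | hull phi c]].
have Slb : has_lbound S.
  by exists 0 => _ [c hc <-]; apply: fine_ge0; exact: powint_ge0.
have S0 : has_inf S by split=> //; exists (J phi), phi => //; exact: hull_self.
pose d := inf S.
have dmin c : hull phi c -> (d%:E <= powint mu 2 (weighted c))%E.
  by move=> hc; rewrite JE// lee_fin; apply: ge_inf => //; exists c.
(* The tolerances make the differences of consecutive elements at most 4 ^- k. *)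
have [del [del0 delS del4]] : exists del : nat -> R, [/\ forall k, 0 < del k,
    forall k, del k.+1 <= del k & forall k, 4 * del k < (4^-1 ^+ k) ^+ 2].
  have q0 k : 0 < 16^-1 ^+ k :> R by rewrite exprn_gt0.
  exists (fun k => 8^-1 * 16^-1 ^+ k); split => k.
  - by rewrite mulr_gt0.
  - by rewrite ler_pM2l// exprS ler_piMl ?exprn_ge0// invf_le1 ?ler1n.
  rewrite exprAC (_ : 4^-1 ^+ 2 = 16^-1 :> R); last by rewrite expr2 -invfM -natrM.
  by move: (q0 k); move: (_ ^+ k) => q q1; lra.
have /choice[c cP] k : exists c, hull phi c /\
    (powint mu 2 (weighted c) <= (d + del k)%:E)%E.
  have [_ [c hc <-] cd] := inf_adherent (del0 k) S0.
  by exists c; split => //; rewrite JE// lee_fin ltW.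
have hc k := (cP k).1; have cd k := (cP k).2.
have mc k : strongly_measurable (c k) := hull_sm mphi (hc k).
have small k c1 c2 : hull phi c1 -> hull phi c2 ->
    (powint mu 2 (weighted c1) <= (d + del k)%:E)%E ->
    (powint mu 2 (weighted c2) <= (d + del k)%:E)%E ->
    (Lpnorm mu 2 (weighted c1 \- weighted c2)%R <= (4^-1 ^+ k)%:E)%E.
  move=> h1 h2 d1 d2; apply: ltW; apply: Lpnorm_lt; [by []|by rewrite exprn_gt0|].
  apply: le_lt_trans (hull_close Lphi dmin h1 h2 d1 d2) _.
  by rewrite lte_fin (@powR_mulrn _ _ 2) ?exprn_ge0// del4.
have cd1 k : (powint mu 2 (weighted (c k.+1)) <= (d + del k)%:E)%E.
  by apply: le_trans (cd _) _; rewrite lee_fin lerD2l.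
have [F mF cF] : exists2 g, strongly_measurable g &
    \forall x \ae mu, weighted (c k) x @[k --> \oo] --> g x.
  have mcw k : strongly_measurable (weighted (c k)) := sm_weighted (mc k).
  have clo k : (Lpnorm mu 2 (weighted (c k.+1) \- weighted (c k))%R <=
      (4^-1 ^+ k)%:E)%E.
    exact: small k _ _ (hc k.+1) (hc k) (cd1 k) (cd k).
  exact: riesz_fischer h12 mcw clo.
pose m x := ((gauss_weight x)^-1)%:C * F x.
have mw : weighted m = F.
  apply/funext => x; rewrite /weighted /m mulrA -rmorphM/= mulfV ?mul1r//.
  by rewrite gt_eqF// gauss_weight_gt0.
have mm : strongly_measurable m.
  apply: smM mF; apply: sm_realC.
  rewrite (_ : (fun x => _) = fun x : E => expR (enorm x ^+ 2)); last first.
    by apply/funext => x; rewrite /gauss_weight expRN invrK sqr_enorm.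
  apply: measurableT_comp; first exact: measurable_expR.
  by apply: measurable_funX; exact: measurable_enorm.
have cm : \forall x \ae mu, c k x @[k --> \oo] --> m x.
  by apply: filterS cF => x; rewrite -mw => /cvg_weighted.
exists m; split.
  split; [exact: mm|exists M].
  have cM : \forall x \ae mu, forall k, rnorm (c k x) <= M.
    by apply: ae_forall_nat => k; exact: hull_bound phiM (hc k).
  apply: filterS2 cm cM => x h1 h2; have h3 := rcvg_rnorm h1.
  rewrite -(cvg_lim _ h3)//; apply: limr_le; first by apply/cvg_ex; eexists; exact: h3.
  exact: nearW.
exists c; split; [exact: hc|exact: cm|move=> U V iU].
have hU k : hull phi (c k \o U) by exact: hull_comp iU (hc k).
have dU k : (powint mu 2 (weighted (c k \o U)) <= (d + del k)%:E)%E.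
  rewrite (weighted_iso _ iU) powint_mp; [exact: cd|exact: iso_mp iU|].
  exact: sm_weighted (mc k).
have mU : strongly_measurable (m \o U) by apply: sm_comp mm; exact: (iso_mp iU).1.
have N0 : Lpnorm mu 2 (weighted (m \o U) \- weighted m)%R = 0%E.
  apply/eqP; rewrite eq_le Lpnorm_ge0 andbT; apply/lee_addgt0Pr => e e0.
  rewrite add0e.
  apply: (@Lpnorm_fatou _ _ _ mu 2 _ (fun k => weighted (c k \o U) \- weighted (c k))).
  - by [].
  - move=> k; exact: smB (sm_weighted (hull_sm mphi (hU k))) (sm_weighted (mc k)).
  - exact: smB (sm_weighted mU) (sm_weighted mm).
  - apply: filterS2 cm (ae_mp (iso_mp iU) cm) => x h1 h2.
    have := (cvg_weighted (fun k => c k \o U) (m \o U) x).2 h2.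
    by move=> h2'; exact: cvgB h2' ((cvg_weighted _ _ _).2 h1).
  have : (4^-1 ^+ k @[k --> \oo] --> (0 : R)) by apply: cvg_expr; rewrite gtr0_norm// invf_lt1 ?ltr1n.
  move=> /cvgr_lt /(_ _ e0); apply: filterS => k ke.
  apply: le_trans (small k _ _ (hU k) (hc k) (dU k) (cd k)) _.
  by rewrite lee_fin ltW.
have mD : strongly_measurable (weighted (m \o U) \- weighted m).
  exact: smB (sm_weighted mU) (sm_weighted mm).
have h02 : 0 < 2 :> R := lt_le_trans ltr01 h12.
have := Lpnorm_eq0 h02 mD N0; apply: filterS => x /eqP; rewrite /= subr_eq0 => /eqP.
exact: mulfI (gauss_weightC_neq0 x) _ _.
Qed.

End hull_limit.

(** * Functions invariant under isometries are radial *)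

Section balls.
Context {R : realType} (n : nat).
Local Notation E := (Rn R n).
Local Notation mu := (@lebesgue_Rn R n).
Local Notation leb := (@lebesgue_measure R).

Definition ball_indic (r : R) (x : E) : R := (enorm x < r)%R%:R.

Lemma ball_indic_ge0 r x : 0 <= ball_indic r x.
Proof. exact: ler0n. Qed.

Lemma measurable_ball_indic r : measurable_fun setT (ball_indic r).
Proof.
rewrite (_ : ball_indic r = \1_[set x : E | enorm x < r]); last first.
  by apply/funext => x; rewrite indicE mem_setE.
apply: measurable_indic.
rewrite (_ : [set _ | _] = (@enorm R n) @^-1` `]-oo, r[%classic).
  by rewrite -[X in measurable X]setTI; exact: measurable_enorm.
by apply/seteqP; split => x /=; rewrite in_itv.
Qed.

(** A ball has positive volume since it contains a cube, and finite volume since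
    the integrable Gaussian is bounded below on it. *)
Lemma integral_ball_indic r : 0 < r ->
  exists2 v, 0 < v & (\int[mu]_x (ball_indic r x)%:E = v%:E)%E.
Proof.
move=> r0; pose I := (\int[mu]_x (ball_indic r x)%:E)%E.
have mb : measurable_fun setT (fun x : E => (ball_indic r x)%:E).
  by apply/measurable_EFinP; exact: measurable_ball_indic.
have Ify : (I < +oo)%E.
  apply: (@le_lt_trans _ _ (\int[mu]_x ((expR (r ^+ 2))%:E * (gauss_weight x)%:E))%E).
    apply: ge0_le_integral => //.
    - by move=> x _; rewrite lee_fin ball_indic_ge0.
    - by apply: measurable_funeM; apply/measurable_EFinP; exact: measurable_gauss_weight.
    move=> x _; rewrite -EFinM lee_fin /gauss_weight -expRD /ball_indic.
    case: (boolP (enorm x < r)) => [xr|_]; last exact: expR_ge0.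
    rewrite -[leLHS]expR0 ler_expR subr_ge0 -sqr_enorm lerXn2r ?nnegrE ?enorm_ge0//.
    - exact: ltW.
    - exact: ltW.
  rewrite ge0_integralZl_EFin ?expR_ge0//; last 2 first.
  - by move=> x _; rewrite lee_fin ltW// gauss_weight_gt0.
  - by apply/measurable_EFinP; exact: measurable_gauss_weight.
  by rewrite lte_mul_pinfty ?lee_fin ?expR_ge0//; exact: integral_gauss_weight_lty.
(* The ball contains a cube, whose volume is a product. *)
pose s := r / n.+1%:R.
have s0 : 0 < s by rewrite divr_gt0.
pose h := \1_(ball (0 : R) s) : R -> R.
have mh : measurable_fun setT h by apply: measurable_indic; exact: measurable_ball.
have h0 y : 0 <= h y by rewrite /h indicE.
have Ih : (\int[leb]_x (h x)%:E = (s *+ 2)%:E)%E.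
  by rewrite integral_indic//= ?setIT ?lebesgue_measure_ball// ?ltW//; exact: measurable_ball.
have cube : ((s *+ 2) ^+ n)%:E%E = (\int[mu]_x (tprod h x)%:E)%E.
  by rewrite (integral_tprod n mh h0 Ih).
have Igt : (0 < I)%E.
  apply: (@lt_le_trans _ _ ((s *+ 2) ^+ n)%:E%E).
    by rewrite lte_fin exprn_gt0// pmulrn_lgt0.
  rewrite cube; apply: ge0_le_integral => //.
  - by move=> x _; rewrite lee_fin tprod_ge0.
  - by apply/measurable_EFinP; exact: measurable_tprod.
  move=> x _; rewrite lee_fin /ball_indic.
  case: (boolP [forall i, `|tnth x i| < s]) => [/forallP xs|].
    have -> : enorm x < r.
      apply: le_lt_trans (enorm_le_sum x) _.
      apply: (@le_lt_trans _ _ (\sum_(i < n) s)).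
        by apply: ler_sum => i _; exact: ltW.
      rewrite sumr_const card_ord -[X in X < _]mulr_natr /s mulrAC ltr_pdivrMr//.
      by rewrite ltr_pM2l// ltr_nat.
    apply: le_trans (_ : _ <= \prod_(i < n) 1) _; last by rewrite big1.
    by apply: ler_prod => i _; rewrite h0 /h indicE lern1 leq_b1.
  rewrite negb_forall => /existsP[i xi].
  rewrite /tprod (bigD1 i)//= {1}/h indicE memNset ?mul0r ?ler0n//.
  by rewrite -ball_normE /= sub0r normrN; exact/negP.
exists (fine I); first by rewrite fine_gt0// Igt.
by rewrite fineK// ge0_fin_numE// ltW.
Qed.

Lemma cvg_rnorm_ball (x : nat -> E) :
  (forall k, enorm (x k) < k.+1%:R^-1) ->
  forall i, tnth (x k) i @[k --> \oo] --> (0 : R).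
Proof.
move=> xk i; apply/cvgrPdist_lt => e e0.
have [N _ Ne] := cvgr_dist_lt _ _ (@cvg_harmonic R) _ e0.
exists N => // k /Ne; rewrite /harmonic /= !sub0r !normrN => h.
apply: le_lt_trans (ler_tnth_enorm _ _) _; apply: lt_trans (xk k) _.
by rewrite ger0_norm// in h; rewrite invr_ge0.
Qed.

End balls.

Section uniform_continuity.
Context {R : realType} (n : nat) (X : completeNormedModType R[i]).
Local Notation E := (Rn R n).
Local Notation mu := (@lebesgue_Rn R n).

(** The oscillation between [x] and [y] is at most the L^1 norm of [g] times the
    character of [x - y] minus 1, which depends on the difference only and tends
    to 0 by dominated convergence. *)
Lemma inverse_fourier_unif_cont (g : E -> X) (e : R) : Lp mu 1 g -> 0 < e ->
  exists2 r, 0 < r & forall x y, enorm (tsub x y) < r ->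
    rnorm (inverse_fourier g x - inverse_fourier g y) <= e.
Proof.
move=> Lg e0; apply: contrapT => /forall2NP nr.
have /choice[z zP] k : exists z : E * E, enorm (tsub z.1 z.2) < k.+1%:R^-1 /\
    e < rnorm (inverse_fourier g z.1 - inverse_fourier g z.2).
  have [|] := nr k.+1%:R^-1; first by rewrite invr_gt0 ltr0Sn.
  move=> /existsNP[x /existsNP[y /not_implyP[h1 /negP]]].
  by rewrite -ltNge => h2; exists (x, y).
pose w k := tsub (z k).1 (z k).2.
have w0 : forall i, tnth (w k) i @[k --> \oo] --> (0 : R).
  by apply: cvg_rnorm_ball => k; exact: (zP k).1.
have h : Lcvg mu 1 (fun k xi => kernel (w k) xi *: g xi) g.
apply: (Lp_dominated (h := g)); first exact: ltr01.
- by move=> k; exact: (Lp1_kernel _ Lg).1.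
- exact: Lg.1.
- exact: Lg.
- apply: aeW => xi; rewrite -[X in _ --> X]scale1r; apply: cvgZ; last exact: cvg_cst.
  rewrite (_ : 1 = expi 0); last by rewrite /expi cos0 sin0.
  apply: cvg_expi; rewrite -[X in _ --> X](mulr0 (2 * pi)).
  apply: cvgM; first exact: cvg_cst.
  rewrite (_ : 0 = \sum_(i < n) 0 * tnth xi i); last first.
    by rewrite big1// => i _; rewrite mul0r.
  apply: cvg_rsum => i; apply: cvgM; [exact: w0|exact: cvg_cst].
- by move=> k; apply: aeW => xi; rewrite rnormZ rnorm_expi mul1r.
have [N _ /(_ N (leqnn N))] := h _ e0.
apply/negP; rewrite -leNgt; apply: le_trans (_ : _ <= (rnorm (inverse_fourier g (z N).1 - inverse_fourier g (z N).2))%:E)%E _.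
  by rewrite lee_fin ltW//; exact: (zP N).2.
rewrite !inverse_fourierE -bochner_integralB; [|exact: Lp1_kernel|exact: Lp1_kernel].
apply: le_trans (le_bochner_integral _) _; first by apply: LpB => //; exact: Lp1_kernel.
apply: le_Lpnorm => //.
- by apply: smB; [exact: (Lp1_kernel _ Lg).1|exact: (Lp1_kernel _ Lg).1].
- by apply: smB; [exact: (Lp1_kernel _ Lg).1|exact: Lg.1].
apply: aeW => xi /=; rewrite -scalerBl -[X in _ <= rnorm (_ - X)]scale1r -scalerBl !rnormZ.
apply: ler_wpM2r; first exact: rnorm_ge0.
rewrite (_ : kernel (z N).1 xi = kernel (w N) xi * kernel (z N).2 xi); last first.
  by rewrite /kernel -expiD -mulrDr /w dotp_tsub subrK.
by rewrite -[X in rnorm (_ - X)]mul1r -mulrBl rnormM rnorm_expi mulr1.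
Qed.

End uniform_continuity.

Section fast_convergence.
Context {d} {T : measurableType d} {R : realType} (mu : {measure set T -> \bar R}).

(** Combines [riesz_fischer] with Fatou's lemma, which identifies the limit. *)
Lemma Lp_fast_ae p (X : completeNormedModType R[i]) (f : nat -> T -> X) (g : T -> X) :
  1 <= p -> (forall k, strongly_measurable (f k)) -> strongly_measurable g ->
  (forall k, Lpnorm mu p (f k \- g)%R <= (2^-1 * 4^-1 ^+ k)%:E)%E ->
  \forall x \ae mu, f k x @[k --> \oo] --> g x.
Proof.
move=> p1 mf mg fg; have p0 : 0 < p by exact: lt_le_trans p1.
have q0 k : 0 < 4^-1 ^+ k :> R by rewrite exprn_gt0.
have [l ml fl] : exists2 l, strongly_measurable l &
    \forall x \ae mu, f k x @[k --> \oo] --> l x.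
  apply: (riesz_fischer p1 mf) => k.
  apply: le_trans (LpnormB_ge (g := g) _ _ _ _ _) _ => //.
  apply: (@le_trans _ _ ((2^-1 * 4^-1 ^+ k.+1)%:E + (2^-1 * 4^-1 ^+ k)%:E)%E).
    by apply: leeD => //; rewrite LpnormBC.
  rewrite -EFinD lee_fin exprS; move: (q0 k); move: (_ ^+ k) => q q1; lra.
have lg : Lpnorm mu p (l \- g)%R = 0%E.
  apply/eqP; rewrite eq_le Lpnorm_ge0 andbT; apply/lee_addgt0Pr => e e0; rewrite add0e.
  apply: (Lpnorm_fatou (f := fun k => f k \- g) p0).
  - by move=> k; exact: smB.
  - exact: smB.
  - by apply: filterS fl => x h; apply: cvgB; [exact: h|exact: cvg_cst].
  have : (4^-1 ^+ k @[k --> \oo] --> (0 : R)) by apply: cvg_expr; rewrite gtr0_norm// invf_lt1 ?ltr1n.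
  move=> /cvgr_lt /(_ _ e0); apply: filterS => k ke.
  apply: le_trans (fg k) _; rewrite lee_fin.
  by move: (q0 k) ke; move: (_ ^+ k) => q q1 ke; lra.
have := Lpnorm_eq0 p0 (smB ml mg) lg.
by apply: filterS2 fl => x h /eqP; rewrite /= subr_eq0 => /eqP <-.
Qed.

End fast_convergence.

Section averages.
Context {R : realType} (n : nat).
Local Notation E := (Rn R n).
Local Notation mu := (@lebesgue_Rn R n).
Implicit Types (h : E -> R) (U V : E -> E).

Definition ball_sum r h (x : E) : \bar R :=
  (\int[mu]_y (h y * ball_indic r (tsub x y))%:E)%E.

Lemma measurable_ball_pair r h : measurable_fun setT h ->
  measurable_fun setT (fun z : E * E => (h z.2 * ball_indic r (tsub z.1 z.2))%:E).
Proof.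
move=> mh; apply/measurable_EFinP; apply: measurable_funM.
  exact: (measurableT_comp mh measurable_snd).
exact: (measurableT_comp (measurable_ball_indic r) (@measurable_tsub R n)).
Qed.

Lemma measurable_ball_right r (x : E) :
  measurable_fun setT (fun y => ball_indic r (tsub x y)).
Proof.
apply: (measurableT_comp (measurable_ball_indic r)).
exact: (measurableT_comp (@measurable_tsub R n) (measurable_pair1 x)).
Qed.

Lemma measurable_ball_term r h (x : E) : measurable_fun setT h ->
  measurable_fun setT (fun y => (h y * ball_indic r (tsub x y))%:E).
Proof.
by move=> mh; apply/measurable_EFinP; apply: measurable_funM mh (measurable_ball_right r x).
Qed.

Lemma ball_term_ge0 r h (x y : E) : (forall y, 0 <= h y) ->
  (0 <= (h y * ball_indic r (tsub x y))%:E)%E.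
Proof. by move=> h0; rewrite lee_fin mulr_ge0 ?ball_indic_ge0. Qed.

Lemma measurable_ball_sum r h : measurable_fun setT h -> (forall y, 0 <= h y) ->
  measurable_fun setT (ball_sum r h).
Proof.
move=> mh h0.
apply: (measurable_fun_fubini_tonelli_F (m2 := @vol R n) _ (measurable_ball_pair r mh)).
by move=> z; exact: ball_term_ge0.
Qed.

Lemma ball_sum_ge0 r h x : (forall y, 0 <= h y) -> (0 <= ball_sum r h x)%E.
Proof. by move=> h0; apply: integral_ge0 => y _; exact: ball_term_ge0. Qed.

Lemma integral_ball_indic_tsub r (x : E) :
  (\int[mu]_y (ball_indic r (tsub x y))%:E = \int[mu]_y (ball_indic r y)%:E)%E.
Proof.
transitivity (\int[mu]_y (ball_indic r (tsub y x))%:E)%E.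
  by apply: eq_integral => y _; rewrite /ball_indic enorm_tsubC.
apply: (ge0_integral_mp (U := fun y => tsub y x) (f := fun y => (ball_indic r y)%:E)).
- exact: measure_preserving_tsub.
- by apply/measurable_EFinP; exact: measurable_ball_indic.
- by move=> y; rewrite lee_fin ball_indic_ge0.
Qed.

Lemma integral_ball_sum r h v : measurable_fun setT h -> (forall y, 0 <= h y) ->
  0 <= v -> (\int[mu]_y (ball_indic r y)%:E = v%:E)%E ->
  (\int[mu]_x ball_sum r h x = v%:E * \int[mu]_x (h x)%:E)%E.
Proof.
move=> mh h0 v0 vE.
rewrite (fubini_tonelli (m1 := @vol R n) (m2 := @vol R n) _ (measurable_ball_pair r mh)); last first.
  by move=> z; exact: ball_term_ge0.
rewrite -ge0_integralZl_EFin; [|by []|by move=> x _; rewrite lee_fin|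
  exact/measurable_EFinP|exact: v0].
apply: eq_integral => y _ /=.
transitivity (\int[mu]_x ((h y)%:E * (ball_indic r (tsub y x))%:E))%E.
  by apply: eq_integral => x _; rewrite -EFinM /ball_indic enorm_tsubC.
rewrite ge0_integralZl_EFin; [|by []|by move=> x _; rewrite lee_fin ball_indic_ge0|
  by apply/measurable_EFinP; exact: measurable_ball_right|exact: h0].
by rewrite integral_ball_indic_tsub vE muleC.
Qed.

Lemma ball_sum_iso r h U V x : measurable_fun setT h -> (forall y, 0 <= h y) ->
  isometry U V -> (\forall y \ae mu, h (U y) = h y) ->
  ball_sum r h (U x) = ball_sum r h x.
Proof.
move=> mh h0 iU hU; rewrite /ball_sum.
rewrite -(ge0_integral_mp (iso_mp iU) (measurable_ball_term r (U x) mh)); last first.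
  by move=> y; exact: ball_term_ge0.
apply: ge0_ae_eq_integral; [by []|
  exact: (measurableT_comp (measurable_ball_term r (U x) mh) (iso_mp iU).1)|
  exact: measurable_ball_term|by move=> y _; exact: ball_term_ge0|
  by move=> y _; exact: ball_term_ge0|].
by apply: filterS hU => y hy _; rewrite hy /ball_indic (iso_dist _ _ iU).
Qed.

(** Bounds the oscillation of [h] around [x] by that of a uniformly continuous
    function and by the size of the error [w] made in replacing [h] by it. *)
Lemma ball_sum_close r h (w : E -> R) (e v : R) x :
  measurable_fun setT h -> (forall y, 0 <= h y) -> (ball_sum r h x < +oo)%E ->
  measurable_fun setT w -> (forall y, 0 <= w y) -> 0 <= e -> 0 < v ->
  (\int[mu]_y (ball_indic r y)%:E = v%:E)%E ->
  (forall y, enorm (tsub x y) < r -> `|h y - h x| <= w y + w x + e) ->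
  (`|v^-1 * fine (ball_sum r h x) - h x|%:E <= v^-1%:E * ball_sum r w x + (w x + e)%:E)%E.
Proof.
move=> mh h0 hfin mw w0 e0 v0 vE hw.
have we0 : 0 <= w x + e by rewrite addr_ge0.
pose b y := ball_indic r (tsub x y).
have b0 y : 0 <= b y := ball_indic_ge0 r (tsub x y).
have mb : measurable_fun setT b := measurable_ball_right r x.
have Ib : (\int[mu]_y (b y)%:E = v%:E)%E by rewrite -vE integral_ball_indic_tsub.
have bh y : b y * `|h y - h x| <= b y * (w y + w x + e).
  rewrite /b /ball_indic; case: (boolP (enorm (tsub x y) < r)) => [/hw|_].
    by rewrite !mul1r.
  by rewrite !mul0r.
have [|wfin] := eqVneq (ball_sum r w x) +oo%E.
  by move=> ->; rewrite gt0_muley ?addye ?leey// lte_fin invr_gt0.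
have splitI (q : E -> R) c : measurable_fun setT q -> (forall y, 0 <= q y) -> 0 <= c ->
    (\int[mu]_y ((q y + c) * b y)%:E = ball_sum r q x + (c * v)%:E)%E.
  move=> mq q0 c0.
  transitivity (\int[mu]_y ((q y * b y)%:E + c%:E * (b y)%:E))%E.
    by apply: eq_integral => y _; rewrite -EFinM -EFinD mulrDl.
  rewrite ge0_integralD; [|by []|by move=> y _; exact: ball_term_ge0|
    exact: measurable_ball_term|by move=> y _; rewrite -EFinM lee_fin mulr_ge0|
    by apply: measurable_funeM; exact/measurable_EFinP].
  rewrite ge0_integralZl_EFin; [|by []|by move=> y _; rewrite lee_fin|
    exact/measurable_EFinP|exact: c0].
  by rewrite Ib EFinM.
have splitI2 (q q' : E -> R) c : measurable_fun setT q -> (forall y, 0 <= q y) ->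
    measurable_fun setT q' -> (forall y, 0 <= q' y) -> 0 <= c ->
    (\int[mu]_y ((q y + q' y + c) * b y)%:E = ball_sum r q x + ball_sum r q' x + (c * v)%:E)%E.
  move=> mq q0 mq' q0' c0; rewrite (splitI (fun y => q y + q' y)); last 3 first.
  - exact: measurable_funD.
  - by move=> y; rewrite addr_ge0.
  - exact: c0.
  congr (_ + _)%E; rewrite /ball_sum -ge0_integralD; [|by []|by move=> y _; exact: ball_term_ge0|
    exact: measurable_ball_term|by move=> y _; exact: ball_term_ge0|exact: measurable_ball_term].
  by apply: eq_integral => y _; rewrite -EFinD mulrDl.
have up : (ball_sum r h x <= ball_sum r w x + ((h x + (w x + e)) * v)%:E)%E.
  rewrite -splitI; [|exact: mw|exact: w0|by rewrite addr_ge0].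
  apply: ge0_le_integral; [by []|by move=> y _; exact: ball_term_ge0|
    exact: measurable_ball_term| |].
    by apply/measurable_EFinP; apply: measurable_funM => //; apply: measurable_funD.
  move=> y _; rewrite lee_fin -/(b y).
  have h1 := bh y; have h2 := ler_norm (h y - h x); have h3 := b0 y.
  have h4 := ler_wpM2l h3 h2; nra.
have lo : ((h x * v)%:E <= ball_sum r h x + ball_sum r w x + ((w x + e) * v)%:E)%E.
  rewrite -splitI2; [|exact: mh|exact: h0|exact: mw|exact: w0|exact: we0].
  have -> : ((h x * v)%:E = \int[mu]_y (h x * b y)%:E)%E.
    transitivity (\int[mu]_y ((h x)%:E * (b y)%:E))%E; last by apply: eq_integral => y _; rewrite EFinM.
    rewrite ge0_integralZl_EFin; [|by []|by move=> y _; rewrite lee_fin|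
      exact/measurable_EFinP|exact: h0].
    by rewrite Ib EFinM.
  apply: ge0_le_integral; [by []|by move=> y _; rewrite lee_fin mulr_ge0| | |].
  - by apply/measurable_EFinP; apply: measurable_funM.
  - by apply/measurable_EFinP; apply: measurable_funM => //; apply: measurable_funD => //;
      apply: measurable_funD.
  move=> y _; rewrite lee_fin.
  have h1 := bh y; have h2 := ler_norm (h x - h y); have h3 := b0 y.
  rewrite distrC in h2; have h4 := ler_wpM2l h3 h2; nra.
have hf : ball_sum r h x \is a fin_num by rewrite ge0_fin_numE ?ball_sum_ge0.
have wf : ball_sum r w x \is a fin_num by rewrite ge0_fin_numE ?ball_sum_ge0// lt_neqAle wfin leey.
move: up lo; rewrite -(fineK hf) -(fineK wf) /=.
move: (fine _) (fine _) => A B; rewrite -!EFinM -!EFinD !lee_fin => up lo.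
have vv : v^-1 * v = 1 by rewrite mulVf// gt_eqF.
have vi : 0 < v^-1 by rewrite invr_gt0.
have up' := ler_wpM2l (ltW vi) up; have lo' := ler_wpM2l (ltW vi) lo.
rewrite !mulrDr !(mulrCA v^-1) !vv !mulr1 in up' lo'.
by rewrite ler_distl; apply/andP; split; nra.
Qed.

End averages.

Section invariant_radial.
Context {R : realType} (n : nat).
Local Notation E := (Rn R n.+1).
Local Notation mu := (@lebesgue_Rn R n.+1).
Local Notation C := R[i].

(** The averages of an invariant function over balls are radial everywhere, not
    only almost everywhere, because they are defined by integrals; and the
    function is their limit. *)
Lemma invariant_radial_ge0 (h : E -> R) : measurable_fun setT h ->
  (forall x, 0 <= h x) -> (\int[mu]_x (h x)%:E < +oo)%E ->
  (forall U V, isometry U V -> \forall x \ae mu, h (U x) = h x) ->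
  exists h0 : R -> R, \forall x \ae mu, h x = h0 (enorm x).
Proof.
move=> mh h0 hfin hU.
have bfin r x : (ball_sum r h x < +oo)%E.
  apply: le_lt_trans hfin; apply: ge0_le_integral; [by []|
    by move=> y _; exact: ball_term_ge0|exact: measurable_ball_term|
    exact/measurable_EFinP|].
  move=> y _; rewrite lee_fin ler_piMr// /ball_indic; by case: (_ < _).
pose hC x : C := (h x)%:C.
have mhC : strongly_measurable hC by exact: sm_realC.
have LhC : Lp mu 1 hC.
  split; first exact: mhC.
  by rewrite Lpnorm1; under eq_integral do rewrite rnormC ger0_norm//.
have [W [W0 WE]] : exists W : R, 0 <= W /\ (\int[mu]_x (gauss_weight x)%:E = W%:E)%E.
  exists (fine (\int[mu]_x (gauss_weight x)%:E)%E).
  have I0 : (0 <= \int[mu]_x (gauss_weight x)%:E)%E.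
    by apply: integral_ge0 => x _; rewrite lee_fin ltW// gauss_weight_gt0.
  split; first exact: fine_ge0.
  by rewrite fineK// ge0_fin_numE//; exact: integral_gauss_weight_lty.
have [ep [ep0 epE]] : exists ep : nat -> R, (forall k, 0 < ep k) /\
    forall k, ep k + ep k + ep k * W = 2^-1 * 4^-1 ^+ k.
  exists (fun k => 2^-1 * 4^-1 ^+ k / (2 + W)).
  have W2 : 0 < 2 + W by rewrite ltr_wpDr.
  split=> k; first by rewrite divr_gt0// mulr_gt0// exprn_gt0.
  rewrite -[RHS](@divfK _ (2 + W)) ?gt_eqF//.
  by move: (_ / _) => q; ring.
have /choice[g gP] k : exists g : E -> C, fourier_domain 1 g /\
    (Lpnorm mu 1 (inverse_fourier g \- hC)%R < (ep k)%:E)%E.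
  by have [_ /(_ _ (ep0 k))[g dg gh]] := fourier_domain_dense (lexx 1) LhC; exists g.
have /choice[r rP] k : exists r : R, 0 < r /\ forall x y, enorm (tsub x y) < r ->
    rnorm (inverse_fourier (g k) x - inverse_fourier (g k) y) <= ep k.
  by have [r r0 rg] := inverse_fourier_unif_cont (gP k).1.1 (ep0 k); exists r.
have /choice[v vP] k : exists v : R, 0 < v /\
    (\int[mu]_x (ball_indic (r k) x)%:E = v%:E)%E.
  by have [v v0 vE] := @integral_ball_indic R n.+1 _ (rP k).1; exists v.
pose w k x := rnorm (inverse_fourier (g k) x - hC x).
have mw k : measurable_fun setT (w k).
  exact: sm_rnorm (smB (gP k).1.2.1 mhC).
have w0 k x : 0 <= w k x := rnorm_ge0 _.
have wI k : (\int[mu]_x (w k x)%:E <= (ep k)%:E)%E.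
  by apply: le_trans (ltW (gP k).2); rewrite Lpnorm1.
have osc k x y : enorm (tsub x y) < r k -> `|h y - h x| <= w k y + w k x + ep k.
  move=> /(rP k).2 xy; rewrite -rnormC rmorphB /=.
  have quad (a b c d : C) e : rnorm (a - b) <= e ->
      rnorm (c - d) <= rnorm (b - c) + rnorm (a - d) + e.
    move=> ab; have := rnormB c b d; have := rnormB b a d.
    by rewrite (rnormBC c b) (rnormBC b a); lra.
  exact: quad xy.
pose F k x := (v k)^-1 * fine (ball_sum (r k) h x).
have mF k : measurable_fun setT (F k).
  apply: measurable_funM => //; apply: measurableT_comp => //.
  exact: measurable_ball_sum.
have FI k : (\int[mu]_x (gauss_weight x * `|F k x - h x|)%:E <= (2^-1 * 4^-1 ^+ k)%:E)%E.
  have vi : 0 <= (v k)^-1 by rewrite invr_ge0 ltW// (vP k).1.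
  have g0 (x : E) : 0 <= gauss_weight x := ltW (gauss_weight_gt0 x).
  have mb := @measurable_ball_sum R n.+1 (r k) _ (mw k) (w0 k).
  have mg : measurable_fun setT (fun x : E => (gauss_weight x)%:E).
    by apply/measurable_EFinP; exact: measurable_gauss_weight.
  have mwE : measurable_fun setT (fun x => (w k x)%:E) by exact/measurable_EFinP.
  have b0 x : (0 <= (v k)^-1%:E * ball_sum (r k) (w k) x)%E.
    by rewrite mule_ge0 ?lee_fin// ball_sum_ge0.
  have e0 (x : E) : (0 <= (ep k)%:E * (gauss_weight x)%:E)%E.
    by rewrite -EFinM lee_fin mulr_ge0 ?g0// ltW.
  apply: (@le_trans _ _ (\int[mu]_x ((v k)^-1%:E * ball_sum (r k) (w k) x +
      ((w k x)%:E + (ep k)%:E * (gauss_weight x)%:E)))%E).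
    apply: ge0_le_integral; [by []|by move=> x _; rewrite lee_fin mulr_ge0 ?g0| | |].
    - apply/measurable_EFinP; apply: measurable_funM; first exact: measurable_gauss_weight.
      by apply: measurableT_comp => //; exact: measurable_funB.
    - apply: emeasurable_funD; first exact: measurable_funeM.
      by apply: emeasurable_funD; [exact: mwE|exact: measurable_funeM].
    move=> x _.
    have := ball_sum_close mh h0 (bfin _ x) (mw k) (w0 k) (ltW (ep0 k)) (vP k).1 (vP k).2 (osc k x).
    have := b0 x; rewrite -/(F k x) EFinM EFinD.
    have := gauss_weight_le1 x; have := g0 x.
    move: (gauss_weight x) => q q0 q1.
    move: (_ * ball_sum _ _ _)%E => [B| |]//.
      rewrite lee_fin -!EFinD -!EFinM !lee_fin => B0 h1.
      have := w0 k x; have := ep0 k; have := normr_ge0 (F k x - h x).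
      move: (`|_|) h1 => D; move: (w k x) (ep k) => a e; nra.
    by move=> _ _; rewrite addye// leey.
  rewrite ge0_integralD; [|by []|by move=> x _|exact: measurable_funeM|
    by move=> x _; rewrite adde_ge0// lee_fin|
    by apply: emeasurable_funD; [exact: mwE|exact: measurable_funeM]].
  rewrite ge0_integralD; [|by []|by move=> x _; rewrite lee_fin|exact: mwE|
    by move=> x _; exact: e0|exact: measurable_funeM].
  rewrite ge0_integralZl_EFin; [|by []|by move=> x _; exact: ball_sum_ge0|exact: mb|exact: vi].
  rewrite (ge0_integralZl_EFin _ _ _ _ (ltW (ep0 k))); [|by []|
    by move=> x _; rewrite lee_fin|exact: mg].
  rewrite (integral_ball_sum (mw k) (w0 k) (ltW (vP k).1) (vP k).2) WE.
  rewrite muleA -EFinM mulVf ?gt_eqF ?(vP k).1// mul1e -EFinM.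
  by rewrite -epE !EFinD addeA; apply: leeD => //; apply: leeD; exact: wI.
have Fh : \forall x \ae mu, F k x @[k --> \oo] --> h x.
  have := @Lp_fast_ae _ _ _ mu 1 _ (fun k x => (gauss_weight x * F k x)%:C : C)
    (fun x => (gauss_weight x * h x)%:C) (lexx 1).
  have mgF q : measurable_fun setT q ->
      strongly_measurable (fun x : E => (gauss_weight x * q x)%:C : C).
    move=> mq; apply: sm_realC; apply: measurable_funM mq; exact: measurable_gauss_weight.
  move=> /(_ (fun k => mgF _ (mF k)) (mgF _ mh)) fast.
  have {fast} := fast _.
  move=> fast; have : \forall x \ae mu, (gauss_weight x * F k x)%:C @[k --> \oo] --> ((gauss_weight x * h x)%:C : C).
    apply: fast => k; apply: le_trans (FI k); rewrite Lpnorm1 le_eqVlt; apply/orP; left; apply/eqP.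
    apply: eq_integral => x _ /=; rewrite -rmorphB /= rnormC -mulrBr normrM.
    by rewrite (gtr0_norm (gauss_weight_gt0 x)).
  apply: filterS => x /rcvg_Re /= cF.
  have gn := gt_eqF (gauss_weight_gt0 x).
  rewrite -[h x](mulKf (negbT gn)) (_ : (fun k => F k x) =
     fun k => (gauss_weight x)^-1 * (gauss_weight x * F k x)).
    by apply: cvgM; [exact: cvg_cst|exact: cF].
  by apply/funext => k; rewrite mulKf ?gn.
exists (fun t => lim (F k (on_axis n t) @[k --> \oo])).
apply: filterS Fh => x Fx; apply/esym.
rewrite (_ : (fun k => F k (on_axis n (enorm x))) = (fun k => F k x)).
  exact: (cvg_lim _ Fx).
apply/funext => k; have [[U V] [iU Ux]] := iso_transitive x.
by rewrite -Ux /F (ball_sum_iso _ _ mh h0 iU (hU _ _ iU)).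
Qed.

End invariant_radial.

Section invariant_radial_complex.
Context {R : realType}.
Local Notation mu n := (@lebesgue_Rn R n).
Local Notation C := R[i].

Lemma invariant_radial_Lp1 n (f : Rn R n.+1 -> C) : Lp (mu n.+1) 1 f ->
  (forall U V, isometry U V -> \forall x \ae mu n.+1, f (U x) = f x) ->
  exists f0 : R -> C, \forall x \ae mu n.+1, f x = f0 (enorm x).
Proof.
move=> [mf fI] fU; have [mRe mIm] := (sm_complexP f).1 mf.
have part (L : C -> R) : measurable_fun setT (L \o f) ->
    (forall z, `|L z| <= rnorm z) ->
    exists h0 : R -> R, \forall x \ae mu n.+1, Num.max (L (f x)) 0 = h0 (enorm x).
  move=> mL L1.
  have mh : measurable_fun setT (fun x => Num.max (L (f x)) 0).
    exact: (measurable_maxr mL (measurable_cst _)).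
  apply: (invariant_radial_ge0 mh).
  - by move=> x; rewrite le_max lexx orbT.
  - move: fI; rewrite Lpnorm1; apply: le_lt_trans; apply: ge0_le_integral => //.
    + by move=> x _; rewrite lee_fin le_max lexx orbT.
    + exact/measurable_EFinP.
    + by apply/measurable_EFinP; exact: sm_rnorm.
    move=> x _; rewrite lee_fin ge_max rnorm_ge0 andbT.
    exact: le_trans (ler_norm _) (L1 _).
  by move=> U V iU; apply: filterS (fU _ _ iU) => x ->.
have [a aE] := part (@complex.Re R) mRe (@ler_Re_rnorm R).
have [b bE] := part (@complex.Im R) mIm (@ler_Im_rnorm R).
have [c cE] : exists h0 : R -> R,
    \forall x \ae mu n.+1, Num.max (- complex.Re (f x)) 0 = h0 (enorm x).
  apply: (part (fun z => - complex.Re z)) => [|z]; last by rewrite normrN ler_Re_rnorm.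
  exact: measurable_funN.
have [d dE] : exists h0 : R -> R,
    \forall x \ae mu n.+1, Num.max (- complex.Im (f x)) 0 = h0 (enorm x).
  apply: (part (fun z => - complex.Im z)) => [|z]; last by rewrite normrN ler_Im_rnorm.
  exact: measurable_funN.
have maxB (t : R) : t = Num.max t 0 - Num.max (- t) 0.
  have [t0|/ltW t0] := leP 0 t.
    by rewrite max_r ?subr0// oppr_le0.
  by rewrite max_l ?oppr_ge0// sub0r opprK.
exists (fun t => (a t - c t) +i* (b t - d t)).
apply: filterS2 (filterI aE bE) (filterI cE dE) => x [ax bx] [cx dx].
by rewrite -ax -bx -cx -dx -!maxB; case: (f x).
Qed.

(** The Gaussian weight, itself radial, reduces the statement to integrable
    functions. *)
Lemma invariant_radial n (m : Rn R n -> C) : (1 <= n)%N -> Linfty (mu n) m ->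
  (forall U V, isometry U V -> \forall x \ae mu n, m (U x) = m x) -> radial m.
Proof.
case: n m => // n m _ Lm mU.
have [f0 fE] : exists f0 : R -> C, \forall x \ae mu n.+1,
    m x * (gauss_weight x)%:C = f0 (enorm x).
  apply: invariant_radial_Lp1; first exact: (Lp1_fmul Lm (Lp1_gauss_weight n.+1)).
  by move=> U V iU; apply: filterS (mU _ _ iU) => x ->; rewrite (gauss_weight_iso _ iU).
exists (fun t => f0 t * ((expR (- t ^+ 2))%:C)^-1); apply/ae_eqE.
apply: filterS fE => x /= <-; rewrite sqr_enorm mulfK//.
exact: gauss_weightC_neq0.
Qed.

End invariant_radial_complex.

(** * Moments against radial functions *)

Section radial_part.
Context {R : realType} (n : nat).
Local Notation E := (Rn R n).
Local Notation mu := (@lebesgue_Rn R n).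
Local Notation C := R[i].
Local Notation B f := (bochner_integral mu f).
Implicit Types (phi psi c m h : E -> C).

Lemma radial_iso m U V : radial m -> isometry U V -> \forall x \ae mu, m (U x) = m x.
Proof.
move=> [m0 /ae_eqE mE] iU; apply: filterS2 mE (ae_mp (iso_mp iU) mE) => x -> ->.
by rewrite /= (iso_enorm _ iU).
Qed.

Lemma Lp1_weighted h : Linfty mu h -> Lp mu 1 (weighted h).
Proof.
move=> Lh; have := Lp1_fmul Lh (Lp1_gauss_weight n).
by congr Lp; apply/funext => x; rewrite /fmul /weighted mulrC.
Qed.

(** The pairing with radial functions determines a radial function, and all the
    elements of a hull have the same one. *)
Definition moment phi h : C := B (fmul phi (weighted h)).

Lemma Lp1_moment phi h : Linfty mu phi -> Linfty mu h ->
  Lp mu 1 (fmul phi (weighted h)).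
Proof. by move=> Lphi Lh; apply: Lp1_fmul Lphi (Lp1_weighted Lh). Qed.

Lemma moment_linear (a : C) phi psi h : Linfty mu phi -> Linfty mu psi ->
  Linfty mu h -> moment (fun x => a * phi x + psi x) h = a * moment phi h + moment psi h.
Proof.
move=> Lphi Lpsi Lh; have L1 := Lp1_moment Lphi Lh; have L2 := Lp1_moment Lpsi Lh.
have := bochner_integralD (LpZ a ltr01 L1) L2.
rewrite (bochner_integralZ a L1) => <-; congr (B _).
by apply/funext => x; rewrite /fmul /= scalerDl scalerA.
Qed.

Lemma LinftyD (a : C) phi psi : Linfty mu phi -> Linfty mu psi ->
  Linfty mu (fun x => a * phi x + psi x).
Proof.
move=> [mphi [M phiM]] [mpsi [N psiN]]; split.
  by apply: smD mpsi; apply: smM mphi; exact: sm_cst.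
exists (rnorm a * M + N); apply: filterS2 phiM psiN => x h1 h2.
apply: le_trans (rnormD _ _) _; rewrite rnormM; apply: lerD h2.
by apply: ler_wpM2l h1; exact: rnorm_ge0.
Qed.

(** A change of variables moves an isometry from [phi] to the radial function,
    which it leaves unchanged. *)
Lemma hull_moment phi c h : Linfty mu phi -> hull phi c -> Linfty mu h -> radial h ->
  moment c h = moment phi h.
Proof.
move=> Lphi hc Lh rh; elim: hc => [U V iU|c1 c2 h1 E1 h2 E2].
  have LU := Lp1_moment (hull_Linfty Lphi (hull_iso phi iU)) Lh.
  have L := Lp1_moment Lphi Lh.
  rewrite /moment -(bochner_integral_mp (iso_mp iU) L); apply: eq_bochner_integral LU _ _.
    exact: Lp_mp (iso_mp iU) L.
  apply: filterS (radial_iso rh iU) => x hx.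
  by rewrite /fmul /weighted /= hx (gauss_weight_iso _ iU).
have L1 := hull_Linfty Lphi h1; have L2 := hull_Linfty Lphi h2.
have half : (2^-1 : R)%:C * 2 = 1 :> C.
  by rewrite -[2 : C](rmorph_nat (real_complex R)) -[LHS](rmorphM (real_complex R)) mulVf.
have := moment_linear (2^-1 : R)%:C (LinftyD 1 L1 L2)
  (LinftyD (-1) (hull_Linfty Lphi (hull_self phi)) (hull_Linfty Lphi (hull_self phi))) Lh.
have z : moment (fun x => -1 * phi x + phi x) h = 0.
  by rewrite moment_linear// mulN1r addNr.
have s : moment (fun x => 1 * c1 x + c2 x) h = moment c1 h + moment c2 h.
  by rewrite moment_linear// mul1r.
have tw (y : C) : (2^-1 : R)%:C * (y + y) = y.
  by rewrite -mulr2n -[y *+ 2]mulr_natl mulrA half mul1r.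
rewrite z addr0 s E1 E2 tw => <-; congr (moment _ h); apply/funext => x.
by rewrite mul1r mulN1r addNr addr0.
Qed.

Lemma lim_moment (c : nat -> E -> C) m h (M : R) :
  (forall k, strongly_measurable (c k)) -> strongly_measurable m ->
  (forall k, \forall x \ae mu, rnorm (c k x) <= M) ->
  (\forall x \ae mu, c k x @[k --> \oo] --> m x) -> Linfty mu h ->
  moment (c k) h @[k --> \oo] --> moment m h.
Proof.
move=> mc mm cM cm Lh; have L := Lp1_weighted Lh.
apply: (bochner_integral_dominated (h := (`|M|)%:C \*: weighted h)).
- by move=> k; apply: smZ (mc k) L.1.
- exact: smZ mm L.1.
- exact: LpZ.
- by apply: filterS cm => x cx; apply: cvgZ; [exact: cx|exact: cvg_cst].
move=> k; apply: filterS (cM k) => x cx.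
have bound (a b : C) : rnorm a <= M -> rnorm (a *: b) <= rnorm ((`|M|)%:C *: b).
  move=> aM; rewrite !rnormZ rnormC normr_id ler_wpM2r ?rnorm_ge0//.
  exact: le_trans aM (ler_norm _).
exact: bound cx.
Qed.

(** The conjugate of the difference is itself a radial test function, and the
    corresponding moment is a weighted integral of the squared modulus. *)
Lemma moment_separated m m' : Linfty mu m -> Linfty mu m' -> radial m -> radial m' ->
  (forall h, Linfty mu h -> radial h -> moment m h = moment m' h) ->
  \forall x \ae mu, m x = m' x.
Proof.
move=> Lm Lm' [m0 /ae_eqE mE] [m0' /ae_eqE mE'] mm'.
pose e x := -1 * m' x + m x.
pose h x : C := complex.Re (e x) +i* (- complex.Im (e x)).
have Le : Linfty mu e by exact: LinftyD.
have Lh : Linfty mu h.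
  have [me [M eM]] := Le; have [mRe mIm] := (sm_complexP e).1 me; split.
    by apply/sm_complexP; split => //=; exact: measurable_funN.
  exists M; apply: filterS eM => x; apply: le_trans.
  by rewrite -ler_sqr ?nnegrE ?rnorm_ge0// !rnorm_sqr /= sqrrN.
have rh : radial h.
  exists (fun t => let z := -1 * m0' t + m0 t in complex.Re z +i* (- complex.Im z)).
  by apply/ae_eqE; apply: filterS2 mE mE' => x; rewrite /h /e /= => -> ->.
have L := Lp1_moment Le Lh.
have fE x : fmul e (weighted h) x = (gauss_weight x * rnorm (e x) ^+ 2)%:C.
  rewrite /fmul /weighted /h; case: (e x) => a b /=.
  rewrite rnorm_sqr /= -[LHS]/(_ * _); apply/eqP; rewrite eq_complex /=.
  by apply/andP; split; apply/eqP; ring.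
have : moment e h = 0.
  by rewrite moment_linear// mm'// mulN1r addNr.
move=> /(congr1 (@complex.Re R)); rewrite /moment bochner_integral_Re//= => I0.
have N0 : Lpnorm mu 1 (fmul e (weighted h)) = 0%E.
  rewrite Lpnorm1 -[LHS]fineK; last first.
    rewrite ge0_fin_numE; last by apply: integral_ge0 => x _; rewrite lee_fin rnorm_ge0.
    by have := L.2; rewrite Lpnorm1.
  congr EFin; rewrite -[RHS]I0; congr fine; apply: eq_integral => x _.
  by rewrite fE rnormC ger0_norm// mulr_ge0 ?sqr_ge0// ltW// gauss_weight_gt0.
apply: filterS (Lpnorm_eq0 ltr01 L.1 N0) => x; rewrite fE => /(congr1 (@complex.Re R))/eqP/=.
rewrite mulf_eq0 gt_eqF ?gauss_weight_gt0//= expf_eq0/= rnorm_eq0 /e mulN1r addrC subr_eq0.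
by move=> /eqP.
Qed.

End radial_part.

(** * Estimates inherited by the hull and by limits *)

Section hull_estimates.
Context {R : realType} (n : nat) (X : completeNormedModType R[i]) (p : R).
Hypothesis p1 : 1 <= p.
Local Notation E := (Rn R n).
Local Notation mu := (@lebesgue_Rn R n).
Local Notation C := R[i].
Implicit Types (phi c m : E -> C) (f g w : E -> X).

Let p0 : 0 < p. Proof. exact: lt_le_trans p1. Qed.

(** A sublinear function measures the size of the values; the class [W] consists
    of functions to which the argument is compared. The norm together with
    [W = {0}] yields boundedness; the distance to the positive half-line together
    with the positive functions yields positivity. *)
Variable N : X -> R.
Hypothesis N0 : forall x, 0 <= N x.
Hypothesis ND : forall x y, N (x + y) <= N x + N y.
Hypothesis NZ : forall (t : R) x, 0 <= t -> N (t%:C *: x) = t * N x.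
Hypothesis NL : forall x y, `|N x - N y| <= 2 * rnorm (x - y).
Variable W : (E -> X) -> Prop.
Hypothesis mW : forall w, W w -> strongly_measurable w.
Hypothesis WU : forall w U V, W w -> isometry U V -> W (w \o U).

Definition size_of f : E -> C := fun x => (N (f x))%:C.

Lemma cvg_size (u : nat -> X) x : u k @[k --> \oo] --> x ->
  N (u k) @[k --> \oo] --> N x.
Proof.
move=> /rcvgP ux; apply/cvgrPdist_le => e e0.
have e2 : 0 < e / 2 by rewrite divr_gt0.
have [M _ HM] := cvgr_dist_lt _ _ ux _ e2.
exists M => // k /HM; rewrite /= sub0r normrN ger0_norm ?rnorm_ge0// rnormBC => h.
by apply: le_trans (NL _ _) _; lra.
Qed.

Lemma sm_size f : strongly_measurable f -> strongly_measurable (size_of f).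
Proof.
move=> mf; apply: sm_realC; apply: (sm_measurable_cont mf) => u l.
exact: cvg_size.
Qed.

Definition size_bound (K : R) phi := forall g w, fourier_domain p g -> W w ->
  (Lpnorm mu p (size_of (inverse_fourier (fmul phi g))) <=
    K%:E * Lpnorm mu p (inverse_fourier g \- w)%R)%E.

Lemma fourier_domain_iso g U V : isometry U V -> fourier_domain p g ->
  fourier_domain p (g \o U) /\ inverse_fourier (g \o U) = inverse_fourier g \o U.
Proof.
move=> iU [Lg Fg].
have E1 : inverse_fourier (g \o U) = inverse_fourier g \o U.
  by apply/funext => x; exact: (inverse_fourier_iso _ iU Lg).
by split=> //; split; [exact: Lp_mp (iso_mp iU) Lg|rewrite E1; exact: Lp_mp (iso_mp iU) Fg].
Qed.

Lemma sm_fmul phi g : Linfty mu phi -> fourier_domain p g ->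
  strongly_measurable (inverse_fourier (fmul phi g)).
Proof. by move=> Lphi [Lg _]; apply: sm_inverse_fourier; exact: Lp1_fmul. Qed.

(** The transform of [(phi \o U) g] is that of [phi (g \o V)] composed with [U],
    which reduces the case of an isometry to a change of variables; midpoints are
    handled by sublinearity and Minkowski's inequality. *)
Lemma hull_size_bound K phi c : Linfty mu phi -> size_bound K phi -> hull phi c ->
  size_bound K c.
Proof.
move=> Lphi phiK; elim=> [U V iU|c1 c2 h1 IH1 h2 IH2] g w dg Ww.
  have iV := iso_sym iU.
  have [dgV gV] := fourier_domain_iso iV dg.
  have E1 : inverse_fourier (fmul (phi \o U) g) = inverse_fourier (fmul phi (g \o V)) \o U.
    apply/funext => x; rewrite -[RHS](inverse_fourier_iso _ iU); last exact: Lp1_fmul dgV.1.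
    by congr (inverse_fourier _ _); apply/funext => y; rewrite /fmul /= (isoK iU).
  rewrite E1 (_ : size_of _ = size_of (inverse_fourier (fmul phi (g \o V))) \o U)//.
  rewrite (Lpnorm_mp p (iso_mp iU)); last exact: sm_size (sm_fmul Lphi dgV).
  apply: le_trans (phiK _ _ dgV (WU Ww iV)) _.
  have mD : strongly_measurable (inverse_fourier g \- w) := smB dg.2.1 (mW Ww).
  by rewrite gV -[in leRHS](Lpnorm_mp p (iso_mp iV) mD).
have L1 := hull_Linfty Lphi h1; have L2 := hull_Linfty Lphi h2.
set A := inverse_fourier (fmul c1 g); set B := inverse_fourier (fmul c2 g).
have mA := sm_fmul L1 dg; have mB := sm_fmul L2 dg.
have E1 : inverse_fourier (fmul (fun x => (2^-1 : R)%:C * (c1 x + c2 x)) g) =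
    (fun x => (2^-1 : R)%:C *: (A x + B x)).
  apply/funext => x; rewrite /A /B -inverse_fourierD; [|exact: Lp1_fmul dg.1|exact: Lp1_fmul dg.1].
  rewrite -inverse_fourierZ; last by apply: LpD; [exact: lexx|exact: Lp1_fmul dg.1|exact: Lp1_fmul dg.1].
  congr (inverse_fourier _ _); apply/funext => y.
  by rewrite /fmul /= -scalerA scalerDl.
have half : 0 <= 2^-1 :> R by rewrite invr_ge0.
have mS := smD (sm_size mA) (sm_size mB).
rewrite E1; apply: (@le_trans _ _ (Lpnorm mu p ((2^-1 : R)%:C \*: (size_of A \+ size_of B))%R)).
  apply: le_Lpnorm; first exact: ltW.
  - by apply: sm_size; apply: smZl; exact: smD mA mB.
  - exact: smZl.
  apply: aeW => x; rewrite /size_of /= rnormZ !rnormC -rmorphD /= rnormC.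
  rewrite NZ// !normrM (ger0_norm half) (ger0_norm (N0 _)) ler_wpM2l//.
  by rewrite ger0_norm ?addr_ge0.
rewrite LpnormZ// rnormC (ger0_norm half).
apply: (@le_trans _ _ ((2^-1)%:E * (K%:E * Lpnorm mu p (inverse_fourier g \- w)%R +
    K%:E * Lpnorm mu p (inverse_fourier g \- w)%R))%E).
  apply: lee_wpmul2l; first by rewrite lee_fin.
  apply: le_trans (LpnormD mu p1 (sm_size mA) (sm_size mB)) _.
  by apply: leeD; [exact: IH1|exact: IH2].
set Q := (K%:E * _)%E.
case: Q => [q| |]; rewrite /= ?leey//.
  by rewrite -EFinD -EFinM lee_fin; lra.
by rewrite gt0_muleNy// lte_fin invr_gt0.
Qed.

(** The transforms converge at every point, so that Fatou's lemma applies. *)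
Lemma lim_size_bound K (M : R) (c : nat -> E -> C) m :
  (forall k, Linfty mu (c k)) -> Linfty mu m ->
  (forall k, \forall x \ae mu, rnorm (c k x) <= M) ->
  (\forall x \ae mu, c k x @[k --> \oo] --> m x) ->
  (forall k, size_bound K (c k)) -> size_bound K m.
Proof.
move=> Lc Lm cM cm cK g w dg Ww.
apply: (Lpnorm_fatou (f := fun k => size_of (inverse_fourier (fmul (c k) g))) p0).
- by move=> k; apply: sm_size; exact: sm_fmul.
- by apply: sm_size; exact: sm_fmul.
- apply: aeW => x; apply: rcvg_realC; apply: cvg_size.
  exact: inverse_fourier_multiplier_cvg (fun k => (Lc k).1) Lm.1 cM cm dg.1.
by apply: nearW => k; exact: cK.
Qed.

End hull_estimates.

(** * The projection onto radial multipliers *)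

Section radialization.
Context {R : realType} (n : nat).
Hypothesis n_ge1 : (1 <= n)%N.
Local Notation E := (Rn R n).
Local Notation mu := (@lebesgue_Rn R n).
Local Notation C := R[i].
Implicit Types (phi psi m h : E -> C).

(** Approximation by the hull carries the estimates and the moments; the
    uniqueness that makes the choice linear comes from the moments. *)
Definition radialization phi m := [/\ Linfty mu m, radial m &
  exists2 c : nat -> E -> C, (forall k, hull phi (c k)) &
    \forall x \ae mu, c k x @[k --> \oo] --> m x].

Definition radialize phi : E -> C := xget (cst 0) (radialization phi).

Lemma radializeP phi : Linfty mu phi -> radialization phi (radialize phi).
Proof.
move=> Lphi; apply: xgetPex.
have [m [Lm [c [hc cm mU]]]] := hull_invariant_limit Lphi.
by exists m; split => //; [exact: invariant_radial|exists c].
Qed.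

Lemma radialize_Linfty phi : Linfty mu phi -> Linfty mu (radialize phi).
Proof. by case/radializeP. Qed.

Lemma radialize_radial phi : Linfty mu phi -> radial (radialize phi).
Proof. by case/radializeP. Qed.

Lemma radialize_moment phi h : Linfty mu phi -> Linfty mu h -> radial h ->
  moment (radialize phi) h = moment phi h.
Proof.
move=> Lphi Lh rh; have [[mm _] _ [c hc cm]] := radializeP Lphi.
have [mphi [M phiM]] := Lphi.
have := lim_moment (fun k => hull_sm mphi (hc k)) mm
  (fun k => hull_bound phiM (hc k)) cm Lh.
rewrite (_ : (fun k => moment (c k) h) = fun=> moment phi h); last first.
  by apply/funext => k; exact: hull_moment (hc k) _ _.
by move=> /cvg_lim <- //; rewrite lim_cst.
Qed.

(** A radial function is the radialization of [phi] as soon as it has the same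
    moments; this yields all the algebraic properties. *)
Lemma radialize_unique phi m : Linfty mu phi -> Linfty mu m -> radial m ->
  (forall h, Linfty mu h -> radial h -> moment m h = moment phi h) ->
  \forall x \ae mu, radialize phi x = m x.
Proof.
move=> Lphi Lm rm mphi; apply: moment_separated => //.
- exact: radialize_Linfty.
- exact: radialize_radial.
by move=> h Lh rh; rewrite radialize_moment// mphi.
Qed.

Lemma radialize_id phi : Linfty mu phi -> radial phi ->
  \forall x \ae mu, radialize phi x = phi x.
Proof. by move=> Lphi rphi; exact: radialize_unique. Qed.

Lemma radialize_ae phi psi : Linfty mu phi -> Linfty mu psi ->
  (\forall x \ae mu, phi x = psi x) ->
  \forall x \ae mu, radialize phi x = radialize psi x.
Proof.
move=> Lphi Lpsi pp; apply: radialize_unique => //.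
- exact: radialize_Linfty.
- exact: radialize_radial.
move=> h Lh rh; rewrite radialize_moment//.
apply: eq_bochner_integral; [exact: Lp1_moment|exact: Lp1_moment|].
by apply: filterS pp => x; rewrite /fmul => ->.
Qed.

Lemma radialize_linear (a : C) phi psi : Linfty mu phi -> Linfty mu psi ->
  \forall x \ae mu, radialize (fun x => a * phi x + psi x) x =
    a * radialize phi x + radialize psi x.
Proof.
move=> Lphi Lpsi; have L1 := radialize_Linfty Lphi; have L2 := radialize_Linfty Lpsi.
apply: radialize_unique; [exact: LinftyD|exact: LinftyD| |].
  have [m1 /ae_eqE h1] := radialize_radial Lphi.
  have [m2 /ae_eqE h2] := radialize_radial Lpsi.
  exists (fun t => a * m1 t + m2 t); apply/ae_eqE.
  by apply: filterS2 h1 h2 => x -> ->.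
by move=> h Lh rh; rewrite !moment_linear// !radialize_moment.
Qed.

Lemma radialize_size_bound (X : completeNormedModType C) p (N : X -> R)
    (W : (E -> X) -> Prop) K phi : 1 <= p ->
  (forall x, 0 <= N x) -> (forall x y, N (x + y) <= N x + N y) ->
  (forall (t : R) x, 0 <= t -> N (t%:C *: x) = t * N x) ->
  (forall x y, `|N x - N y| <= 2 * rnorm (x - y)) ->
  (forall w, W w -> strongly_measurable w) ->
  (forall w U V, W w -> isometry U V -> W (w \o U)) ->
  Linfty mu phi -> size_bound p N W K phi -> size_bound p N W K (radialize phi).
Proof.
move=> p1 N0 ND NZ NL mW WU Lphi phiK.
have [Lm _ [c hc cm]] := radializeP Lphi; have [_ [M phiM]] := Lphi.
apply: (lim_size_bound p1 NL (c := c) (M := M)) => //.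
- by move=> k; exact: hull_Linfty (hc k).
- by move=> k; exact: hull_bound (hc k).
- by move=> k; exact: (hull_size_bound p1 N0 ND NZ NL mW WU Lphi phiK (hc k)).
Qed.

End radialization.

Section multiplier_radialization.
Context {R : realType} (n : nat) (p : R).
Hypothesis n_ge1 : (1 <= n)%N.
Hypothesis p1 : 1 <= p.
Local Notation E := (Rn R n).
Local Notation mu := (@lebesgue_Rn R n).
Local Notation C := R[i].

Let p0 : 0 < p. Proof. exact: lt_le_trans p1. Qed.

Lemma radialize_norm_bound (X : completeNormedModType C) (K : R) (phi : E -> C) :
  Linfty mu phi ->
  (forall g : E -> X, fourier_domain p g ->
    (Lpnorm mu p (inverse_fourier (fmul phi g)) <= K%:E * Lpnorm mu p (inverse_fourier g))%E) ->
  forall g : E -> X, fourier_domain p g ->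
    (Lpnorm mu p (inverse_fourier (fmul (radialize phi) g)) <=
      K%:E * Lpnorm mu p (inverse_fourier g))%E.
Proof.
move=> Lphi phiK g dg; have Lm := radialize_Linfty n_ge1 Lphi.
have rL (x y : X) : `|rnorm x - rnorm y| <= 2 * rnorm (x - y).
  by apply: le_trans (ler_rnorm_dist _ _) _; rewrite ler_peMl ?rnorm_ge0// ler1n.
have sizeE c (u : E -> X) : Linfty mu c -> fourier_domain p u ->
    Lpnorm mu p (size_of (@rnorm R X) (inverse_fourier (fmul c u))) =
    Lpnorm mu p (inverse_fourier (fmul c u)).
  move=> Lc du; apply: eq_Lpnorm; [exact: ltW| |exact: sm_fmul du|].
    by apply: (sm_size rL); exact: sm_fmul du.
  by apply: aeW => x; rewrite /size_of rnormC ger0_norm// rnorm_ge0.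
have sub0E (u : E -> X) : u \- cst 0 = u by apply/funext => x /=; rewrite subr0.
have := @radialize_size_bound R n n_ge1 X p (@rnorm R X) (fun w => w = cst 0) K phi p1
  (@rnorm_ge0 _ _) (@rnormD _ _) _ rL _ _ Lphi.
move=> /(_ _ _ _ _ g (cst 0) dg (erefl _)); rewrite sizeE// sub0E; apply.
- by move=> t x t0; rewrite rnormZ rnormC ger0_norm.
- by move=> w ->; exact: sm_cst.
- by move=> w U V ->.
- by move=> u w du ->; rewrite sizeE// sub0E; exact: phiK.
Qed.

Lemma radialize_multiplier (X : completeNormedModType C) (phi : E -> C) :
  multiplier p X phi -> multiplier p X (radialize phi).
Proof.
move=> [Lphi phiL [K phiK]]; have Lm := radialize_Linfty n_ge1 Lphi.
have mK := radialize_norm_bound Lphi phiK.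
split=> //; last by exists K.
move=> g dg; split; first exact: sm_fmul dg.
apply: le_lt_trans (mK _ dg) _.
have := dg.2.2; have := Lpnorm_ge0 mu p (inverse_fourier g).
by case: (Lpnorm _ _ _) => // r _ _; rewrite -EFinM ltry.
Qed.

Lemma radialize_multiplier_norm (X : completeNormedModType C) (phi : E -> C) :
  multiplier p X phi ->
  (multiplier_norm p X (radialize phi) <= multiplier_norm p X phi)%E.
Proof.
move=> Mphi; have [Lphi _ _] := Mphi.
have [bU Ug] := multiplier_operatorP p1 Mphi.
have [K [K0 KU UK]] := le_operator_norm p1 bU.
apply: le_trans KU; apply: operator_norm_le => //.
apply: (extends_multiplier_bound p1 (radialize_Linfty n_ge1 Lphi)
  (multiplier_operatorP p1 (radialize_multiplier Mphi)) K0).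
apply: radialize_norm_bound => // g dg.
rewrite -(eqae_Lpnorm p1 _ _ (Ug _ dg)); [exact: UK dg.2| |exact: sm_fmul dg].
by have [UL _ _ _] := bU; exact: (UL _ dg.2).1.
Qed.

Lemma radialize_projection (X : completeNormedModType C) :
  contractive_projection_onto_radial p X (@radialize R n).
Proof.
have L phi : multiplier p X phi -> Linfty mu phi by case.
split; first exact: radialize_multiplier.
- move=> phi psi /L Lphi /L Lpsi /ae_eqE pp; apply/ae_eqE; exact: radialize_ae.
- move=> a phi psi /L Lphi /L Lpsi; apply/ae_eqE; exact: radialize_linear.
split.
- move=> phi /L Lphi; apply/ae_eqE; apply: radialize_id => //.
    exact: radialize_Linfty.
  exact: radialize_radial.
- exact: radialize_multiplier_norm.
move=> psi Mpsi; split=> [[phi /L Lphi /ae_eqE pp]|[_ rpsi]].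
  split=> //; have [m0 /ae_eqE mE] := radialize_radial n_ge1 Lphi.
  by exists m0; apply/ae_eqE; apply: filterS2 pp mE => x -> ->.
by exists psi => //; apply/ae_eqE; apply: radialize_id => //; exact: L.
Qed.

End multiplier_radialization.

(** * Preservation of positivity *)

Section positivity.
Context {R : realType} (n : nat) (p : R).
Hypothesis n_ge1 : (1 <= n)%N.
Hypothesis p1 : 1 <= p.
Local Notation E := (Rn R n).
Local Notation mu := (@lebesgue_Rn R n).
Local Notation C := R[i].

Let p0 : 0 < p. Proof. exact: lt_le_trans p1. Qed.

(** Comparable to the distance to the nonnegative half-line, and sublinear. *)
Definition negativity (z : C) : R := `|complex.Im z| + Num.max (- complex.Re z) 0.

Lemma negativity_ge0 z : 0 <= negativity z.
Proof. by rewrite addr_ge0// le_max lexx orbT. Qed.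

Lemma negativity_eq0 z : negativity z = 0 <-> 0 <= z.
Proof.
rewrite lecE /= /negativity; split=> [h|/andP[/eqP-> r0]]; last first.
  by rewrite normr0 add0r max_r// oppr_le0.
have h1 : 0 <= Num.max (- complex.Re z) 0 by rewrite le_max lexx orbT.
have h2 := normr_ge0 (complex.Im z).
have h3 : - complex.Re z <= Num.max (- complex.Re z) 0 by rewrite le_max lexx.
apply/andP; split; last by lra.
by rewrite -normr_eq0; apply/eqP; lra.
Qed.

Lemma negativityD x y : negativity (x + y) <= negativity x + negativity y.
Proof.
rewrite /negativity !raddfD /=.
have h := ler_normD (complex.Im x) (complex.Im y).
have [a|a] := leP (- complex.Re x) 0; have [b|b] := leP (- complex.Re y) 0;
  have [c|c] := leP (- complex.Re x - complex.Re y) 0; lra.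
Qed.

Lemma negativityZ (t : R) z : 0 <= t -> negativity (t%:C *: z) = t * negativity z.
Proof.
move=> t0; rewrite /negativity; case: z => a b /=.
rewrite !mul0r subr0 addr0 normrM (ger0_norm t0) mulrDr; congr (_ + _).
by rewrite -mulrN -[X in Num.max _ X](mulr0 t) maxr_pMr.
Qed.

Lemma negativity_lip x y : `|negativity x - negativity y| <= 2 * rnorm (x - y).
Proof.
have le z : negativity z <= 2 * rnorm z.
  rewrite /negativity; have := ler_Re_rnorm z; have := ler_Im_rnorm z.
  have := ler_norm (- complex.Re z); rewrite normrN.
  have := rnorm_ge0 z; case: (leP (- complex.Re z) 0); lra.
rewrite ler_distl; apply/andP; split.
  have := negativityD x (y - x); rewrite addrC subrK; have := le (y - x).
  by rewrite rnormBC; lra.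
by have := negativityD y (x - y); rewrite addrC subrK; have := le (x - y); lra.
Qed.

(** Positivity of the operator bounds the negativity of [M_phi f] by the distance
    from [f] to the nonnegative functions, and this estimate passes to the hull
    and to limits, whereas positivity itself involves operators. *)
Lemma radialize_positive (phi : E -> C) : multiplier p C phi ->
  positive_operator p (multiplier_operator p C phi) ->
  positive_operator p (multiplier_operator p C (radialize phi)).
Proof.
move=> Mphi pos f Lf f0; have [Lphi _ _] := Mphi.
have [bU Ug] := multiplier_operatorP p1 Mphi.
set U := multiplier_operator p C phi in pos bU Ug *.
have [K [K0 _ UK]] := le_operator_norm p1 bU; have [UL _ _ _] := bU.
have sm_neg := sm_size (n := n) negativity_lip.
pose W (w : E -> C) := Lp mu p w /\ \forall x \ae mu, 0 <= w x.
have h2 : 0 <= 2 :> R by rewrite ler0n.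
have le_neg (u v : E -> C) : strongly_measurable u -> strongly_measurable v ->
    (\forall x \ae mu, negativity (u x) <= 2 * rnorm (v x)) ->
    (Lpnorm mu p (size_of negativity u) <= 2%:E * Lpnorm mu p v)%E.
  move=> mu' mv uv; apply: (@le_trans _ _ (Lpnorm mu p ((2 : R)%:C \*: v)%R)).
    apply: le_Lpnorm; [exact: ltW|exact: sm_neg mu'|exact: smZl mv|].
    apply: filterS uv => x uvx; rewrite /size_of rnormC (ger0_norm (negativity_ge0 _)).
    by rewrite -[X in _ <= rnorm X]/((2 : R)%:C *: v x) rnormZ rnormC (ger0_norm h2).
  by rewrite (LpnormZ mu _ p0 mv) rnormC (ger0_norm h2).
have phiN : size_bound p negativity W (2 * K) phi.
  move=> g w dg [Lw w0]; have LU := LpB p1 (UL _ dg.2) (UL _ Lw).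
  have Lgw := LpB p1 dg.2 Lw.
  apply: (@le_trans _ _ (2%:E * Lpnorm mu p (U (inverse_fourier g) \- U w)%R)%E).
    apply: le_neg; [exact: sm_fmul dg|exact: LU.1|].
    apply: filterS2 (Ug _ dg) (pos _ Lw w0) => x gx /negativity_eq0 wx.
    have := negativity_lip (U (inverse_fourier g) x) (U w x).
    by rewrite -(gx Logic.I) wx subr0 (ger0_norm (negativity_ge0 _)).
  rewrite (eqae_Lpnorm p1 LU.1 (UL _ Lgw).1 (bounded_operatorB p1 bU dg.2 Lw)).
  by rewrite EFinM -muleA; apply: lee_wpmul2l => //; exact: UK.
have mN : size_bound p negativity W (2 * K) (radialize phi).
  apply: (radialize_size_bound n_ge1 p1 negativity_ge0 negativityD negativityZ
    negativity_lip _ _ Lphi phiN) => [w [Lw _]|w A B [Lw w0] iA]; first exact: Lw.1.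
  by split; [exact: Lp_mp (iso_mp iA) Lw|exact: (ae_mp (iso_mp iA) w0)].
have Mm := radialize_multiplier n_ge1 p1 Mphi; have [Lm _ _] := Mm.
have [bV Vg] := multiplier_operatorP p1 Mm.
set V := multiplier_operator p C (radialize phi) in bV Vg *.
have [K' [K'0 _ VK]] := le_operator_norm p1 bV; have [VL _ _ _] := bV.
have mVf := sm_neg _ (VL _ Lf).1.
suff Nf0 : Lpnorm mu p (size_of negativity (V f)) = 0%E.
  apply: filterS (Lpnorm_eq0 p0 mVf Nf0) => x /(congr1 (@complex.Re R)) /=.
  by move/negativity_eq0.
apply/eqP; rewrite eq_le Lpnorm_ge0 andbT; apply/lee_addgt0Pr => e e0; rewrite add0e.
have KK : 0 < 2 * K + 2 * K' + 1 by lra.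
have [_ /(_ _ (divr_gt0 e0 KK))[g dg gf]] := fourier_domain_dense p1 Lf.
set d := e / _ in gf.
have mmg := sm_fmul Lm dg; have LVg := VL _ dg.2.
have LD := LpB p1 (VL _ Lf) LVg.
have mDC : strongly_measurable (V f \- V (inverse_fourier g)) := LD.1.
have mneg := sm_neg _ mmg.
have mr : strongly_measurable (fun x => (rnorm ((V f \- V (inverse_fourier g)) x))%:C : C).
  by apply: sm_realC; exact: sm_rnorm.
have rE : Lpnorm mu p (fun x => (rnorm ((V f \- V (inverse_fourier g)) x))%:C : C) =
    Lpnorm mu p (V f \- V (inverse_fourier g)).
  apply: eq_Lpnorm; [exact: ltW|exact: mr|exact: mDC|].
  by apply: aeW => x; rewrite rnormC (ger0_norm (rnorm_ge0 _)).
apply: (@le_trans _ _ (Lpnorm mu p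
    (size_of negativity (inverse_fourier (fmul (radialize phi) g)) \+
    ((2 : R)%:C \*: (fun x => (rnorm ((V f \- V (inverse_fourier g)) x))%:C : C)))%R)).
  apply: le_Lpnorm; [exact: ltW|exact: mVf|exact: smD mneg (smZl _ mr)|].
  apply: filterS (Vg _ dg) => x gx.
  have calc (a b c : R) : 0 <= b -> 0 <= c -> `|a - b| <= 2 * c ->
      a <= rnorm (b%:C + (2 : R)%:C *: (c%:C : C)).
    move=> b0 c0; rewrite -[_ *: _](rmorphM (real_complex R)) -rmorphD /= rnormC.
    by rewrite ler_distl ger0_norm => [/andP[_]//|]; lra.
  rewrite [X in X <= _]rnormC (ger0_norm (negativity_ge0 _)).
  apply: calc; [exact: negativity_ge0|exact: rnorm_ge0|].
  by rewrite -(gx Logic.I); exact: negativity_lip.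
apply: le_trans (LpnormD mu p1 mneg (smZl _ mr)) _.
rewrite (LpnormZ mu _ p0 mr) rnormC (ger0_norm h2) rE.
rewrite (eqae_Lpnorm p1 LD.1 (VL _ (LpB p1 Lf dg.2)).1 (bounded_operatorB p1 bV Lf dg.2)).
have b1 := mN g f dg (conj Lf f0).
have b2 := VK _ (LpB p1 Lf dg.2); rewrite LpnormBC in b2.
have gd := ltW gf.
have K20 : (0 <= (2 * K)%:E)%E by rewrite lee_fin mulr_ge0.
apply: (@le_trans _ _ ((2 * K)%:E * d%:E + 2%:E * (K'%:E * d%:E))%E).
  apply: leeD; first by apply: le_trans b1 _; apply: lee_wpmul2l.
  apply: lee_wpmul2l; first by rewrite lee_fin.
  by apply: le_trans b2 _; apply: lee_wpmul2l; rewrite ?lee_fin.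
rewrite -!EFinM -EFinD lee_fin.
have : d * (2 * K + 2 * K' + 1) = e by rewrite /d divfK// gt_eqF.
have : 0 < d by rewrite divr_gt0.
nra.
Qed.

End positivity.

Local Close Scope classical_set_scope.

Theorem theorem3 (R : realType) (n : nat) (n_ge1 : (1 <= n)%N)
    (p : R) (p_ge1 : 1 <= p) :
  exists P : forall X : completeNormedModType R[i],
      (Rn R n -> R[i]) -> (Rn R n -> R[i]),
    (forall X : completeNormedModType R[i],
       contractive_projection_onto_radial p X (P X)) /\
    (forall phi : Rn R n -> R[i],
       multiplier p R[i] phi ->
       positive_operator p (multiplier_operator p R[i] phi) ->
       positive_operator p (multiplier_operator p R[i] (P R[i] phi))).
Proof.
exists (fun _ => @radialize R n); split=> [X|phi Mphi].
  exact: radialize_projection.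
exact: radialize_positive.
Qed.
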